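(* Let $n\ge2$ be the dimension of the ambient space and let $1<p<\infty$. There is a constant $c_p>0$ (for the given dimension $n$) such that for every positive integer $N$ $$\inf_{\boldsymbol{\varepsilon} \in \{+,-\}^\Sigma}\ \sup_{\substack{\mathbb L\subset \mathbb Z^{\Sigma}\\ \# \mathbb L = N} }\ \sup_{\varnothing \subsetneq U\subseteq \Sigma} \Big\| f\mapsto \sup_{\boldsymbol{\ell} \in \mathbb L }\big| K_{U,\boldsymbol{\ell}}^{\boldsymbol{\varepsilon} } f\big|\Big\|_{L^p(\mathbb R^n)\to L^p(\mathbb R^n)} \geq c_p \Big(\sqrt{\log N}\Big)^{ \left\lfloor \frac n 2\right\rfloor}.$$
   Context: $\Sigma=\{(j,k):1\le j<k\le n\}$; for $\sigma=(j,k)\in\Sigma$ write $\sigma(1)=j$, $\sigma(2)=k$. Fix smooth functions $\phi^+,\phi^-:\mathbb R\to[0,1]$ with $\phi^+(x)=0$ for $x<-(n+1)$, $\phi^+(x)=1$ for $x>-n$; $\phi^-(x)=1$ for $x<-\frac1{2n}$, $\phi^-(x)=0$ for $x>-\frac1{2(n+1)}$. For $\sigma\in\Sigma$, $\ell\in\mathbb Z$ and a sign $\pm$, $K^{\pm}_{\sigma,\ell}$ is the Fourier multiplier operator on $\mathbb R^n$ with symbol $$\kappa^{\pm}_{\sigma,\ell}(\xi)=\phi^{\pm}\Big(2^{\ell}\,\frac{\xi_{\sigma(1)}}{\xi_{\sigma(2)}}\Big).$$ For $\varnothing\subsetneq U\subseteq\Sigma$, $\boldsymbol\ell=\{\ell_\sigma\}_{\sigma\in\Sigma}\in\mathbb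 Z^\Sigma$ and $\boldsymbol\varepsilon=\{\varepsilon_\sigma\}_{\sigma\in\Sigma}\in\{+,-\}^\Sigma$, $K^{\boldsymbol\varepsilon}_{U,\boldsymbol\ell}=\prod_{\sigma\in U}K^{\varepsilon_\sigma}_{\sigma,\ell_\sigma}$ (composition; only the components $\ell_\sigma,\varepsilon_\sigma$ with $\sigma\in U$ enter). *)

(* Defs.v *)
From HB Require Import structures.
From mathcomp Require Import all_boot all_order all_algebra finmap.
From mathcomp Require Import all_classical all_reals all_analysis.
From mathcomp Require Import complex.

Set Implicit Arguments.
Unset Strict Implicit.
Unset Printing Implicit Defensive.

Import Order.TTheory GRing.Theory Num.Theory.
Import numFieldNormedType.Exports.

Local Open Scope classical_set_scope.
Local Open Scope ring_scope.

Notation Rn R n := (n.-tuple (measurableTypeR R)).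

Section LebesgueRn.
Context {R : realType}.
Local Open Scope ereal_scope.

Definition cons_Rn n (p : measurableTypeR R * Rn R n) : Rn R n.+1 :=
  [tuple of p.1 :: p.2].

Fixpoint lebesgue_Rn n : set (Rn R n) -> \bar R :=
  match n with
  | 0 => \d_ ([tuple] : Rn R 0)
  | n'.+1 => pushforward (lebesgue_measure \x @lebesgue_Rn n') (@cons_Rn n')
  end.

Lemma measurable_cons_Rn n : measurable_fun [set: _] (@cons_Rn n).
Proof. exact: measurable_cons. Qed.

Section step.
Variables (n : nat) (m : {sigma_finite_measure set (Rn R n) -> \bar R}).

Let nu : set (Rn R n.+1) -> \bar R :=
  pushforward (lebesgue_measure \x m) (@cons_Rn n).

Let nuM : {measure set (Rn R n.+1) -> \bar R} :=
  measure_function_pushforward__canonical__measure_function_Measure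
    (lebesgue_measure \x m) (@measurable_cons_Rn n).

HB.instance Definition _ := isMeasure.Build _ _ _ nu
  (measure0 nuM) (measure_ge0 nuM) (@measure_semi_sigma_additive _ _ _ nuM).

Let nu_sigma_finite : sigma_finite [set: Rn R n.+1] nu.
Proof.
have /sigma_finiteP[F [TF ndF Foo]] :=
  @sigma_finiteT _ _ _ (@lebesgue_measure R).
have /sigma_finiteP[G [TG ndG Goo]] := @sigma_finiteT _ _ _ m.
pose uncons (t : Rn R n.+1) : measurableTypeR R * Rn R n :=
  (thead t, [tuple of behead t]).
have unconsK p : uncons (cons_Rn p) = p.
  by case: p => x t; congr pair; apply: val_inj.
have muncons : measurable_fun [set: Rn R n.+1] uncons.
  apply/measurable_fun_pairP; split; first exact: (measurable_tnth ord0).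
  exact: measurable_behead.
exists (fun k => uncons @^-1` (F k `*` G k)).
  rewrite predeqE => t; split => // _.
  have [i _ Fi] : (\bigcup_i F i) (thead t) by rewrite -TF.
  have [j _ Gj] : (\bigcup_i G i) [tuple of behead t] by rewrite -TG.
  exists (maxn i j) => //; split => /=.
  - by move: Fi; exact/subsetPset/ndF/leq_maxl.
  - by move: Gj; exact/subsetPset/ndG/leq_maxr.
move=> k; have [mF Fk] := Foo k; have [mG Gk] := Goo k.
split; first by rewrite -[X in measurable X]setTI; apply: muncons => //; exact: measurableX.
rewrite /nu /pushforward (_ : _ @^-1` _ = F k `*` G k); last first.
  by apply/funext => p /=; rewrite -[in RHS](unconsK p).
by rewrite product_measure1E// lte_mul_pinfty// ge0_fin_numE.
Qed.

HB.instance Definition _ := Measure_isSigmaFinite.Build _ _ _ nu nu_sigma_finite.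

Lemma lebesgue_Rn_step : exists m' : {sigma_finite_measure set (Rn R n.+1) -> \bar R},
  (m' : set _ -> \bar R) = pushforward (lebesgue_measure \x m) (@cons_Rn n).
Proof. by exists [the {sigma_finite_measure set _ -> \bar R} of nu]. Qed.

End step.

Let lebesgue_Rn_exists n :
  exists m : {sigma_finite_measure set (Rn R n) -> \bar R},
    (m : set (Rn R n) -> \bar R) = @lebesgue_Rn n.
Proof.
elim: n => [|n [m mE]].
  by exists [the {sigma_finite_measure set _ -> \bar R} of \d_ ([tuple] : Rn R 0)].
by rewrite /= -mE; exact: lebesgue_Rn_step.
Qed.

Variable n : nat.

Let lebesgue_Rn0 : @lebesgue_Rn n set0 = 0.
Proof. by have [m <-] := lebesgue_Rn_exists n. Qed.

Let lebesgue_Rn_ge0 A : 0 <= @lebesgue_Rn n A.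
Proof. by have [m <-] := lebesgue_Rn_exists n. Qed.

Let lebesgue_Rn_sigma_additive : semi_sigma_additive (@lebesgue_Rn n).
Proof.
by have [m <-] := lebesgue_Rn_exists n; exact: measure_semi_sigma_additive.
Qed.

HB.instance Definition _ := isMeasure.Build _ _ _ (@lebesgue_Rn n)
  lebesgue_Rn0 lebesgue_Rn_ge0 lebesgue_Rn_sigma_additive.

Let lebesgue_Rn_sigma_finite : sigma_finite [set: Rn R n] (@lebesgue_Rn n).
Proof. by have [m <-] := lebesgue_Rn_exists n; exact: sigma_finiteT. Qed.

HB.instance Definition _ := Measure_isSigmaFinite.Build _ _ _ (@lebesgue_Rn n)
  lebesgue_Rn_sigma_finite.

End LebesgueRn.
Arguments lebesgue_Rn {R n}.

Lemma lebesgue_Rn_box (R : realType) n (A : 'I_n -> set (measurableTypeR R)) :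
  (forall i, measurable (A i)) ->
  lebesgue_Rn [set x : Rn R n | forall i, A i (tnth x i)] =
    (\prod_(i < n) lebesgue_measure (A i))%E.
Proof.
elim: n => [|n IHn] in A * => mA.
  rewrite big_ord0 /= /dirac indicE mem_set//=; by case.
rewrite big_ord_recl -IHn//= /pushforward.
rewrite (_ : _ @^-1` _ = A ord0 `*` [set x | forall i, A (lift ord0 i) (tnth x i)]).
  rewrite product_measure1E//.
  rewrite (_ : [set x | _] = \bigcap_(i in [set: 'I_n]) ((@tnth n _ ^~ i) @^-1` A (lift ord0 i))).
    apply: fin_bigcap_measurable => // i _.
    by rewrite -[X in measurable X]setTI; exact: measurable_tnth.
  by apply/seteqP; split => x /= h i => [_|]; exact: h.
apply/seteqP; split => [[x t] /= h|[x t] /= [h0 h] i].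
  by split => [|i]; [exact: (h ord0)|have := h (lift ord0 i); rewrite tnthS].
by case: (unliftP ord0 i) => [j ->|->]; rewrite ?tnthS//; exact: h.
Qed.

Section Definitions.
Context {R : realType}.
Local Open Scope complex_scope.
Local Open Scope ring_scope.

Section functions.
Variable n : nat.
Local Notation fct := (Rn R n -> R[i]).
Implicit Types (f g h : fct) (m : Rn R n -> R) (p : R).

Definition LnormC p f : \bar R :=
  Lnorm lebesgue_Rn p%:E (fun x => (Normc.normc (f x))%:E).

Definition LfunC p f : Prop :=
  [/\ measurable_fun setT (fun x => complex.Re (f x)),
      measurable_fun setT (fun x => complex.Im (f x)) &
      (LnormC p f < +oo)%E].

Definition cvg_Lp p (u : nat -> fct) f : Prop :=
  (fun k => LnormC p (fun x => u k x - f x)) @ \oo --> (0 : \bar R).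

Definition integralC f : R[i] :=
  (\int[lebesgue_Rn]_x complex.Re (f x)) +i*
  (\int[lebesgue_Rn]_x complex.Im (f x)).

Definition cis (t : R) : R[i] := cos t +i* sin t.

Definition dot_Rn (x y : Rn R n) : R := \sum_(i < n) tnth x i * tnth y i.

Definition fourier f : fct :=
  fun xi => integralC (fun x => f x * cis (- (2 * pi * dot_Rn x xi))).

(* Operators on L^p are given by their graphs, functional up to equality almost
   everywhere.  [fourier_L2] is the graph of the extension by continuity to L^2
   of [fourier] restricted to the intersection of L^1 and L^2. *)
Definition fourier_L2 f g : Prop :=
  [/\ LfunC 2 f, LfunC 2 g &
      exists u : nat -> fct,
        [/\ forall k, LfunC 1 (u k) /\ LfunC 2 (u k),
            cvg_Lp 2 u f & cvg_Lp 2 (fun k => fourier (u k)) g]].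

Definition multiplier_L2 m f h : Prop :=
  exists g, fourier_L2 f g /\ fourier_L2 h (fun xi => (m xi)%:C * g xi).

(* The extension by density to L^p of [multiplier_L2 m] restricted to the
   intersection of L^2 and L^p. *)
Definition multiplier_op p m f h : Prop :=
  [/\ LfunC p f, LfunC p h &
      exists u v : nat -> fct,
        [/\ forall k, [/\ LfunC p (u k), LfunC p (v k) &
                          multiplier_L2 m (u k) (v k)],
            cvg_Lp p u f & cvg_Lp p v h]].

(* Composition; the order is immaterial, as multiplier operators commute. *)
Fixpoint multiplier_comp p (ms : seq (Rn R n -> R)) f h : Prop :=
  match ms with
  | [::] => f = h
  | m :: ms' => exists g, multiplier_comp p ms' f g /\ multiplier_op p m g h
  end.

(* The least [C] bounding the (possibly nonlinear) operator with graph [T]. *)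
Definition op_norm p (T : fct -> (Rn R n -> R) -> Prop) : \bar R :=
  ereal_inf [set C%:E | C in [set C : R | 0 <= C /\
    forall f F, LfunC p f -> T f F ->
      (Lnorm lebesgue_Rn p%:E (EFin \o F) <= C%:E * LnormC p f)%E]].

End functions.

Definition smooth (phi : R -> R) : Prop :=
  forall k x, derivable (derive1n k phi) x 1.

Definition cutoff_pos n (phi : R -> R) : Prop :=
  [/\ smooth phi, forall x, 0 <= phi x <= 1,
      forall x, x < - n.+1%:R -> phi x = 0 &
      forall x, - n%:R < x -> phi x = 1].

Definition cutoff_neg n (phi : R -> R) : Prop :=
  [/\ smooth phi, forall x, 0 <= phi x <= 1,
      forall x, x < - (2 * n%:R)^-1 -> phi x = 1 &
      forall x, - (2 * n.+1%:R)^-1 < x -> phi x = 0].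

End Definitions.

(* Coordinates are numbered from 0. *)
Definition Sigma n := {s : 'I_n * 'I_n | (s.1 < s.2)%N}.

(* Signs are booleans, [true] standing for [+]. *)
Definition signs n := {ffun Sigma n -> bool}.
Definition scales n := {ffun Sigma n -> int}.

Section Maximal.
Context {R : realType}.
Variables (n : nat) (phip phim : R -> R).
Implicit Types (p : R) (e : signs n) (l : scales n) (U : {set Sigma n}).

(* On the null set [xi_(s.2) = 0] the quotient is [0]. *)
Definition kappa (e : bool) (s : Sigma n) (l : int) (xi : Rn R n) : R :=
  (if e then phip else phim)
    (2%:R ^ l * (tnth xi (val s).1 / tnth xi (val s).2)).

Definition K_op p e U l : (Rn R n -> R[i]) -> (Rn R n -> R[i]) -> Prop :=
  multiplier_comp p [seq kappa (e s) s (l s) | s <- enum U].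

Definition max_op p e U (L : {fset scales n})
    (f : Rn R n -> R[i]) (F : Rn R n -> R) : Prop :=
  exists2 h : scales n -> Rn R n -> R[i],
    forall l, l \in L -> K_op p e U l f (h l) &
    forall x, F x = \big[Num.max/0]_(l <- L) Normc.normc (h l x).

End Maximal.

(* Main.v *)
Require Import Defs.
From HB Require Import structures.
From mathcomp Require Import all_boot all_order all_algebra finmap.
From mathcomp Require Import all_classical all_reals all_analysis.
From mathcomp Require Import measurable_realfun complex.
From mathcomp Require Import ring lra zify.

(** The lower bound comes from one set of directions and from one test function for
each sign pattern and each [N].

Directions.  Let [k = n./2] and let [U] consist of the [k] pairs [(2 i, 2 i + 1)].  These
pairs have no coordinate in common, so the multipliers of different pairs act on different
variables, and a product construction multiplies the gains.  It remains to gain a factor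
[sqrt (d + 1)] for one pair with [2 ^ d] scales: with [k] pairs this uses
[2 ^ (d * k)] scales, and the largest admissible [d] satisfies [k * (d + 1) >= log N] up
to a constant.

One pair.  A dilated cutoff is constant, equal to [0] or [1], on narrow sectors of
the plane around a lacunary sequence of directions, and the multipliers of the various scales
keep exactly the sectors on one side of a threshold ([cutoff_const]).  Attach the sectors to
the nodes of the complete binary tree of depth [d], in in-order.  If the spectrum of each term
of [f = \sum_s piece s] lies in the sector of the node [s], the maximal operator contains all
in-order partial sums of this series, one for each of the [2 ^ d] leaves.

The tree sum is such a series with large partial sums.  Let independent signs [r (th s)] sit
at the nodes, let a path follow them from the root, to the right where the sign is positive,
and let [piece s] be the sign at [s] if the path visits [s] and zero otherwise.  The full sum
is a sum of [d + 1] independent signs, of size [sqrt (d + 1)] in every L^p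
([mean_tree_sum_moment]).  But a node of the path precedes, in in-order, the leaf that the path
reaches exactly when the path turns right there, that is when its sign is positive; so the
partial sum at this leaf is the number of right turns, of order [d + 1]
([mean_linearised_ge]).  Choosing the leaf in this way is the linearisation of the maximal
function.

Realisation in frequency.  Signs are replaced by an odd trigonometric polynomial with values
in [[-1, 1]] and second moment close to [1] ([near_sign]).  The angle at a node becomes the
phase [T ^ h (x_(2 i + 1) - rho x_(2 i))], where [rho] is the direction of the sector of the
node and the integer [h] increases along the paths.  The weight of a node involves only its
ancestors, so the frequency of its piece is led by its own angle and lies in its sector once
[T] is large ([span_piece], [sector_freq]).  As [T] tends to infinity the angles become
independent, by the Riemann-Lebesgue lemma ([mean_limit]).  Everything is multiplied by a
tensor power of the Fejer kernel, whose Fourier transform has compact support; all Fourier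
transforms are then explicit ([spec_cos]), and the multipliers act on the test function by
selecting pieces ([K_op_filtered]).

Norms.  To compare L^p norms with averages of polynomials in [r], the norm of the test function
is bounded by an even moment and that of the maximal function is bounded below by the tangent to
the p-th power ([powR_le_even_power], [powR_tangent], [norm_gain]). *)

Set Implicit Arguments.
Unset Strict Implicit.
Unset Printing Implicit Defensive.

Import Order.TTheory GRing.Theory Num.Theory.
Import numFieldNormedType.Exports.

Local Open Scope classical_set_scope.
Local Open Scope ring_scope.

(** * Averages over grids of angles *)

Section GridMean.
Variables (R : realType) (M : nat).
Hypothesis M_gt0 : (0 < M)%N.
Implicit Types (h : R -> R).

Definition avg h : R := M%:R^-1 * \sum_(x < M) h (x%:R / M%:R).

Lemma avgD h1 h2 : avg (fun x => h1 x + h2 x) = avg h1 + avg h2.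
Proof. by rewrite /avg big_split mulrDr. Qed.

Lemma avgZ c h : avg (fun x => c * h x) = c * avg h.
Proof. by rewrite /avg -mulr_sumr mulrCA. Qed.

Lemma avg_cst c : avg (fun=> c) = c.
Proof.
rewrite /avg sumr_const card_ord -[c *+ M]mulr_natl mulrA mulVf ?mul1r//.
by rewrite pnatr_eq0 -lt0n.
Qed.

Lemma le_avg h1 h2 : (forall x, h1 x <= h2 x) -> avg h1 <= avg h2.
Proof.
by move=> h12; rewrite ler_wpM2l ?invr_ge0// ler_sum.
Qed.

(** Each term telescopes, being a difference of two sines half a step away. *)
Lemma sum_cos_arith (a phi : R) n : 2 * sin (a / 2) * \sum_(x < n) cos (phi + x%:R * a) =
  sin (phi + n%:R * a - a / 2) - sin (phi - a / 2).
Proof.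
elim: n => [|n IHn]; first by rewrite big_ord0 mulr0 mul0r addr0 subrr.
rewrite big_ord_recr/= mulrDr IHn.
have -> : phi + n.+1%:R * a - a / 2 = phi + n%:R * a + a / 2 by rewrite -natr1; field.
set y := phi + n%:R * a; rewrite (sinB y) (sinD y); ring.
Qed.

Lemma sin_add2pi (k : int) (x : R) : sin (x + k%:~R * (2 * pi)) = sin x.
Proof.
have P (n : nat) y : sin (y + n%:R * (2 * pi)) = sin y :> R.
  have -> : n%:R * (2 * pi) = (pi *+ 2) *+ n :> R.
    by rewrite -[RHS]mulr_natl -[pi *+ 2]mulr_natl.
  exact: (periodicn (@sinD2pi R)).
case: k => n; first by rewrite -pmulrn P.
by rewrite NegzE mulrNz mulNr -pmulrn -(P n.+1) subrK.
Qed.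

(** A character of the grid [{0, 1/M, .., (M - 1)/M}] that is not trivial has mean
    zero; below [M] no non-zero frequency is trivial.  This is the only
    orthogonality used, so that averages over grids replace a probability space. *)
Lemma avg_cos (phi : R) (k : int) : (absz k < M)%N ->
  avg (fun x => cos (phi + 2 * pi * (k%:~R * x))) = if k == 0 then cos phi else 0.
Proof.
move=> kM; have M0 : M%:R != 0 :> R by rewrite pnatr_eq0 -lt0n.
case: eqVneq => [->|k0].
  under [X in avg X]funext do rewrite mul0r mulr0 addr0.
  exact: avg_cst.
pose a : R := 2 * pi * k%:~R / M%:R.
(* [0 < |a / 2| < pi] because [0 < |k| < M]. *)
have saN0 : sin (a / 2) != 0.
  have : sin (`|a / 2|) != 0.
    rewrite gt_eqF// sin_gt0_pi//; apply/andP; split.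
      rewrite normr_gt0 /a !mulf_neq0 ?invr_eq0 ?intr_eq0//.
      by rewrite gt_eqF// pi_gt0.
    have -> : a / 2 = pi * (k%:~R / M%:R) by rewrite /a; field.
    rewrite normrM (gtr0_norm (pi_gt0 _)) gtr_pMr ?pi_gt0//.
    rewrite normrM normfV normr_nat ltr_pdivrMr ?mul1r ?ltr0n//.
    by rewrite -intr_norm -[M%:R]/(M%:~R) ltr_int; move: kM; rewrite -ltz_nat abszE.
  by case: (leP 0 (a / 2)) => [/ger0_norm|/ltr0_norm] ->; rewrite ?sinN ?oppr_eq0.
have := sum_cos_arith a phi M.
have -> : phi + M%:R * a - a / 2 = phi - a / 2 + k%:~R * (2 * pi).
  by rewrite /a; field.
rewrite sin_add2pi subrr => /eqP; rewrite mulf_eq0 mulf_eq0 pnatr_eq0 (negPf saN0)/=.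
move=> /eqP s0; rewrite /avg (eq_bigr (fun x : 'I_M => cos (phi + x%:R * a))) ?s0 ?mulr0// => i _.
by congr cos; rewrite /a; field.
Qed.

Definition subtree (b : bool) (th : seq bool -> R) : seq bool -> R := fun s => th (b :: s).

(** An assignment of one angle to every node of the infinite binary tree is a
    function of the path from the root, [false] being a left turn. *)
Definition graft (x : R) (a b : seq bool -> R) : seq bool -> R := fun s =>
  match s with [::] => x | false :: s' => a s' | true :: s' => b s' end.

(** The expectation of a function of the nodes of depth at most [d], the angles
    being independent and uniform on the grid.  Recursion on the depth makes the
    independence of the root and of the two subtrees definitional. *)
Fixpoint tree_mean d (H : (seq bool -> R) -> R) : R :=
  match d with
  | 0 => avg (fun x => H (fun=> x))
  | d'.+1 => avg (fun x => tree_mean d' (fun a => tree_mean d' (fun b => H (graft x a b))))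
  end.

Lemma tree_meanD d H1 H2 : tree_mean d (fun th => H1 th + H2 th) = tree_mean d H1 + tree_mean d H2.
Proof.
elim: d H1 H2 => [|d IHd] H1 H2 /=; first exact: avgD.
rewrite -avgD; congr avg; apply/funext => x; rewrite -IHd; congr tree_mean.
by apply/funext => a; rewrite -IHd.
Qed.

Lemma tree_meanZ d c H : tree_mean d (fun th => c * H th) = c * tree_mean d H.
Proof.
elim: d H => [|d IHd] H /=; first exact: avgZ.
rewrite -avgZ; congr avg; apply/funext => x; rewrite -IHd; congr tree_mean.
by apply/funext => a; rewrite -IHd.
Qed.

Lemma tree_mean_cst d c : tree_mean d (fun=> c) = c.
Proof.
elim: d => [|d IHd] /=; first exact: avg_cst.
by under [X in avg X]funext do rewrite IHd IHd; exact: avg_cst.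
Qed.

Lemma le_tree_mean d H1 H2 : (forall th, H1 th <= H2 th) -> tree_mean d H1 <= tree_mean d H2.
Proof.
elim: d H1 H2 => [|d IHd] H1 H2 H12 /=; first by apply: le_avg.
by apply: le_avg => x; apply: (IHd) => a; apply: (IHd) => b.
Qed.

(** Independence of the root and of the two subtrees. *)
Lemma tree_mean_split d A B C :
  tree_mean d.+1 (fun th => A (th [::]) * B (subtree false th) * C (subtree true th)) =
  avg A * tree_mean d B * tree_mean d C.
Proof.
rewrite /= -mulrA mulrC -avgZ; congr avg; apply/funext => x.
rewrite mulrC mulrA [_ * tree_mean d C]mulrC -!tree_meanZ; congr tree_mean; apply/funext => a.
by rewrite mulrC -tree_meanZ; congr tree_mean.
Qed.

Fixpoint paths d : seq (seq bool) :=
  match d with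
  | 0 => [:: [::]]
  | d'.+1 => [::] :: map (cons false) (paths d') ++ map (cons true) (paths d')
  end.

Lemma big_paths (F : seq bool -> R) d : \sum_(s <- paths d.+1) F s =
  F [::] + (\sum_(s <- paths d) F (false :: s) + \sum_(s <- paths d) F (true :: s)).
Proof. by rewrite big_cons big_cat !big_map. Qed.

Lemma tree_mean_cos d (phi : R) (k : seq bool -> int) :
  (forall s, s \in paths d -> (absz (k s) < M)%N) ->
  tree_mean d (fun th => cos (phi + 2 * pi * \sum_(s <- paths d) (k s)%:~R * th s)) =
  if all (fun s => k s == 0) (paths d) then cos phi else 0.
Proof.
elim: d phi k => [|d IHd] phi k kM.
  rewrite /= andbT -(avg_cos phi); last by rewrite kM ?mem_seq1.
  by congr avg; apply/funext => x; rewrite big_seq1.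
have kf s : s \in paths d -> (absz (k (false :: s)) < M)%N.
  by move=> sd; rewrite kM// inE/= mem_cat map_f.
have kt s : s \in paths d -> (absz (k (true :: s)) < M)%N.
  by move=> sd; rewrite kM// inE/= mem_cat map_f// orbT.
set af := all (fun s => k (false :: s) == 0) (paths d).
set at_ := all (fun s => k (true :: s) == 0) (paths d).
have -> : all (fun s => k s == 0) (paths d.+1) = (k [::] == 0) && (af && at_).
  by rewrite /= all_cat !all_map.
rewrite [LHS]/= (_ : avg _ = avg (fun x => if af then
   if at_ then cos (phi + 2 * pi * ((k [::])%:~R * x)) else 0 else 0)); last first.
  congr avg; apply/funext => x.
  transitivity (tree_mean d (fun a => if at_ then
     cos (phi + 2 * pi * ((k [::])%:~R * x) + 2 * pi * \sum_(s <- paths d) (k (false :: s))%:~R * a s) else 0)).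
    congr tree_mean; apply/funext => a; rewrite -IHd//; congr tree_mean; apply/funext => b.
    by congr cos; rewrite -/(paths d.+1) big_paths/=; ring.
  by case: at_; rewrite ?IHd// tree_mean_cst if_same.
case: af; last by rewrite andbF avg_cst.
case: at_; last by rewrite /= andbF avg_cst.
by rewrite /= andbT avg_cos ?kM ?inE.
Qed.

Definition forest_cons (a : seq bool -> R) (th : nat -> seq bool -> R) : nat -> seq bool -> R :=
  fun i => if i is j.+1 then th j else a.

(** Expectation for [n] independent trees. *)
Fixpoint forest_mean d n (H : (nat -> seq bool -> R) -> R) : R :=
  match n with
  | 0 => H (fun _ _ => 0)
  | n'.+1 => tree_mean d (fun a => forest_mean d n' (fun th => H (forest_cons a th)))
  end.

Lemma forest_meanD d n H1 H2 : forest_mean d n (fun th => H1 th + H2 th) = forest_mean d n H1 + forest_mean d n H2.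
Proof.
elim: n H1 H2 => [|n IHn] H1 H2 //=.
by rewrite -tree_meanD; congr tree_mean; apply/funext => x; rewrite -IHn.
Qed.

Lemma forest_meanZ d n c H : forest_mean d n (fun th => c * H th) = c * forest_mean d n H.
Proof.
elim: n H => [|n IHn] H //=.
by rewrite -tree_meanZ; congr tree_mean; apply/funext => x; rewrite -IHn.
Qed.

Lemma forest_mean_cst d n c : forest_mean d n (fun=> c) = c.
Proof.
by elim: n => [|n IHn] //=; under [X in tree_mean d X]funext do rewrite IHn; exact: tree_mean_cst.
Qed.

(** Independence of the trees. *)
Lemma forest_mean_prod d n (H : (seq bool -> R) -> R) :
  forest_mean d n (fun th => \prod_(i < n) H (th i)) = tree_mean d H ^+ n.
Proof.
elim: n => [|n IHn] /=; first by rewrite big_ord0.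
rewrite exprS -IHn mulrC -tree_meanZ; congr tree_mean; apply/funext => a.
rewrite mulrC -forest_meanZ; congr forest_mean; apply/funext => th.
by rewrite big_ord_recl.
Qed.

Lemma forest_mean_cos d n (phi : R) (k : nat -> seq bool -> int) :
  (forall i s, (i < n)%N -> s \in paths d -> (absz (k i s) < M)%N) ->
  forest_mean d n (fun th => cos (phi +
     2 * pi * \sum_(i < n) \sum_(s <- paths d) (k i s)%:~R * th i s)) =
  if all (fun i => all (fun s => k i s == 0) (paths d)) (iota 0 n) then cos phi else 0.
Proof.
elim: n phi k => [|n IHn] phi k kM; first by rewrite /= big_ord0 mulr0 addr0.
rewrite /= (iotaDl 1 0) all_map.
transitivity (tree_mean d (fun a => if all (fun i => all (fun s => k i.+1 s == 0) (paths d)) (iota 0 n) then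
   cos (phi + 2 * pi * \sum_(s <- paths d) (k 0%N s)%:~R * a s) else 0)).
  congr tree_mean; apply/funext => a.
  rewrite -(IHn _ (fun i => k i.+1)); last by move=> i s ? ?; exact: kM.
  congr forest_mean; apply/funext => th; congr cos.
  by rewrite big_ord_recl/= mulrDr addrA.
rewrite (_ : all (preim _ _) _ = all (fun i => all (fun s => k i.+1 s == 0) (paths d)) (iota 0 n))//.
case: (all _ (iota 0 n)); last by rewrite tree_mean_cst andbF.
by rewrite andbT tree_mean_cos// => s ?; exact: kM.
Qed.

End GridMean.

(** * Tree sums and their truncated partial sums *)

Section Tree.
Variables (R : realType) (r : R -> R).

(** When [r x] is a sign this is the indicator of the event that the path turns
    to the side [b] at a node of angle [x]: to the right if the sign is positive.
    In general it is a conditional probability. *)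
Definition branch (b : bool) (x : R) : R := (1 + (if b then r x else - r x)) / 2.

(** The probability of reaching the node [s], given the angles. *)
Fixpoint weight (s : seq bool) (th : seq bool -> R) : R :=
  if s is b :: s' then branch b (th [::]) * weight s' (subtree b th) else 1.

Definition piece (s : seq bool) (th : seq bool -> R) : R := weight s th * r (th s).

(** In-order: a node comes after its left subtree and before its right subtree.
    A leaf [t] stands for the gap on the right of the last node of its path, so a
    node above it precedes it exactly when the path turns right there. *)
Fixpoint before (s t : seq bool) : bool :=
  match t, s with
  | [::], _ => true
  | b :: _, [::] => b
  | b :: t', c :: s' => if c == b then before s' t' else b
  end.

Fixpoint leaves d : seq (seq bool) :=
  if d is d'.+1 then map (cons false) (leaves d') ++ map (cons true) (leaves d')
  else [:: [::]].

(** If [r] is a sign, a random path is followed and this is the sum of the signs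
    met on it, hence a sum of [d + 1] independent signs, of size [sqrt (d + 1)]. *)
Definition tree_sum d (th : seq bool -> R) : R := \sum_(s <- paths d) piece s th.

(** If [r] is a sign and the path ends in [t], only the nodes at which the path turns
    right contribute, and they contribute [1] each: [(d + 1) / 2] on average. *)
Definition part_sum d (t : seq bool) (th : seq bool -> R) : R :=
  \sum_(s <- paths d | before s t) piece s th.

(** The last turn is a right turn because [before _ t] contains the node [t]
    itself. *)
Definition leaf_weight (t : seq bool) th : R := weight t th * branch true (th t).

Definition leaf_total d th : R := \sum_(t <- leaves d) leaf_weight t th.

(** The maximal partial sum is linearised by choosing the leaf which the random path
    reaches.  The result is a polynomial in [r], whose mean can be computed. *)
Definition linearised d th : R := \sum_(t <- leaves d) leaf_weight t th * part_sum d t th.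

Lemma piece_cons b s th : piece (b :: s) th = branch b (th [::]) * piece s (subtree b th).
Proof. by rewrite /piece/= mulrA. Qed.

Lemma tree_sumS d th : tree_sum d.+1 th = r (th [::]) +
  (branch false (th [::]) * tree_sum d (subtree false th) +
   branch true (th [::]) * tree_sum d (subtree true th)).
Proof.
rewrite /tree_sum big_paths {1}/piece/= mul1r !mulr_sumr.
by under eq_bigr do rewrite piece_cons; under [X in _ + (_ + X)]eq_bigr do rewrite piece_cons.
Qed.

Lemma part_sum_false d t th : part_sum d.+1 (false :: t) th =
  branch false (th [::]) * part_sum d t (subtree false th).
Proof.
rewrite /part_sum big_mkcond big_paths/= add0r [X in _ + X]big1// addr0.
rewrite mulr_sumr [RHS]big_mkcond; apply: eq_bigr => s _.
by case: ifP => // _; rewrite piece_cons.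
Qed.

Lemma part_sum_true d t th : part_sum d.+1 (true :: t) th = r (th [::]) +
  (branch false (th [::]) * tree_sum d (subtree false th) +
   branch true (th [::]) * part_sum d t (subtree true th)).
Proof.
rewrite /part_sum big_mkcond big_paths/= {1}/piece/= mul1r; congr (_ + (_ + _)).
  by rewrite mulr_sumr; apply: eq_bigr => s _; rewrite piece_cons.
rewrite mulr_sumr [RHS]big_mkcond; apply: eq_bigr => s _.
by case: ifP => // _; rewrite piece_cons.
Qed.

Lemma big_leaves (F : seq bool -> R) d : \sum_(t <- leaves d.+1) F t =
  \sum_(t <- leaves d) F (false :: t) + \sum_(t <- leaves d) F (true :: t).
Proof. by rewrite big_cat !big_map. Qed.

Lemma leaf_weight_cons b t th :
  leaf_weight (b :: t) th = branch b (th [::]) * leaf_weight t (subtree b th).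
Proof. by rewrite /leaf_weight/= mulrA. Qed.

Lemma leaf_totalS d th : leaf_total d.+1 th =
  branch false (th [::]) * leaf_total d (subtree false th) +
  branch true (th [::]) * leaf_total d (subtree true th).
Proof.
rewrite /leaf_total big_leaves !mulr_sumr.
by congr (_ + _); apply: eq_bigr => t _; rewrite leaf_weight_cons.
Qed.

Lemma linearisedS d th : linearised d.+1 th =
  branch false (th [::]) ^+ 2 * linearised d (subtree false th) +
  (branch true (th [::]) * r (th [::]) * leaf_total d (subtree true th) +
   (branch true (th [::]) * branch false (th [::]) * tree_sum d (subtree false th) *
      leaf_total d (subtree true th) +
    branch true (th [::]) ^+ 2 * linearised d (subtree true th))).
Proof.
rewrite /linearised /leaf_total big_leaves; congr (_ + _).
  by rewrite mulr_sumr; apply: eq_bigr => t _; rewrite leaf_weight_cons part_sum_false; ring.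
under eq_bigr do rewrite leaf_weight_cons part_sum_true.
move: (tree_sum d _) => T; rewrite !mulr_sumr -!big_split/=.
by apply: eq_bigr => t _; ring.
Qed.

Section Bounded.
Hypothesis r_le1 : forall x, `|r x| <= 1.

Lemma branch_ge0 b x : 0 <= branch b x.
Proof.
rewrite divr_ge0//; have := r_le1 x; rewrite ler_norml => /andP[].
by case: b; lra.
Qed.

Lemma branch_sum x : branch false x + branch true x = 1.
Proof. by rewrite /branch; field. Qed.

Lemma weight_ge0 s th : 0 <= weight s th.
Proof. by elim: s th => [|b s IHs] th //=; rewrite mulr_ge0 ?branch_ge0. Qed.

Lemma leaf_weight_ge0 t th : 0 <= leaf_weight t th.
Proof. by rewrite mulr_ge0 ?weight_ge0 ?branch_ge0. Qed.

Lemma leaf_total_le1 d th : leaf_total d th <= 1.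
Proof.
elim: d th => [|d IHd] th.
  rewrite /leaf_total big_seq1 /leaf_weight/= mul1r -(branch_sum (th [::])).
  by rewrite lerDr branch_ge0.
rewrite leaf_totalS -(branch_sum (th [::])) lerD//.
  by rewrite ler_piMr ?branch_ge0.
by rewrite ler_piMr ?branch_ge0.
Qed.

(** A linearisation is a subconvex combination of the partial sums. *)
Lemma norm_linearised d th m : 0 <= m ->
  (forall t, t \in leaves d -> `|part_sum d t th| <= m) -> `|linearised d th| <= m.
Proof.
move=> m0 Hm; apply: le_trans (ler_norm_sum _ _ _) _.
apply: (@le_trans _ _ (leaf_total d th * m)); last by rewrite ler_piMl ?leaf_total_le1.
rewrite mulr_suml big_seq [leRHS]big_seq; apply: ler_sum => t td.
by rewrite normrM ger0_norm ?leaf_weight_ge0// ler_wpM2l ?leaf_weight_ge0 ?Hm.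
Qed.

(** Square [expR (u / 2) <= (1 - u / 2)^-1]. *)
Lemma expR_le_quad (u : R) : `|u| <= 1 -> expR u <= 1 + u + 2 * u ^+ 2.
Proof.
rewrite ler_norml => /andP[u1 u2].
have h : expR (u / 2) <= (1 - u / 2)^-1.
  have := expR_ge1Dx (- (u / 2)); rewrite expRN => h.
  by rewrite -[leLHS]invrK lef_pV2 ?posrE ?invr_gt0 ?expR_gt0//; lra.
have -> : expR u = expR (u / 2) ^+ 2 by rewrite -expRM_natl; congr expR; field.
apply: (@le_trans _ _ ((1 - u / 2)^-1 ^+ 2)).
  by rewrite ler_sqr ?nnegrE ?expR_ge0 ?invr_ge0//; lra.
rewrite exprVn -[leLHS]mul1r ler_pdivrMr; last by rewrite exprn_gt0//; lra.
have : 0 <= u ^+ 2 * ((1 - u) * (5 / 4 - u / 2)).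
  by rewrite mulr_ge0 ?sqr_ge0// mulr_ge0//; lra.
nra.
Qed.

Section Means.
Variables (M : nat) (rho : R).
Hypotheses (M_gt0 : (0 < M)%N) (avg_r : avg M r = 0) (avg_r2 : avg M (fun x => r x ^+ 2) = rho).
Let mean := @tree_mean R M.

Lemma mean_root d A : mean d (fun th => A (th [::])) = avg M A.
Proof.
case: d => // d.
transitivity (mean d.+1 (fun th => A (th [::]) * (fun=> 1) (subtree false th) * (fun=> 1) (subtree true th))).
  by congr mean; apply/funext => th; rewrite !mulr1.
by rewrite /mean (tree_mean_split M d A (fun=> 1) (fun=> 1)) !tree_mean_cst// !mulr1.
Qed.

Lemma mean_left d A B : mean d.+1 (fun th => A (th [::]) * B (subtree false th)) = avg M A * mean d B.
Proof.
transitivity (mean d.+1 (fun th => A (th [::]) * B (subtree false th) * (fun=> 1) (subtree true th))).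
  by congr mean; apply/funext => th; rewrite !mulr1.
by rewrite /mean (tree_mean_split M d A B (fun=> 1)) !tree_mean_cst// !mulr1.
Qed.

Lemma mean_right d A C : mean d.+1 (fun th => A (th [::]) * C (subtree true th)) = avg M A * mean d C.
Proof.
transitivity (mean d.+1 (fun th => A (th [::]) * (fun=> 1) (subtree false th) * C (subtree true th))).
  by congr mean; apply/funext => th; rewrite !mulr1.
by rewrite /mean (tree_mean_split M d A (fun=> 1) C) !tree_mean_cst// !mulr1.
Qed.

Lemma avg_branch b : avg M (branch b) = 1 / 2.
Proof.
have -> : branch b = fun x => 1 / 2 + (if b then 1 / 2 else - (1 / 2)) * r x.
  by apply/funext => x; rewrite /branch; case: b; field.
by rewrite avgD (avgZ _ _ r) avg_r mulr0 addr0 avg_cst.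
Qed.

Lemma avg_branch_sqr b : avg M (fun x => branch b x ^+ 2) = (1 + rho) / 4.
Proof.
have -> : (fun x => branch b x ^+ 2) =
    fun x => 1 / 4 + ((if b then 1 / 2 else - (1 / 2)) * r x + 1 / 4 * r x ^+ 2).
  by apply/funext => x; rewrite /branch; case: b; field.
by rewrite !avgD (avgZ _ (1 / 4) (fun x => r x ^+ 2)) (avgZ _ _ r) avg_r avg_r2 avg_cst//; field.
Qed.

Lemma avg_branch_r : avg M (fun x => branch true x * r x) = rho / 2.
Proof.
have -> : (fun x => branch true x * r x) = fun x => 1 / 2 * r x + 1 / 2 * r x ^+ 2.
  by apply/funext => x; rewrite /branch; field.
by rewrite !avgD (avgZ _ _ r) avgZ avg_r avg_r2; field.
Qed.

Lemma mean_tree_sum d : mean d (tree_sum d) = 0.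
Proof.
elim: d => [|d IHd].
  rewrite -avg_r -(mean_root 0); congr mean; apply/funext => th.
  by rewrite /tree_sum big_seq1 /piece mul1r.
rewrite (funext (@tree_sumS d)).
rewrite /mean !tree_meanD -/mean mean_root avg_r mean_left mean_right.
by rewrite -/mean IHd !mulr0 !addr0.
Qed.

Lemma mean_leaf_total d : mean d (leaf_total d) = 1 / 2.
Proof.
elim: d => [|d IHd].
  rewrite -(avg_branch true) -(mean_root 0); congr mean; apply/funext => th.
  by rewrite /leaf_total big_seq1 /leaf_weight mul1r.
rewrite (funext (@leaf_totalS d)).
rewrite /mean !tree_meanD -/mean mean_left mean_right.
by rewrite !avg_branch IHd; field.
Qed.

Lemma mean_linearised0 : mean 0 (linearised 0) = rho / 2.
Proof.
rewrite -avg_branch_r -(mean_root 0); congr mean; apply/funext => th.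
by rewrite /linearised big_seq1 /leaf_weight /part_sum /= big_cons big_nil /piece /= !mul1r addr0.
Qed.

(** With probability one half the path turns right at the root, which adds one
    positive sign to the partial sum; the whole left subtree then enters as well,
    but has mean zero.  The factor [(1 + rho) / 2] is the loss due to [r] not being
    exactly a sign. *)
Lemma mean_linearisedS d : mean d.+1 (linearised d.+1) =
  (1 + rho) / 2 * mean d (linearised d) + rho / 4.
Proof.
rewrite (funext (@linearisedS d)).
rewrite /mean !tree_meanD -/mean (mean_left _ (fun x => branch false x ^+ 2)).
rewrite (mean_right _ (fun x => branch true x ^+ 2)).
rewrite (mean_right _ (fun x => branch true x * r x)).
rewrite /mean (tree_mean_split _ _ (fun x => branch true x * branch false x) (tree_sum d) (leaf_total d)).
rewrite -/mean mean_tree_sum mean_leaf_total !avg_branch_sqr avg_branch_r.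
by field.
Qed.

(** As [rho] tends to [1] with [d] fixed the loss disappears, and the mean grows
    linearly in [d]. *)
Lemma mean_linearised_ge d : 0 <= rho <= 1 ->
  rho / 4 * d.+1%:R * (1 - d%:R * ((1 - rho) / 2)) <= mean d (linearised d).
Proof.
move=> /andP[rho0 rho1]; elim: d => [|d IHd].
  by rewrite mean_linearised0 mul0r subr0 !mulr1; lra.
rewrite mean_linearisedS.
set y := mean d _ in IHd *; have d0 : 0 <= d%:R :> R by [].
rewrite -(@natr1 _ d.+1) -(@natr1 _ d) in IHd *; set m : R := d%:R in IHd d0 *.
have : (1 + rho) / 2 * (rho / 4 * (m + 1) * (1 - m * ((1 - rho) / 2))) <= (1 + rho) / 2 * y.
  by rewrite ler_wpM2l//; lra.
suff : rho / 4 * (m + 1 + 1) * (1 - (m + 1) * ((1 - rho) / 2)) <=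
       (1 + rho) / 2 * (rho / 4 * (m + 1) * (1 - m * ((1 - rho) / 2))) + rho / 4 by lra.
rewrite -subr_ge0.
suff -> : (1 + rho) / 2 * (rho / 4 * (m + 1) * (1 - m * ((1 - rho) / 2))) + rho / 4 -
  rho / 4 * (m + 1 + 1) * (1 - (m + 1) * ((1 - rho) / 2)) =
  rho / 4 * (m + 1) * ((1 - rho) / 2) * (1 + m * ((1 - rho) / 2)).
  have h0 : 0 <= (1 - rho) / 2 by lra.
  by rewrite mulr_ge0 ?addr_ge0 ?mulr_ge0//; lra.
by field.
Qed.

(** Sub-Gaussian bound, as for a sum of [d + 1] independent signs: given the angle
    at the root, the squares of the two branching probabilities add up to at most
    [1], so the exponents of the subtrees do not accumulate. *)
Lemma mean_expR_tree_sum d (t : R) : `|t| <= 1 ->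
  mean d (fun th => expR (t * tree_sum d th)) <= expR (2 * t ^+ 2 * d.+1%:R).
Proof.
have avg_exp u : `|u| <= 1 -> avg M (fun x => expR (u * r x)) <= expR (2 * u ^+ 2).
  move=> u1; apply: (@le_trans _ _ (avg M (fun x => 1 + (u * r x + 2 * u ^+ 2)))).
    apply: le_avg => // x; have ur : `|u * r x| <= 1.
      by rewrite normrM mulr_ile1.
    apply: (le_trans (expR_le_quad ur)); rewrite addrA lerD2l exprMn mulrA.
    have r2 : r x ^+ 2 <= 1 by have := r_le1 x; rewrite ler_norml => /andP[]; nra.
    by rewrite ler_piMr// mulr_ge0// sqr_ge0.
  rewrite !avgD !avg_cst// (avgZ _ _ r) avg_r mulr0 add0r; exact: expR_ge1Dx.
elim: d t => [|d IHd] t t1.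
  rewrite mulr1; apply: le_trans (avg_exp t t1); rewrite -(mean_root 0) le_eqVlt; apply/orP; left.
  apply/eqP; congr mean; apply/funext => th.
  by rewrite /tree_sum big_seq1 /piece mul1r.
apply: (@le_trans _ _ (avg M (fun x => expR (2 * t ^+ 2 * d.+1%:R) * expR (t * r x)))); last first.
  rewrite avgZ -[d.+2%:R]natr1 [leRHS](_ : _ = expR (2 * t ^+ 2 * d.+1%:R) * expR (2 * t ^+ 2)).
    by rewrite ler_wpM2l ?expR_ge0 ?avg_exp.
  by rewrite -expRD mulrDr mulr1.
rewrite /mean/=; apply: le_avg => // x.
rewrite (_ : tree_mean _ _ _ = expR (t * r x) * (mean d (fun a => expR (t * branch false x * tree_sum d a)) *
    mean d (fun a => expR (t * branch true x * tree_sum d a)))); last first.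
  rewrite /mean [tree_mean _ _ _ * _]mulrC -!tree_meanZ; congr tree_mean; apply/funext => a.
  rewrite [tree_mean _ _ _ * _]mulrC -!tree_meanZ; congr tree_mean; apply/funext => b.
  by rewrite -!expRD tree_sumS /=; congr expR; rewrite /subtree/=; ring.
have tb b : `|t * branch b x| <= 1.
  rewrite normrM mulr_ile1// ger0_norm ?branch_ge0//.
  by rewrite -(branch_sum x); case: b; rewrite ?lerDl ?lerDr branch_ge0.
rewrite mulrC ler_wpM2r ?expR_ge0//.
have mean_ge0 y : 0 <= mean d (fun a => expR (y * tree_sum d a)).
  by rewrite -(tree_mean_cst M_gt0 d 0); apply: le_tree_mean => // th; exact: expR_ge0.
apply: (le_trans (ler_pM _ _ (IHd _ (tb false)) (IHd _ (tb true)))) => //.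
rewrite -expRD ler_expR !exprMn -mulrDl ler_wpM2r// -mulrDr ler_wpM2l// -mulrDr.
rewrite ler_piMr ?sqr_ge0//.
by have := r_le1 x; rewrite ler_norml => /andP[]; nra.
Qed.

(** From [z / k <= expR (z / k)], raised to the power [k]. *)
Lemma expr_le_expR (y : R) q : (0 < q)%N ->
  y ^+ (2 * q) <= (2 * q)%:R ^+ (2 * q) * (expR y + expR (- y)).
Proof.
move=> q0; set k := (2 * q)%N; have k0 : 0 < k%:R :> R by rewrite ltr0n muln_gt0.
have P (z : R) : 0 <= z -> z ^+ k <= k%:R ^+ k * expR z.
  move=> z0; have -> : expR z = expR (z / k%:R) ^+ k.
    by rewrite -expRM_natl; congr expR; rewrite mulrC divfK ?gt_eqF.
  rewrite -exprMn lerXn2r ?nnegrE ?mulr_ge0 ?expR_ge0 ?(ltW k0)//.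
  rewrite -ler_pdivrMl// mulrC.
  by apply: le_trans (expR_ge1Dx _); rewrite lerDr.
have [y0|y0] := leP 0 y.
  by apply: (le_trans (P _ y0)); rewrite ler_wpM2l ?exprn_ge0 ?(ltW k0)// lerDl expR_ge0.
rewrite (_ : y ^+ k = (- y) ^+ k); last by rewrite /k !exprM sqrrN.
have y0' : 0 <= - y by lra.
apply: (le_trans (P _ y0')).
by rewrite ler_wpM2l ?exprn_ge0 ?(ltW k0)// lerDr expR_ge0.
Qed.

(** Moments are bounded by exponential moments at the scale of the standard
    deviation, uniformly in [d]. *)
Lemma mean_tree_sum_moment d q : (0 < q)%N ->
  mean d (fun th => (tree_sum d th / Num.sqrt d.+1%:R) ^+ (2 * q)) <=
  (2 * q)%:R ^+ (2 * q) * (2 * expR 2).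
Proof.
move=> q0; set t := (Num.sqrt (d.+1%:R : R))^-1.
have t0 : 0 <= t by rewrite invr_ge0 sqrtr_ge0.
have t2 : t ^+ 2 * d.+1%:R = 1 by rewrite exprVn sqr_sqrtr// mulVf// pnatr_eq0.
have t1 : `|t| <= 1.
  rewrite ger0_norm// invf_le1 ?sqrtr_gt0 ?ltr0n//.
  by rewrite -[leLHS]sqrtr1 ler_sqrt// ler1n.
pose c : R := (2 * q)%:R ^+ (2 * q).
apply: (@le_trans _ _ (mean d (fun th => c * (expR (t * tree_sum d th) + expR (- t * tree_sum d th))))).
  by apply: le_tree_mean => // th; rewrite mulrC mulNr; exact: expr_le_expR.
rewrite /mean tree_meanZ tree_meanD ler_wpM2l ?exprn_ge0// mulr_natl mulr2n lerD//.
  by apply: (le_trans (mean_expR_tree_sum d t1)); rewrite -mulrA t2 mulr1.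
apply: le_trans (mean_expR_tree_sum d (_ : `|- t| <= 1)) _; first by rewrite normrN.
by rewrite sqrrN -mulrA t2 mulr1.
Qed.

End Means.
End Bounded.
End Tree.

(** * Trigonometric polynomials close to a random sign *)

Section CosSpan.
Variable R : realType.

Lemma cos_mul_cos (a b : R) : cos a * cos b = (cos (a + b) + cos (a - b)) / 2.
Proof. by rewrite cosB cosD; field. Qed.

(** Even trigonometric polynomials in arbitrary phases [K].  A predicate rather than
    explicit coefficients, since only linearity and the location of the spectrum
    matter. *)
Inductive cos_span (X : Type) (K : set (X -> R)) : (X -> R) -> Prop :=
| cos_span0 : cos_span K (fun=> 0)
| cos_spanS c phi H : K phi -> cos_span K H ->
    cos_span K (fun x => c * cos (2 * pi * phi x) + H x).

Section Closure.
Variable X : Type.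
Implicit Types (K : set (X -> R)) (H : X -> R).

Lemma cos_span_sub K1 K2 H : K1 `<=` K2 -> cos_span K1 H -> cos_span K2 H.
Proof.
move=> K12; elim=> [|c phi H' K1phi _ IH]; first exact: cos_span0.
by apply: cos_spanS => //; exact: K12.
Qed.

Lemma cos_spanD K H1 H2 : cos_span K H1 -> cos_span K H2 ->
  cos_span K (fun x => H1 x + H2 x).
Proof.
move=> + sH2; elim=> [|c phi H Kphi _ IH].
  by rewrite (_ : (fun x => _) = H2)//; apply/funext => x; rewrite add0r.
rewrite (_ : (fun x => _) = fun x => c * cos (2 * pi * phi x) + (H x + H2 x)).
  exact: cos_spanS.
by apply/funext => x; rewrite addrA.
Qed.

Lemma cos_spanZ K c H : cos_span K H -> cos_span K (fun x => c * H x).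
Proof.
elim=> [|c' phi H' Kphi _ IH].
  by rewrite (_ : (fun x => _) = fun=> 0); [exact: cos_span0|apply/funext => x; rewrite mulr0].
rewrite (_ : (fun x => _) = fun x => c * c' * cos (2 * pi * phi x) + c * H' x).
  exact: cos_spanS.
by apply/funext => x; rewrite mulrDr mulrA.
Qed.

Lemma cos_span1 K phi : K phi -> cos_span K (fun x => cos (2 * pi * phi x)).
Proof.
move=> Kphi; have := cos_spanS 1 Kphi (cos_span0 K).
by rewrite (_ : (fun x => _) = (fun x => cos (2 * pi * phi x)))//; apply/funext => x; rewrite mul1r addr0.
Qed.

Lemma cos_span_cst K c : K (fun=> 0) -> cos_span K (fun=> c).
Proof.
move=> K0; have := cos_spanZ c (cos_span1 K0).
by rewrite (_ : (fun x => _) = (fun=> c))//; apply/funext => x; rewrite mulr0 cos0 mulr1.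
Qed.

(** Product-to-sum: the spectrum of a product lies in the sums and the differences of
    the spectra. *)
Lemma cos_spanM K1 K2 K H1 H2 :
  (forall u v, K1 u -> K2 v -> K (fun x => u x + v x) /\ K (fun x => u x - v x)) ->
  cos_span K1 H1 -> cos_span K2 H2 -> cos_span K (fun x => H1 x * H2 x).
Proof.
move=> K12 sH1 sH2; elim: sH1 => [|c u H Ku _ IH].
  by rewrite (_ : (fun x => _) = fun=> 0); [exact: cos_span0|apply/funext => x; rewrite mul0r].
rewrite (_ : (fun x => _) = fun x => c * (cos (2 * pi * u x) * H2 x) + H x * H2 x); last first.
  by apply/funext => x; rewrite mulrDl mulrA.
apply: cos_spanD IH; apply: cos_spanZ; elim: sH2 => [|c' v H' Kv _ IH].
  by rewrite (_ : (fun x => _) = fun=> 0); [exact: cos_span0|apply/funext => x; rewrite mulr0].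
rewrite (_ : (fun x => _) = fun x => c' / 2 * cos (2 * pi * (u x + v x)) +
    (c' / 2 * cos (2 * pi * (u x - v x)) + cos (2 * pi * u x) * H' x)).
  have [? ?] := K12 _ _ Ku Kv.
  by apply: (cos_spanS _ (phi := fun x => u x + v x)) => //;
     apply: (cos_spanS _ (phi := fun x => u x - v x)).
apply/funext => x; rewrite mulrDr mulrCA cos_mul_cos -mulrDr -mulrBr.
by field.
Qed.

End Closure.

Lemma cos_span_comp (X Y : Type) (u : Y -> X) (K : set (X -> R)) (L : set (Y -> R)) H :
  (forall phi, K phi -> L (phi \o u)) -> cos_span K H -> cos_span L (fun y => H (u y)).
Proof.
move=> KL; elim=> [|c phi H' Kphi _ IH]; first exact: cos_span0.
by apply: (cos_spanS _ (phi := phi \o u)) => //; exact: KL.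
Qed.

(** The parity matters: an odd spectrum does not contain [0], which gives mean zero
    and, further on, places every piece of a tree sum in the sector of its node. *)
Definition harmonics (q : int) (D : nat) : set (R -> R) :=
  [set phi | exists j : int, (`|2 * j + q| <= D%:Z)%R /\ phi = fun x => (2 * j + q)%:~R * x].

Definition low_harmonic (D : nat) : set (R -> R) :=
  [set phi | exists j : int, (`|j| <= D%:Z)%R /\ phi = fun x => j%:~R * x].

Lemma harmonic_low q D : harmonics q D `<=` low_harmonic D.
Proof. by move=> phi [j [jD ->]]; exists (2 * j + q). Qed.

Lemma low_harmonicM D1 D2 H1 H2 : cos_span (low_harmonic D1) H1 ->
  cos_span (low_harmonic D2) H2 ->
  cos_span (low_harmonic (D1 + D2)) (fun x => H1 x * H2 x).
Proof.
apply: cos_spanM => u v [j [jD ->]] [k [kD ->]]; split; [exists (j + k)|exists (j - k)]; split.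
- lia.
- by apply/funext => x; rewrite intrD mulrDl.
- lia.
- by apply/funext => x; rewrite intrD intrN mulrDl mulNr.
Qed.

(** Frequencies above the degree of [H] are orthogonal to it. *)
Lemma avg_high M D B H : cos_span (low_harmonic D) H -> (D < B)%N -> (D + B < M)%N ->
  avg M (fun x => H x * cos (2 * pi * (B%:R * x))) = 0.
Proof.
move=> sH DB DM; have M0 : (0 < M)%N by lia.
elim: sH => [|c phi H' [j [jD ->]] _ IH].
  by under [X in avg _ X]funext do rewrite mul0r; rewrite avg_cst.
rewrite (_ : (fun x => _) = fun x => c / 2 * cos (0 + 2 * pi * ((j + B%:Z)%:~R * x)) +
  (c / 2 * cos (0 + 2 * pi * ((j - B%:Z)%:~R * x)) + H' x * cos (2 * pi * (B%:R * x)))).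
  rewrite !avgD !avgZ IH !avg_cos//; [|lia|lia].
  by rewrite !ifF ?mulr0 ?addr0//; lia.
apply/funext => x; rewrite !add0r mulrDl -[c * _ * _]mulrA cos_mul_cos.
rewrite -mulrDr -mulrBr -mulrDl -mulrBl intrD intrB (_ : B%:~R = B%:R)//.
by field.
Qed.

Lemma avg_odd M D H : cos_span (harmonics 1 D) H -> (D < M)%N -> avg M H = 0.
Proof.
move=> sH DM; have M0 : (0 < M)%N by lia.
elim: sH => [|c phi H' [j [jD ->]] _ IH]; first by rewrite avg_cst.
rewrite (_ : (fun x => _) = fun x => c * cos (0 + 2 * pi * ((2 * j + 1)%:~R * x)) + H' x).
  rewrite !avgD !avgZ IH !avg_cos//; [|lia].
  by rewrite ifF ?mulr0 ?addr0//; lia.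
by apply/funext => x; rewrite add0r.
Qed.

(** A bounded martingale [r' = r + (1 - r^2) / 2 * z] driven by lacunary cosines
    [z] is absorbed at the two signs: its defect [e = E(1 - r^2)] satisfies
    [e' = e - E((1 - r^2)^2) / 8 <= e - e^2 / 8] by Cauchy-Schwarz.  The powers
    of [7] are odd, which keeps the spectrum odd, and sparse enough for the
    orthogonality of the terms. *)
Lemma near_sign_step (u : nat) : exists (r : R -> R) (D : nat),
  [/\ forall x, `|r x| <= 1, (4 * D < 7 ^ u)%N, cos_span (harmonics 1 D) r &
      forall M, (4 * D < M)%N -> avg M (fun x => 1 - r x ^+ 2) <= 8 / (u + 8)%:R].
Proof.
elim: u => [|u [r [D [r1 D7 sr er]]]].
  exists (fun=> 0), 0%N; split => //.
  - by move=> x; rewrite normr0.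
  - exact: cos_span0.
  - by move=> M M0; rewrite avg_cst// expr0n subr0 add0n divff// pnatr_eq0.
(* The new frequency [B] exceeds four times the degree [D] of [r]: all cross terms
   below have a non-zero frequency smaller than [M]. *)
set B := (7 ^ u)%N in D7.
have Bodd : odd B by rewrite /B oddX orbT.
pose Y x : R := 1 - r x ^+ 2; pose z x : R := cos (2 * pi * (B%:R * x)).
have r2 x : r x ^+ 2 <= 1 by have := r1 x; rewrite ler_norml => /andP[]; nra.
have z1 x : `|z x| <= 1 by exact: cos_max.
have sY : cos_span (harmonics 0 (2 * D)) Y.
  have -> : Y = fun x => 1 + (-1) * (r x * r x) by apply/funext => x; rewrite /Y mulN1r expr2.
  apply: cos_spanD; first by apply: cos_span_cst; exists 0; split=> //; apply/funext => x; rewrite mul0r.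
  apply: cos_spanZ; apply: (cos_spanM _ sr sr) => _ _ [j [jD ->]] [k [kD ->]].
  split; [exists (j + k + 1)|exists (j - k)]; split; try lia;
  by apply/funext => x; rewrite -1?mulrDl -1?mulrBl -?intrD -?intrB; congr (_%:~R * _); lia.
have lr := cos_span_sub (@harmonic_low _ _) sr.
have lY := cos_span_sub (@harmonic_low _ _) sY.
exists (fun x => r x + 2^-1 * (Y x * z x)), (2 * D + B)%N; split.
- move=> x; have := r1 x; have := z1 x; have := r2 x; rewrite !ler_norml /Y.
  move: (r x) (z x) => a b a2 /andP[b1 b2] /andP[a1 a3].
  have : 0 <= (1 - a ^+ 2) * (1 - b) by apply: mulr_ge0; lra.
  have : 0 <= (1 - a ^+ 2) * (1 + b) by apply: mulr_ge0; lra.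
  by move=> h1 h2; apply/andP; split; nra.
- by rewrite expnS -/B; lia.
- apply: cos_spanD; first by apply: cos_span_sub sr => _ [j [jD ->]]; exists j; split=> //; lia.
  apply: cos_spanZ; apply: (cos_spanM (K2 := [set fun x => B%:R * x])) sY (cos_span1 _) => //.
  have [b Bb] : exists b, B = (2 * b + 1)%N by exists B./2; lia.
  move=> _ _ [j [jD ->]] ->; split; [exists (j + b%:Z)|exists (j - b%:Z - 1)]; split; try lia;
  apply/funext => x; rewrite -?mulrDl -?mulrBl -[B%:R]/(B%:~R) -?intrD -?intrB;
  by congr (_%:~R * _); lia.
- move=> M DM; have M0 : (0 < M)%N by lia.
  have e1 : avg M (fun x => r x * Y x * z x) = 0.
    by apply: (avg_high (low_harmonicM lr lY)); lia.
  have e2 : avg M (fun x => Y x * Y x * cos (2 * pi * ((2 * B)%:R * x))) = 0.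
    by apply: (avg_high (low_harmonicM lY lY)); lia.
  have e3 : avg M (fun x => 1 - (r x + 2^-1 * (Y x * z x)) ^+ 2) =
      avg M Y - avg M (fun x => Y x * Y x) / 8.
    transitivity (avg M (fun x => Y x + (-1 * (r x * Y x * z x) +
       (- 8^-1 * (Y x * Y x) + - 8^-1 * (Y x * Y x * cos (2 * pi * ((2 * B)%:R * x))))))).
      congr avg; apply/funext => x.
      rewrite (_ : 2 * pi * ((2 * B)%:R * x) = (2 * pi * (B%:R * x)) *+ 2); last first.
        by rewrite natrM -[RHS]mulr_natl; ring.
      by rewrite cos_mulr2n -/(z x) /Y; field.
    by rewrite !avgD (avgZ _ (-1)) !(avgZ _ (- 8^-1)) e1 e2; field.
(* Cauchy-Schwarz, as the mean of [(Y - avg M Y)^2]. *)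
  have e4 : avg M Y ^+ 2 <= avg M (fun x => Y x * Y x).
    have : 0 <= avg M (fun x => Y x * Y x + (- (2 * avg M Y) * Y x + avg M Y ^+ 2)).
      rewrite -(avg_cst M0 (0 : R)); apply: le_avg => x.
      have := sqr_ge0 (Y x - avg M Y); move: (avg M Y) => e; nra.
    rewrite (avgD M (fun x => Y x * Y x)) (avgD M (fun x => - (2 * avg M Y) * Y x)).
    by rewrite (avgZ _ _ Y) avg_cst//; move: (avg M _) (avg M Y) => E e; nra.
  have e0 : 0 <= avg M Y by rewrite -(avg_cst M0 (0 : R)); apply: le_avg => x; rewrite subr_ge0.
  rewrite e3; have {}er := er M ltac:(lia); rewrite -/Y in er.
  apply: (@le_trans _ _ (avg M Y - avg M Y ^+ 2 / 8)); first by rewrite lerD2l lerN2 ler_pM2r.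
  move: (avg M Y) e0 er => e e0; rewrite !natrD -[u.+1%:R]natr1.
  have u0 : 0 <= u%:R :> R by [].
  move: (u%:R) u0 => v v0; rewrite !ler_pdivlMr; [|lra|lra] => er.
  have e4' : e <= 1 by nra.
  nra.
Qed.

(** A genuine sign is not a trigonometric polynomial; a polynomial with values in
    [[-1, 1]] and second moment close to [1] serves as well. *)
Lemma near_sign (eps : R) : 0 < eps -> exists (r : R -> R) (D : nat),
  [/\ forall x, `|r x| <= 1, cos_span (harmonics 1 D) r &
      forall M, (4 * D < M)%N -> avg M r = 0 /\ 1 - eps <= avg M (fun x => r x ^+ 2)].
Proof.
move=> eps0; pose u := Num.bound (8 / eps).
have [r [D [r1 _ sr er]]] := near_sign_step u.
exists r, D; split=> // M DM; split; first by apply: (avg_odd sr); lia.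
have M0 : (0 < M)%N by lia.
have : avg M (fun x => 1 - r x ^+ 2) <= eps.
  apply: (le_trans (er M DM)); rewrite ler_pdivrMr ?ltr0n ?addn_gt0 ?orbT//.
  rewrite -ler_pdivrMl// mulrC; apply: (@le_trans _ _ u%:R).
    by apply/ltW/archi_boundP; rewrite divr_ge0// ltW.
  by rewrite ler_nat leq_addr.
rewrite (_ : (fun x => _) = fun x => 1 + -1 * r x ^+ 2).
  by rewrite avgD avgZ avg_cst//; lra.
by apply/funext => x; rewrite mulN1r.
Qed.

End CosSpan.

(** * The Fejer kernel and the Riemann-Lebesgue lemma *)

Section OneDim.
Variable R : realType.
Local Notation mu := (@lebesgue_measure R).
Implicit Types (f g psi : R -> R).

Lemma ge0_integral_affine (G : R -> R) (a h : R) : 0 < a -> continuous G ->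
  (forall x, 0 <= G x) ->
  (\int[mu]_x (G x)%:E = \int[mu]_x (a * G ((x + h) * a))%:E)%E.
Proof.
move=> a0 cG G0; pose F := fun x : R => (x + h) * a.
have F'E : (F^`() = cst a)%classic.
  apply/funext => x; rewrite /F derive1E deriveM// deriveD// derive_cst scaler0.
  by rewrite add0r derive_id derive_cst addr0 [LHS]mulr1.
rewrite (@increasing_ge0_integration_by_substitutionT _ F).
- by apply: eq_integral => x _ /=; rewrite F'E mulrC.
- by move=> x y xy; rewrite /F ltr_pM2r// ltrD2r.
- by rewrite F'E => ?; exact: cvg_cst.
- by rewrite F'E; exact: is_cvg_cst.
- by rewrite F'E; exact: is_cvg_cst.
- by move=> x; rewrite /F; apply: derivableM => //; exact: derivableD.
- by apply/gt0_cvgMlNy => //; exact: cvg_addrr_Ny.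
- by apply/gt0_cvgMly => //; exact: cvg_addrr.
- exact: cG.
- exact: G0.
Qed.

Lemma integrable_affine (G : R -> R) (a h : R) : 0 < a -> continuous G ->
  (forall x, 0 <= G x) -> mu.-integrable setT (EFin \o G) ->
  mu.-integrable setT (EFin \o (fun x => a * G ((x + h) * a))).
Proof.
move=> a0 cG G0 iG.
have mG : measurable_fun setT (fun x : R => a * G ((x + h) * a)).
  apply: measurable_funM => //; apply: measurableT_comp; first exact: continuous_measurable_fun.
  by apply: measurable_funM => //; exact: measurable_funD.
apply/integrableP; split; first exact/measurable_EFinP.
apply/abse_integralP => //=; first exact/measurable_EFinP.
by rewrite -ge0_integral_affine//; apply/abse_integralP => //; have /integrableP[] := iG.
Qed.

(** The common majorant of all one-dimensional integrands. *)
Definition decay (x : R) : R := (1 + x ^+ 2)^-1.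

Lemma decay_gt0 x : 0 < decay x.
Proof. by rewrite invr_gt0 ltr_pwDl// sqr_ge0. Qed.

Lemma continuous_decay : continuous decay.
Proof. exact: continuous_oneDsqrV. Qed.

Lemma integrable_decay : mu.-integrable setT (EFin \o decay).
Proof.
have mb : measurable_fun setT decay by apply: continuous_measurable_fun; exact: continuous_decay.
apply/integrableP; split; first exact/measurable_EFinP.
apply/abse_integralP => //=; first exact/measurable_EFinP.
rewrite ge0_symfun_integralT//=.
- rewrite (_ : [set x | _] = `[0, +oo[%classic); last first.
    by apply/seteqP; split => x/=; rewrite in_itv/= andbT.
  by rewrite integral0y_oneDsqr -EFinM ltry.
- by move=> x; exact/ltW/decay_gt0.
- exact: continuous_decay.
- by move=> x/=; rewrite /decay sqrrN.
Qed.

Lemma integrable_le_decay f K : continuous f -> (forall x, `|f x| <= K * decay x) ->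
  mu.-integrable setT (EFin \o f).
Proof.
move=> cf fK.
apply: (@le_integrable _ _ _ mu setT measurableT _ (EFin \o (fun x => K * decay x))).
- by apply/measurable_EFinP; exact: continuous_measurable_fun.
- by move=> x _ /=; rewrite lee_fin (le_trans (fK x))// ler_norm.
- exact: (integrableZl _ K integrable_decay).
Qed.

(** Makes the dominated convergence in the Riemann-Lebesgue lemma uniform in small
    translations. *)
Lemma decay_shift x h : `|h| <= 1 -> decay (x + h) <= 3 * decay x.
Proof.
move=> h1; have h2 : h ^+ 2 <= 1 by move: h1; rewrite ler_norml => /andP[]; nra.
rewrite /decay -[X in _ <= X]invrK lef_pV2 ?posrE ?invr_gt0 ?mulr_gt0 ?decay_gt0//; last first.
  by rewrite ltr_pwDl// sqr_ge0.
rewrite invfM invrK ler_pdivrMl//.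
have := sqr_ge0 (x + 2 * h); nra.
Qed.

(** Continuous at [0], unlike the bare quotient, whose value there is [0]. *)
Definition sinc (x : R) : R := if x == 0 then 1 else sin x / x.

Lemma continuous_sinc : continuous sinc.
Proof.
move=> x; have [->|x0] := eqVneq x 0.
  have /cvg_ex[l sl] : derivable (@sin R) 0 1 by exact: derivable_sin.
  have l1 : l = 1.
    have /cvg_lim <- // := sl.
    by rewrite -[LHS]/('D_1 sin 0) derive_val cos0.
  rewrite l1 in sl; apply/continuous_withinNx; rewrite {2}/sinc eqxx.
  apply: cvg_trans sl; apply: near_eq_cvg; near=> y.
  have y0 : y != 0 by near: y; exact: nbhs_dnbhs_neq.
  by rewrite /sinc (negPf y0)/= sin0 subr0 addr0 mulrC; congr (_ * sin _); rewrite [LHS]mulr1.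
have xs : {near x, (fun y => sin y / y) =1 sinc}.
  near=> y; rewrite /sinc ifF//; apply/negbTE; near: y.
  exact: open_neq.
apply: cvg_trans (near_eq_cvg xs) _.
rewrite /sinc (negPf x0); apply: cvgM; first exact: continuous_sin.
by apply: cvgV => //; exact: cvg_id.
Unshelve. all: by end_near. Qed.

Lemma norm_sinc_le1 x : `|sinc x| <= 1.
Proof.
rewrite /sinc; case: eqVneq => x0; first by rewrite normr1.
rewrite normrM normfV ler_pdivrMr ?normr_gt0// mul1r.
wlog x_gt0 : x x0 / 0 < x.
  move=> W; have [xn| |x00] := ltgtP x 0; [|exact: W|by rewrite x00 eqxx in x0].
  by rewrite -normrN -sinN -(normrN x); apply: W; rewrite ?oppr_eq0// oppr_gt0.
have [c xc scE] : exists2 c, c \in `]0, x[%R & sin x - sin 0 = cos c * (x - 0).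
  apply: (MVT x_gt0); exact: continuous_subspaceT (@continuous_sin R).
move: scE; rewrite sin0 !subr0 => ->.
by rewrite normrM ler_piMl ?cos_max.
Qed.

(** The Fejer kernel [(1 - cos x) / x^2], nonnegative and with a compactly supported
    Fourier transform. *)
Definition fejer (x : R) : R := sinc (x / 2) ^+ 2 / 2.

Lemma fejer0 : fejer 0 = 1 / 2.
Proof. by rewrite /fejer mul0r /sinc eqxx expr1n. Qed.

Lemma fejerE x : fejer x * x ^+ 2 = 1 - cos x.
Proof.
rewrite /fejer /sinc mulf_eq0 invr_eq0 pnatr_eq0 orbF.
case: eqVneq => [->|x0]; first by rewrite expr0n mulr0 cos0 subrr.
have -> : 1 - cos x = 2 * sin (x / 2) ^+ 2.
  rewrite -[in LHS](_ : (x / 2) *+ 2 = x); last by rewrite -mulr_natl; field.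
  by rewrite cos_mulr2n cos2sin2 -mulr_natl; ring.
by field.
Qed.

Lemma fejer_ge0 x : 0 <= fejer x.
Proof. by rewrite divr_ge0// sqr_ge0. Qed.

Lemma fejer_le_half x : fejer x <= 1 / 2.
Proof.
by rewrite ler_pM2r// -(real_normK (num_real _)) exprn_ile1// norm_sinc_le1.
Qed.

Lemma fejerN x : fejer (- x) = fejer x.
Proof.
by rewrite /fejer /sinc mulNr oppr_eq0 sinN invrN mulrNN.
Qed.

Lemma continuous_fejer : continuous fejer.
Proof.
move=> x; apply: cvgM; last exact: cvg_cst.
have c : {for x, continuous (fun y : R => sinc (y / 2))}.
  apply: continuous_comp; last exact: continuous_sinc.
  by apply: cvgM; [exact: cvg_id|exact: cvg_cst].
by apply: cvgM.
Qed.

Lemma fejer_le_decay x : fejer x <= 3 * decay x.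
Proof.
rewrite /decay ler_pdivlMr ?ltr_pwDl ?sqr_ge0// mulrDr mulr1 fejerE.
have := fejer_le_half x; have := cos_geN1 x; lra.
Qed.

Lemma integrable_fejer_cos (b : R) : mu.-integrable setT (EFin \o (fun x => fejer x * cos (b * x))).
Proof.
apply: (@integrable_le_decay _ 3).
  move=> x; apply: cvgM; first exact: continuous_fejer.
  apply: continuous_comp; last exact: continuous_cos.
  by apply: cvgM; [exact: cvg_cst|exact: cvg_id].
move=> x; rewrite normrM (ger0_norm (fejer_ge0 x)).
apply: le_trans (fejer_le_decay x); rewrite ler_piMr ?fejer_ge0//.
exact: cos_max.
Qed.

Lemma integrable_fejer : mu.-integrable setT (EFin \o fejer).
Proof.
have := integrable_fejer_cos 0.
by rewrite (_ : (fun x => _) = fejer)//; apply/funext => x; rewrite mul0r cos0 mulr1.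
Qed.

Definition fejer_mass : R := \int[mu]_x fejer x.

(** Homogeneity: [(1 - cos (a x)) / x^2] is a rescaled Fejer kernel.  As a
    product of [fejer] with a cosine is a combination of three of these, the Fourier
    transform of [fejer] follows without inverting that of the triangle. *)
Lemma Rintegral_fejer_scale (a : R) :
  \int[mu]_x (a ^+ 2 * fejer (a * x)) = `|a| * fejer_mass.
Proof.
wlog a_ge0 : a / 0 <= a.
  move=> W; have [|/ltW an] := leP 0 a; first exact: W.
  have a0 : 0 <= - a by rewrite oppr_ge0.
  rewrite -normrN -(W _ a0); apply: eq_Rintegral => x _.
  by rewrite sqrrN mulNr fejerN.
have [->|a0] := eqVneq a 0.
  rewrite normr0 mul0r -[RHS](Rintegral_set0 mu (fun=> 0)) /Rintegral integral_set0.
  by under eq_integral do rewrite expr0n mul0r; rewrite integral0.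
rewrite ger0_norm// /fejer_mass {1 2}/Rintegral.
rewrite (@ge0_integral_affine fejer a 0) ?lt_def ?a0//; last 2 first.
- exact: continuous_fejer.
- exact: fejer_ge0.
have ia : mu.-integrable setT (EFin \o (fun x => a * fejer ((x + 0) * a))).
  apply: integrable_affine; rewrite ?lt_def ?a0//; last 2 first.
  - exact: fejer_ge0.
  - exact: integrable_fejer.
  - exact: continuous_fejer.
rewrite -[RHS]RintegralZl//; apply: eq_Rintegral => x _.
by rewrite addr0 mulrA -expr2 (mulrC x).
Qed.

Lemma integrable_fejer_scale (a : R) :
  mu.-integrable setT (EFin \o (fun x => a ^+ 2 * fejer (a * x))).
Proof.
have P b : 0 < b -> mu.-integrable setT (EFin \o (fun x => b ^+ 2 * fejer (b * x))).
  move=> b0.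
  have := integrable_affine 0 b0 continuous_fejer fejer_ge0 integrable_fejer.
  move=> /(integrableZl measurableT b); congr (_.-integrable _ _); apply/funext => x /=.
  by rewrite -EFinM addr0; congr EFin; rewrite (mulrC x) mulrA.
have [a0|a0|<-] := ltgtP 0 a; first exact: P.
  have /P : 0 < - a by rewrite oppr_gt0.
  by congr (_.-integrable _ _); apply/funext => x /=; rewrite sqrrN mulNr fejerN.
rewrite (_ : _ \o _ = cst 0%E); first exact: integrable0.
by apply/funext => x /=; rewrite expr0n mul0r.
Qed.

(** The triangle of half-width [1], as a combination of three absolute values. *)
Definition tent (b : R) : R :=
  fejer_mass * (2^-1 * `|b + 1| + (2^-1 * `|b - 1| - `|b|)).

Lemma Rintegral_fejer_cos (b : R) : \int[mu]_x (fejer x * cos (b * x)) = tent b.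
Proof.
pose F a x := a ^+ 2 * fejer (a * x).
have FE a x : x != 0 -> F a x = (1 - cos (a * x)) / x ^+ 2.
  move=> x0; rewrite -fejerE /F exprMn; field.
  by rewrite x0.
have E x : fejer x * cos (b * x) = 2^-1 * F (b + 1) x + (2^-1 * F (b - 1) x + -1 * F b x).
  have [->|x0] := eqVneq x 0.
    by rewrite /F !mulr0 fejer0 cos0; field.
  rewrite !FE// -[fejer x](_ : F 1 x = _); last by rewrite /F expr1n !mul1r.
  have -> : (b + 1) * x = b * x + x by ring.
  have -> : (b - 1) * x = b * x - x by ring.
  rewrite FE// mul1r cosB cosD; field.
  by rewrite x0.
transitivity (\int[mu]_x (2^-1 * F (b + 1) x + (2^-1 * F (b - 1) x + -1 * F b x))).
  by apply: eq_Rintegral => x _.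
have i k a : mu.-integrable setT (EFin \o (fun x => k * F a x)).
  exact: (integrableZl measurableT k (integrable_fejer_scale a)).
have iF a : mu.-integrable setT (EFin \o F a) by exact: integrable_fejer_scale.
have S a : \int[mu]_x F a x = `|a| * fejer_mass by exact: Rintegral_fejer_scale.
clearbody F; have i2 := integrableD measurableT (i 2^-1 (b - 1)) (i (-1) b).
by rewrite !RintegralD// !RintegralZl// !S /tent; ring.
Qed.

Lemma tent_eq0 b : 1 <= `|b| -> tent b = 0.
Proof.
rewrite /tent ler_normr => b1; apply/eqP; rewrite mulf_eq0; apply/orP; right; apply/eqP.
have [b0|b0] := leP 0 b.
  by rewrite !ger0_norm; lra.
by rewrite !ler0_norm; lra.
Qed.

Lemma continuous_tent : continuous tent.
Proof.
move=> b; apply: cvgM; first exact: cvg_cst.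
have c k : (fun b : R => `|b + k|) @ b --> `|b + k|.
  by apply: (cvg_norm (f := fun b => b + k)); apply: cvgD; [exact: cvg_id|exact: cvg_cst].
apply: cvgD; first by apply: cvgM; [exact: cvg_cst|exact: c].
apply: cvgB; first by apply: cvgM; [exact: cvg_cst|exact: c].
by apply: cvg_norm; exact: cvg_id.
Qed.

Lemma norm_tent_le b : `|tent b| <= 2 * fejer_mass * decay b.
Proof.
have m0 : 0 <= fejer_mass by apply: Rintegral_ge0 => x _; exact: fejer_ge0.
have [b1|b1] := leP 1 `|b|.
  by rewrite tent_eq0// normr0 !mulr_ge0// ltW// decay_gt0.
rewrite /tent normrM ger0_norm// -mulrA [leRHS]mulrCA ler_wpM2l//.
have b2 : 1 / 2 <= decay b.
  rewrite /decay -[leRHS]mul1r ler_pdivlMr ?ltr_pwDl ?sqr_ge0//.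
  by move: b1; rewrite ltr_norml => /andP[]; nra.
have : `|2^-1 * `|b + 1| + (2^-1 * `|b - 1| - `|b|)| <= 1.
  move: b1; rewrite ltr_norml => /andP[b1 b1'].
  rewrite [ `|b + 1|]ger0_norm; [|lra]; rewrite [ `|b - 1|]ler0_norm; [|lra].
  have [b0|b0] := leP 0 b.
    by rewrite [ `|b|]ger0_norm// ler_norml; lra.
  by rewrite [ `|b|]ltr0_norm// ler_norml; lra.
lra.
Qed.

(** Translating by half a period [pi / b] changes the sign of the cosine, so the
    integral is at most half the L^1 distance between [psi] and its translate, which
    tends to zero. *)
Lemma riemann_lebesgue psi K (b : nat -> R) : continuous psi ->
  (forall x, 0 <= psi x) -> (forall x, psi x <= K * decay x) ->
  (fun k => `|b k|) @ \oo --> +oo ->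
  (fun k => \int[mu]_x (psi x * cos (b k * x))) @ \oo --> (0 : R).
Proof.
move=> cpsi psi0 psiK boo.
have K0 : 0 <= K.
  by have := le_trans (psi0 0) (psiK 0); rewrite pmulr_lge0// decay_gt0.
have ccos (a : R) : continuous (fun x : R => cos (a * x)).
  move=> x; apply: continuous_comp; last exact: continuous_cos.
  by apply: cvgM; [exact: cvg_cst|exact: cvg_id].
have csh (h : R) : continuous (fun x : R => psi (x + h)).
  move=> x; apply: continuous_comp; last exact: cpsi.
  by apply: cvgD; [exact: cvg_id|exact: cvg_cst].
have ipsi : mu.-integrable setT (EFin \o psi).
  by apply: (@integrable_le_decay _ K) => // x; rewrite ger0_norm.
have ish h : mu.-integrable setT (EFin \o (fun x => psi (x + h))).
  have := integrable_affine h ltr01 cpsi psi0 ipsi.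
  by congr (_.-integrable _ _); apply/funext => x /=; rewrite mul1r mulr1.
have bnd (f : R -> R) (u : R -> R) : mu.-integrable setT (EFin \o f) -> continuous u ->
    (forall x, `|u x| <= 1) -> mu.-integrable setT (EFin \o (fun x => f x * u x)).
  move=> fi cu u1; apply: (@le_integrable _ _ _ mu setT measurableT _ (EFin \o f)) => //.
    apply/measurable_EFinP; apply: measurable_funM; last exact: continuous_measurable_fun.
    by apply/measurable_EFinP; case/integrableP: fi.
  by move=> x _ /=; rewrite lee_fin normrM ler_piMr.
have cos1 (a : R) x : `|cos (a * x)| <= 1 by exact: cos_max.
have ic a := bnd _ _ ipsi (ccos a) (cos1 a).
have ics h a := bnd _ _ (ish h) (ccos a) (cos1 a).
have shift h : \int[mu]_x psi x = \int[mu]_x psi (x + h).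
  rewrite /Rintegral (@ge0_integral_affine psi 1 h)//; congr fine.
  by apply: eq_integral => x _; rewrite mul1r mulr1.
(* Invariance under translation is available for nonnegative functions: it is applied
   to [psi (1 + cos)]. *)
have flip a : a != 0 -> \int[mu]_x (psi x * cos (a * x)) =
    - \int[mu]_x (psi (x + pi / a) * cos (a * x)).
  move=> a0; pose h := pi / a.
  have : \int[mu]_x (psi x + psi x * cos (a * x)) =
      \int[mu]_x (psi (x + h) + -1 * (psi (x + h) * cos (a * x))).
    rewrite /Rintegral (@ge0_integral_affine _ 1 h)//; last 2 first.
    - by move=> x; apply: cvgD; [exact: cpsi|apply: cvgM; [exact: cpsi|exact: ccos]].
    - by move=> x; rewrite -[X in X + _]mulr1 -mulrDr mulr_ge0// -lerBlDl sub0r cos_geN1.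
    congr fine; apply: eq_integral => x _; congr EFin.
    rewrite mul1r mulr1 (_ : a * (x + h) = a * x + pi); last by rewrite /h; field.
    by rewrite cosDpi; ring.
  have ics' : mu.-integrable setT (EFin \o (fun x => -1 * (psi (x + h) * cos (a * x)))).
    exact: (integrableZl measurableT (-1) (ics h a)).
  by rewrite !RintegralD// RintegralZl// -shift => /addrI ->; rewrite mulN1r.
have main k : b k != 0 -> `|\int[mu]_x (psi x * cos (b k * x))| <=
    fine (\int[mu]_x `|(psi (x + pi / b k))%:E - (psi x)%:E|)%E.
  move=> bk0.
  have id : mu.-integrable setT (EFin \o (fun x => psi (x + pi / b k) - psi x)).
    exact: (integrableB measurableT (ish _) ipsi).
  have idn : mu.-integrable setT (EFin \o (fun x => `|psi (x + pi / b k) - psi x|)).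
    exact: integrable_norm.
  have idc := bnd _ _ id (ccos (b k)) (cos1 (b k)).
  have h2 : 2 * \int[mu]_x (psi x * cos (b k * x)) =
      - \int[mu]_x ((psi (x + pi / b k) - psi x) * cos (b k * x)).
    rewrite (_ : \int[mu]_x ((psi (x + pi / b k) - psi x) * cos (b k * x)) =
      \int[mu]_x (psi (x + pi / b k) * cos (b k * x)) - \int[mu]_x (psi x * cos (b k * x))).
      by rewrite mulr_natl mulr2n {1}(flip _ bk0) opprB addrC.
    by rewrite -RintegralB//; apply: eq_Rintegral => x _; exact: mulrBl.
  have h3 : `|\int[mu]_x ((psi (x + pi / b k) - psi x) * cos (b k * x))| <=
      \int[mu]_x `|psi (x + pi / b k) - psi x|.
    apply: (le_trans (le_normr_Rintegral _ idc)) => //.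
    apply: le_Rintegral => //; first exact: integrable_norm.
    by move=> x _; rewrite normrM ler_piMr.
  have : `|2 * \int[mu]_x (psi x * cos (b k * x))| <= \int[mu]_x `|psi (x + pi / b k) - psi x|.
    by rewrite h2 normrN.
  rewrite normrM ger0_norm// => h4.
  apply: (@le_trans _ _ (2 * `|\int[mu]_x (psi x * cos (b k * x))|)).
    by rewrite ler_peMl// ler1n.
  exact: h4.
have boo1 : \forall k \near \oo, pi <= `|b k| by move/cvgryPge : boo; apply.
have h0 : (fun k => pi / b k) @ \oo --> (0 : R).
  apply/norm_cvg0P; rewrite (_ : (fun k => _) = (fun k => pi * `|b k|^-1)); last first.
    by apply/funext => k; rewrite normrM normfV (ger0_norm (pi_ge0 _)).
  rewrite -[X in _ --> X](mulr0 pi); apply: cvgM; first exact: cvg_cst.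
  apply/(gtr0_cvgV0 (f := fun k => `|b k|)) => //; near=> k.
  by apply: (lt_le_trans (pi_gt0 R)); near: k.
(* Truncated so that the translates are dominated for all [k], not just for large ones. *)
pose h k := if `|pi / b k| <= 1 then pi / b k else 0.
have hE : \forall k \near \oo, h k = pi / b k.
  move/cvgr0Pnorm_le : h0 => /(_ 1 ltr01); apply: filterS => k.
  by rewrite /h => ->.
have hc : h @ \oo --> (0 : R).
  by apply: cvg_trans h0; apply: near_eq_cvg; apply: filterS hE => k ->.
have h1 k : `|h k| <= 1 by rewrite /h; case: ifP => // _; rewrite normr0.
have [_ dc _] : [/\ mu.-integrable setT (EFin \o psi),
   (fun k => \int[mu]_x `|(psi (x + h k))%:E - (psi x)%:E|)%E @ \oo --> (0 : \bar R) &
   (fun k => \int[mu]_x (psi (x + h k))%:E)%E @ \oo --> (\int[mu]_x (psi x)%:E)%E].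
  apply: (@dominated_convergence _ _ _ mu setT measurableT
    (fun k x => (psi (x + h k))%:E) (EFin \o psi) (EFin \o (fun x => K * 3 * decay x))).
  - by move=> k; apply/measurable_EFinP; exact: continuous_measurable_fun.
  - by apply/measurable_EFinP; exact: continuous_measurable_fun.
  - apply: aeW => x _; apply: cvg_EFin; first exact: nearW.
    have hh : (fun k => psi (x + h k)) @ \oo --> psi x.
      apply: continuous_cvg; first exact: cpsi.
      by rewrite -[X in _ --> X]addr0; apply: cvgD; [exact: cvg_cst|exact: hc].
    exact: hh.
  - exact: (integrableZl _ (K * 3) integrable_decay).
  - apply: aeW => x k _; rewrite /= lee_fin ger0_norm//.
    apply: (le_trans (psiK _)); rewrite -mulrA ler_wpM2l//; exact: decay_shift.
apply/norm_cvg0P.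
apply: (squeeze_cvgr (f := fun=> 0)
  (h := fun k => fine (\int[mu]_x `|(psi (x + h k))%:E - (psi x)%:E|)%E)).
- near=> k; rewrite normr_ge0/= (_ : h k = pi / b k); last by near: k.
  apply: main; rewrite -normr_gt0; apply: (lt_le_trans (pi_gt0 R)); near: k; exact: boo1.
- exact: cvg_cst.
- exact: (fine_cvg dc).
Unshelve. all: by end_near. Qed.

End OneDim.

(** * Integrals of product functions *)

Section RnIntegral.
Variable R : realType.
Local Notation mu := (@lebesgue_measure R).

Lemma measurable_tnth_Rn n (i : 'I_n) : measurable_fun setT (fun x : Rn R n => tnth x i).
Proof. exact: measurable_tnth. Qed.

Lemma fubini_cons n (psi : R -> R) (Phi : Rn R n -> R) (F : Rn R n.+1 -> R) :
  mu.-integrable setT (EFin \o psi) ->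
  (@lebesgue_Rn R n).-integrable setT (EFin \o Phi) ->
  (forall y t, F (cons_Rn (y, t)) = psi y * Phi t) ->
  (@lebesgue_Rn R n.+1).-integrable setT (EFin \o F) /\
  \int[lebesgue_Rn]_x F x = \int[mu]_y psi y * \int[lebesgue_Rn]_t Phi t.
Proof.
move=> ipsi iPhi FE.
have mpsi : measurable_fun setT psi by apply/measurable_EFinP; case/integrableP: ipsi.
have mPhi : measurable_fun setT Phi by apply/measurable_EFinP; case/integrableP: iPhi.
have mF : measurable_fun setT F.
  rewrite (_ : F = fun x => psi (tnth x ord0) * Phi [tuple of behead x]).
    apply: measurable_funM; first by apply: (measurableT_comp mpsi); exact: measurable_tnth_Rn.
    by apply: (measurableT_comp mPhi); exact: measurable_behead.
  by apply/funext => x; rewrite -FE; congr F; apply: val_inj; case: x => [[|a s] Hs].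
have mP : measurable_fun setT (fun z : measurableTypeR R * Rn R n => (psi z.1 * Phi z.2)%:E).
  apply/measurable_EFinP; apply: measurable_funM.
    by apply: (measurableT_comp mpsi); exact: measurable_fst.
  by apply: (measurableT_comp mPhi); exact: measurable_snd.
have iP : (@lebesgue_measure R \x @lebesgue_Rn R n)%E.-integrable setT
    (fun z => (psi z.1 * Phi z.2)%:E).
  apply/integrable12ltyP => //=.
  have IPhi : (\int[lebesgue_Rn]_t `|(Phi t)%:E| < +oo)%E by case/integrableP : iPhi.
  have Ipsi : (\int[mu]_y `|(psi y)%:E| < +oo)%E by case/integrableP : ipsi.
  rewrite (eq_integral (fun y : measurableTypeR R => `|(psi y)%:E| * \int[lebesgue_Rn]_t `|(Phi t)%:E|)%E); last first.
    move=> y _; rewrite -ge0_integralZl//.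
      by apply: eq_integral => t _; rewrite -EFinM /= normrM.
    by apply: measurableT_comp => //; exact/measurable_EFinP.
  rewrite ge0_integralZr//; last 2 first.
  - by apply: measurableT_comp => //; exact/measurable_EFinP.
  - exact: integral_ge0.
  by rewrite lte_mul_pinfty// ?integral_ge0// ge0_fin_numE// integral_ge0.
have iF : (lebesgue_measure \x @lebesgue_Rn R n)%E.-integrable (@cons_Rn R n @^-1` setT)
    ((EFin \o F) \o @cons_Rn R n).
  rewrite preimage_setT; congr (_.-integrable _ _): iP.
  by apply/funext => -[y t] /=; rewrite FE.
split.
  apply: (integrable_pushforward _ _ iF) => //; first exact: measurable_cons_Rn.
  exact/measurable_EFinP.
have -> : \int[lebesgue_Rn]_x F x =
  fine (\int[pushforward (lebesgue_measure \x @lebesgue_Rn R n)%E (@cons_Rn R n)]_x (F x)%:E) by [].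
rewrite integral_pushforward//; last 2 first.
- exact: measurable_cons_Rn.
- exact/measurable_EFinP.
rewrite preimage_setT.
rewrite (eq_integral (fun z : measurableTypeR R * Rn R n => (psi z.1 * Phi z.2)%:E)); last first.
  by move=> [y t] _ /=; rewrite FE.
rewrite -integral12_prod_meas1//.
rewrite (eq_integral (fun y : measurableTypeR R => (psi y)%:E * \int[lebesgue_Rn]_t (Phi t)%:E)%E); last first.
  by move=> y _; rewrite -integralZl//; apply: eq_integral => t _; rewrite EFinM.
have fPhi : (\int[lebesgue_Rn]_t (Phi t)%:E)%E \is a fin_num by exact: integrable_fin_num iPhi.
rewrite -(fineK fPhi) integralZr// fineM//.
exact: integrable_fin_num ipsi.
Qed.

Lemma Rintegral_Rn0 (F : Rn R 0 -> R) : (@lebesgue_Rn R 0).-integrable setT (EFin \o F) /\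
  \int[lebesgue_Rn]_x F x = F [tuple].
Proof.
have FE : F = cst (F [tuple]) by apply/funext => x; rewrite (tuple0 x).
have mF : measurable_fun setT F by rewrite FE; exact: measurable_cst.
have -> : \int[lebesgue_Rn]_x F x = fine (\int[\d_([tuple] : Rn R 0)]_x (F x)%:E)%E by [].
rewrite integral_dirac//; last exact/measurable_EFinP.
rewrite diracT mul1e; split=> //; apply/integrableP; split; first exact/measurable_EFinP.
have -> : (\int[@lebesgue_Rn R 0]_x `|(EFin \o F) x| = \int[\d_([tuple] : Rn R 0)]_x `|(F x)%:E|)%E by [].
rewrite integral_dirac//; first by rewrite diracT mul1e ltry.
by apply: measurableT_comp => //; exact/measurable_EFinP.
Qed.

Lemma integrable_mul_le1 d (T : measurableType d) (m : {measure set T -> \bar R}) (f u : T -> R) :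
  m.-integrable setT (EFin \o f) -> measurable_fun setT u -> (forall x, `|u x| <= 1) ->
  m.-integrable setT (EFin \o (fun x => f x * u x)).
Proof.
move=> fi mu1 u1; apply: (@le_integrable _ _ _ m setT measurableT _ (EFin \o f)) => //.
  apply/measurable_EFinP; apply: measurable_funM => //.
  by apply/measurable_EFinP; case/integrableP: fi.
by move=> x _ /=; rewrite lee_fin normrM ler_piMr.
Qed.

(** Both half-lines are exchanged by the reflection. *)
Lemma ge0_integral_opp (f : R -> R) : measurable_fun setT f -> (forall x, 0 <= f x) ->
  (\int[mu]_x (f x)%:E = \int[mu]_x (f (- x))%:E)%E.
Proof.
move=> mf f0.
have mfN : measurable_fun setT (fun x : R => f (- x)).
  by apply: measurableT_comp => //; exact: oppr_measurable.
have split (g : R -> R) : measurable_fun setT g -> (forall x, 0 <= g x) ->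
    (\int[mu]_x (g x)%:E = \int[mu]_(x in `]-oo, 0%R]) (g x)%:E + \int[mu]_(x in `[0%R, +oo[) (g x)%:E)%E.
  move=> mg g0; rewrite -(@integral_itv_obnd_cbnd R 0); last first.
    by apply/measurable_EFinP; exact: measurable_funTS.
  rewrite -ge0_integral_setU//.
  - by rewrite -setCitvl setUv.
  - by apply/measurable_EFinP; exact: measurable_funTS.
  - by move=> x _; rewrite lee_fin.
  - rewrite disj_set2E; apply/eqP; rewrite -subset0 => x []/= /[!in_itv]/=.
    by rewrite andbT leNgt => /negP.
have flip (g : R -> R) : measurable_fun setT g -> (forall x, 0 <= g x) ->
    (\int[mu]_(x in `[0%R, +oo[) (g x)%:E = \int[mu]_(x in `]-oo, 0%R]) (g (- x))%:E)%E.
  move=> mg g0; apply: (@ge0_integration_by_substitution0 R (EFin \o g)).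
    exact/measurable_EFinP.
  by move=> x; rewrite lee_fin.
rewrite split// [RHS]split// flip// (flip (fun x => f (- x)))//.
by rewrite addeC; congr (_ + _)%E; apply: eq_integral => x _; rewrite opprK.
Qed.

Section Tensor.
Variable psi : R -> R.
Hypothesis ipsi : mu.-integrable setT (EFin \o psi).
Hypothesis cpsi : continuous psi.
Hypothesis psi_ge0 : forall x, 0 <= psi x.
Hypothesis psiN : forall x, psi (- x) = psi x.

Definition tensor n (x : Rn R n) : R := \prod_(i < n) psi (tnth x i).

Definition lin n (a : 'I_n -> R) (x : Rn R n) : R := \sum_(i < n) a i * tnth x i.

Lemma tensor_cons n y (t : Rn R n) : tensor (cons_Rn (y, t)) = psi y * tensor t.
Proof.
rewrite /tensor big_ord_recl; congr (_ * _).
by apply: eq_bigr => i _; rewrite tnthS.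
Qed.

Lemma lin_cons n a y (t : Rn R n) :
  lin a (cons_Rn (y, t)) = a ord0 * y + lin (fun i => a (lift ord0 i)) t.
Proof.
rewrite /lin big_ord_recl; congr (_ + _).
by apply: eq_bigr => i _; rewrite tnthS.
Qed.

Lemma continuous_cosM (a : R) : continuous (fun x : R => cos (a * x)).
Proof.
move=> x; apply: continuous_comp; last exact: continuous_cos.
by apply: cvgM; [exact: cvg_cst|exact: cvg_id].
Qed.

Lemma continuous_sinM (a : R) : continuous (fun x : R => sin (a * x)).
Proof.
move=> x; apply: continuous_comp; last exact: continuous_sin.
by apply: cvgM; [exact: cvg_cst|exact: cvg_id].
Qed.

Lemma integrable_mul_cos (a : R) : mu.-integrable setT (EFin \o (fun x => psi x * cos (a * x))).
Proof.
apply: integrable_mul_le1 => //; last by move=> x; exact: cos_max.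
exact: continuous_measurable_fun (@continuous_cosM a).
Qed.

Lemma integrable_mul_sin (a : R) : mu.-integrable setT (EFin \o (fun x => psi x * sin (a * x))).
Proof.
apply: integrable_mul_le1 => //; last by move=> x; exact: sin_max.
exact: continuous_measurable_fun (@continuous_sinM a).
Qed.

(** The reflection [x |-> - x] exchanges the nonnegative functions [psi (1 + sin)] and
    [psi (1 - sin)]. *)
Lemma Rintegral_odd (a : R) : \int[mu]_x (psi x * sin (a * x)) = 0.
Proof.
have : \int[mu]_x (psi x + psi x * sin (a * x)) = \int[mu]_x (psi x + -1 * (psi x * sin (a * x))).
  rewrite /Rintegral ge0_integral_opp; last 2 first.
  - apply: measurable_funD; first exact: continuous_measurable_fun.
    apply: measurable_funM; first exact: continuous_measurable_fun.
    exact: continuous_measurable_fun (@continuous_sinM a).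
  - by move=> x; rewrite -[X in X + _]mulr1 -mulrDr mulr_ge0// -lerBlDl sub0r sin_geN1.
  congr fine; apply: eq_integral => x _ /=.
  by rewrite psiN mulrN sinN mulrN mulN1r.
have i1 : mu.-integrable setT (EFin \o (fun x => -1 * (psi x * sin (a * x)))).
  exact: (integrableZl measurableT (-1) (integrable_mul_sin a)).
rewrite !RintegralD//; try exact: integrable_mul_sin.
rewrite RintegralZl//; last exact: integrable_mul_sin.
by move: (\int[mu]_x (psi x * sin (a * x))) => I; move: (\int[mu]_x psi x) => J; lra.
Qed.

(** The Fourier transform of an even product function is the product of the cosine
    transforms.  Sine and cosine are treated together because the addition formulas
    mix them in the induction on the dimension. *)
Lemma Rintegral_tensor_cos_sin n (a : 'I_n -> R) :
  [/\ (@lebesgue_Rn R n).-integrable setT (EFin \o (fun x => tensor x * cos (lin a x))),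
      (@lebesgue_Rn R n).-integrable setT (EFin \o (fun x => tensor x * sin (lin a x))),
      \int[lebesgue_Rn]_x (tensor x * cos (lin a x)) =
        \prod_(i < n) \int[mu]_y (psi y * cos (a i * y)) &
      \int[lebesgue_Rn]_x (tensor x * sin (lin a x)) = 0].
Proof.
elim: n a => [|n IHn] a.
  have [i1 e1] := Rintegral_Rn0 (fun x => tensor x * cos (lin a x)).
  have [i2 e2] := Rintegral_Rn0 (fun x => tensor x * sin (lin a x)).
  split=> //; rewrite ?e1 ?e2 /tensor /lin !big_ord0 ?cos0 ?sin0 ?mulr1 ?mulr0//.
have [ic is_ ec es] := IHn (fun i => a (lift ord0 i)).
pose F (u : R -> R) (v : Rn R n -> R) (x : Rn R n.+1) :=
  u (tnth x ord0) * v [tuple of behead x].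
have FE u v y t : F u v (cons_Rn (y, t)) = u y * v t.
  by rewrite /F; congr (u _ * v _); exact: val_inj.
have [icc ecc] := fubini_cons (integrable_mul_cos (a ord0)) ic (FE _ _).
have [ics ecs] := fubini_cons (integrable_mul_cos (a ord0)) is_ (FE _ _).
have [isc esc] := fubini_cons (integrable_mul_sin (a ord0)) ic (FE _ _).
have [iss ess] := fubini_cons (integrable_mul_sin (a ord0)) is_ (FE _ _).
have consK (x : Rn R n.+1) : x = cons_Rn (tnth x ord0, [tuple of behead x]).
  by apply: val_inj; case: x => [[|y s] Hs].
have Ec : (fun x => tensor x * cos (lin a x)) =
   fun x => F (fun y => psi y * cos (a ord0 * y)) (fun t => tensor t * cos (lin (fun i => a (lift ord0 i)) t)) x
    - F (fun y => psi y * sin (a ord0 * y)) (fun t => tensor t * sin (lin (fun i => a (lift ord0 i)) t)) x.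
  apply/funext => x; rewrite [x]consK !FE tensor_cons lin_cons cosD; ring.
have Es : (fun x => tensor x * sin (lin a x)) =
   fun x => F (fun y => psi y * sin (a ord0 * y)) (fun t => tensor t * cos (lin (fun i => a (lift ord0 i)) t)) x
    + F (fun y => psi y * cos (a ord0 * y)) (fun t => tensor t * sin (lin (fun i => a (lift ord0 i)) t)) x.
  apply/funext => x; rewrite [x]consK !FE tensor_cons lin_cons sinD; ring.
rewrite Ec Es; split.
- exact: (integrableB measurableT icc iss).
- exact: (integrableD measurableT isc ics).
- by rewrite RintegralB// ecc ess ec es mulr0 subr0 big_ord_recl.
- by rewrite RintegralD// esc ecs es Rintegral_odd mulr0 mul0r addr0.
Qed.

End Tensor.
End RnIntegral.

(** * Fourier transforms of modulated envelopes *)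

Section ProductIntegrals.
Variable R : realType.
Local Notation mu := (@lebesgue_measure R).

Lemma tentN (b : R) : tent (- b) = tent b.
Proof.
rewrite /tent normrN; have -> : `|- b + 1| = `|b - 1| by rewrite -normrN opprD opprK.
have -> : `|- b - 1| = `|b + 1| by rewrite -normrN opprD !opprK.
ring.
Qed.

Lemma integrable_tent_sqr (m : R) :
  mu.-integrable setT (EFin \o (fun x => tent (2 * pi * (x + m)) ^+ 2)).
Proof.
have twopi : 0 < 2 * pi :> R by rewrite mulr_gt0// pi_gt0.
have c : continuous (fun x : R => tent x ^+ 2).
  by move=> x; apply: cvgM; exact: continuous_tent.
have i : mu.-integrable setT (EFin \o (fun x : R => tent x ^+ 2)).
  apply: (@integrable_le_decay _ _ ((2 * fejer_mass R) ^+ 2)) => // x.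
  rewrite normrX; apply: (@le_trans _ _ ((2 * fejer_mass R * decay x) ^+ 2)).
    by rewrite lerXn2r ?nnegrE//; [exact: le_trans (norm_tent_le x)|exact: norm_tent_le].
  rewrite exprMn ler_wpM2l ?sqr_ge0// expr2 ler_piMr//; first exact/ltW/decay_gt0.
  exact: (oneDsqrV_le1 x).
have := integrable_affine m twopi c (fun x => sqr_ge0 _) i.
move=> /(integrableZl measurableT (2 * pi)^-1).
congr (_.-integrable _ _); apply/funext => x /=.
by rewrite -EFinM mulKf ?gt_eqF// mulrC.
Qed.

Lemma integrable_prod n (F : 'I_n -> R -> R) :
  (forall i, mu.-integrable setT (EFin \o F i)) ->
  (@lebesgue_Rn R n).-integrable setT (EFin \o (fun x => \prod_(i < n) F i (tnth x i))).
Proof.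
elim: n F => [|n IHn] F iF; first by case: (Rintegral_Rn0 (fun x => \prod_(i < 0) F i (tnth x i))).
have iF' i : mu.-integrable setT (EFin \o F (lift ord0 i)) by exact: iF.
have [] := @fubini_cons R n _ _ (fun x => \prod_(i < n.+1) F i (tnth x i)) (iF ord0) (IHn _ iF').
- move=> y t; rewrite big_ord_recl; congr (_ * _).
  by apply: eq_bigr => i _; rewrite tnthS.
- by [].
Qed.

Lemma linZ n c (a : 'I_n -> R) x : lin (fun i => c * a i) x = c * lin a x.
Proof. by rewrite /lin mulr_sumr; apply: eq_bigr => i _; rewrite mulrA. Qed.

Lemma linD n (a b : 'I_n -> R) x : lin (fun i => a i + b i) x = lin a x + lin b x.
Proof. by rewrite /lin -big_split; apply: eq_bigr => i _; rewrite /= mulrDl. Qed.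

Lemma linB n (a b : 'I_n -> R) x : lin (fun i => a i - b i) x = lin a x - lin b x.
Proof. by rewrite /lin -sumrB; apply: eq_bigr => i _; rewrite /= mulrBl. Qed.

End ProductIntegrals.

Section RnFourier.
Context {R : realType} {n : nat}.
Local Open Scope complex_scope.
Local Notation Rn := (Rn R n).
Local Notation lam := (@lebesgue_Rn R n).
Implicit Types (f h phi : Rn -> R) (mu : 'I_n -> R).

(** The localisation common to the test function and to its images. *)
Definition envelope (x : Rn) : R := tensor (@fejer R) x.

Definition realC f : Rn -> R[i] := fun x => (f x)%:C.

Lemma fejer_tensor_cos_sin mu :
  [/\ lam.-integrable setT (EFin \o (fun x => envelope x * cos (lin mu x))),
      lam.-integrable setT (EFin \o (fun x => envelope x * sin (lin mu x))),
      \int[lam]_x (envelope x * cos (lin mu x)) = \prod_(i < n) tent (mu i) &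
      \int[lam]_x (envelope x * sin (lin mu x)) = 0].
Proof.
have [i1 i2 e1 e2] := @Rintegral_tensor_cos_sin R _ (@integrable_fejer R)
  (@continuous_fejer R) (@fejer_ge0 R) (@fejerN R) n mu.
by split=> //; rewrite e1; apply: eq_bigr => i _; exact: Rintegral_fejer_cos.
Qed.

Lemma envelope_ge0 x : 0 <= envelope x.
Proof. by apply: prodr_ge0 => i _; exact: fejer_ge0. Qed.

Lemma envelope_le1 x : envelope x <= 1.
Proof.
apply: prodr_ile1 => i _.
by rewrite fejer_ge0 (le_trans (fejer_le_half _))//; lra.
Qed.

Lemma integrable_envelope : lam.-integrable setT (EFin \o envelope).
Proof.
have [i1 _ _ _] := fejer_tensor_cos_sin (fun=> 0).
congr (_.-integrable _ _): i1; apply/funext => x /=.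
by rewrite /lin big1 ?cos0 ?mulr1// => i _; rewrite mul0r.
Qed.

Lemma measurable_envelope : measurable_fun setT envelope.
Proof. by apply/measurable_EFinP; case/integrableP: integrable_envelope. Qed.

Lemma measurable_lin mu : measurable_fun setT (lin mu).
Proof.
apply: measurable_sum => i; apply: measurable_funM => //.
exact: measurable_tnth_Rn.
Qed.

Lemma measurable_cos_lin mu : measurable_fun setT (fun x : Rn => cos (lin mu x)).
Proof.
apply: measurableT_comp; last exact: measurable_lin.
by apply: continuous_measurable_fun; exact: continuous_cos.
Qed.

Lemma measurable_sin_lin mu : measurable_fun setT (fun x : Rn => sin (lin mu x)).
Proof.
apply: measurableT_comp; last exact: measurable_lin.
by apply: continuous_measurable_fun; exact: continuous_sin.
Qed.

(** [phi] is the Fourier transform of [f], both being regular enough for the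
    Fourier transform on L^2 and for membership in every L^p with [1 <= p]. *)
Record spec f phi : Prop := Spec {
  spec_meas : measurable_fun setT f;
  spec_dom : exists K : R, forall x, `|f x| <= K * envelope x;
  spec_measF : measurable_fun setT phi;
  spec_sqr : lam.-integrable setT (EFin \o (fun x => phi x ^+ 2));
  spec_fourier : fourier (realC f) = realC phi }.

Lemma dom_integrable f (u : Rn -> R) : measurable_fun setT f -> (exists K : R, forall x, `|f x| <= K * envelope x) ->
  measurable_fun setT u -> (forall x, `|u x| <= 1) ->
  lam.-integrable setT (EFin \o (fun x => f x * u x)).
Proof.
move=> mf [K fK] mu1 u1; apply: integrable_mul_le1 => //.
apply: (@le_integrable _ _ _ lam setT measurableT _ (EFin \o (fun x => K * envelope x))).
- exact/measurable_EFinP.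
- by move=> x _ /=; rewrite lee_fin (le_trans (fK x))// ler_norm.
- exact: (integrableZl measurableT K integrable_envelope).
Qed.

Lemma Re_mul_cis (a t : R) : complex.Re (a%:C * cis t) = a * cos t.
Proof. by rewrite /= mul0r subr0. Qed.

Lemma Im_mul_cis (a t : R) : complex.Im (a%:C * cis t) = a * sin t.
Proof. by rewrite /= mul0r addr0. Qed.

Lemma dot_lin x (xi : Rn) : 2 * pi * dot_Rn x xi = lin (fun i => 2 * pi * tnth xi i) x.
Proof.
rewrite /dot_Rn /lin mulr_sumr; apply: eq_bigr => i _.
by rewrite [tnth x i * _]mulrC mulrA.
Qed.

Lemma fourier_realE f xi : fourier (realC f) xi =
  (\int[lam]_x (f x * cos (lin (fun i => 2 * pi * tnth xi i) x))) +i*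
  (\int[lam]_x (f x * - sin (lin (fun i => 2 * pi * tnth xi i) x))).
Proof.
rewrite /fourier /integralC; congr (_ +i* _); apply: eq_Rintegral => x _.
  by rewrite Re_mul_cis cosN dot_lin.
by rewrite Im_mul_cis sinN dot_lin.
Qed.

Lemma spec_lin f1 phi1 f2 phi2 (a : R) : spec f1 phi1 -> spec f2 phi2 ->
  spec (fun x => a * f1 x + f2 x) (fun x => a * phi1 x + phi2 x).
Proof.
move=> [mf1 df1 mp1 s1 F1] [mf2 df2 mp2 s2 F2]; split.
- by apply: measurable_funD => //; exact: measurable_funM.
- move: df1 df2 => [K1 d1] [K2 d2]; exists (`|a| * K1 + K2) => x.
  rewrite mulrDl (le_trans (ler_normD _ _))// lerD// normrM -mulrA ler_wpM2l//.
- by apply: measurable_funD => //; exact: measurable_funM.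
- apply: (@le_integrable _ _ _ lam setT measurableT _
    (EFin \o (fun x => 2 * a ^+ 2 * phi1 x ^+ 2 + 2 * phi2 x ^+ 2))).
  + apply/measurable_EFinP; apply: measurable_funX.
    by apply: measurable_funD => //; exact: measurable_funM.
  + move=> x _ /=; rewrite lee_fin !ger0_norm ?sqr_ge0//; last first.
      by have := sqr_ge0 (a * phi1 x); have := sqr_ge0 (phi2 x); nra.
    by have := sqr_ge0 (a * phi1 x - phi2 x); nra.
  + exact: (integrableD measurableT (integrableZl measurableT (2 * a ^+ 2) s1)
      (integrableZl measurableT 2 s2)).
- apply/funext => xi.
  have E1 := congr1 (fun F => F xi) F1; have E2 := congr1 (fun F => F xi) F2.
  rewrite fourier_realE /realC /= in E1; rewrite fourier_realE /realC /= in E2.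
  case: E1 => c1 s1'; case: E2 => c2 s2'.
  rewrite fourier_realE /realC; set L := fun i : 'I_n => _ in c1 s1' c2 s2' *.
  have mc : measurable_fun setT (fun x : Rn => cos (lin L x)) := measurable_cos_lin L.
  have ms : measurable_fun setT (fun x : Rn => - sin (lin L x)).
    by apply: measurableT_comp => //; exact: measurable_sin_lin.
  have bc (x : Rn) : `|cos (lin L x)| <= 1 by exact: cos_max.
  have bs (x : Rn) : `|- sin (lin L x)| <= 1 by rewrite normrN; exact: sin_max.
  have lincomb (u : Rn -> R) : measurable_fun setT u -> (forall x, `|u x| <= 1) ->
      \int[lam]_x ((a * f1 x + f2 x) * u x) =
      a * \int[lam]_x (f1 x * u x) + \int[lam]_x (f2 x * u x).
    move=> mu1 u1; have i1 := dom_integrable mf1 df1 mu1 u1.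
    have i2 := dom_integrable mf2 df2 mu1 u1.
    have i3 : lam.-integrable setT (EFin \o (fun x => a * (f1 x * u x))).
      exact: (integrableZl measurableT a i1).
    rewrite -RintegralZl// -RintegralD//; apply: eq_Rintegral => x _.
    by rewrite mulrDl mulrA.
  by rewrite !lincomb// c1 c2 s1' s2' mulr0 addr0.
Qed.

Lemma spec0 : spec (fun=> 0) (fun=> 0).
Proof.
split => //.
- by exists 0 => x; rewrite normr0 mul0r.
- rewrite (_ : _ \o _ = cst 0%E); first exact: integrable0.
  by apply/funext => x /=; rewrite expr0n.
- apply/funext => xi; rewrite fourier_realE /realC.
  by congr (_ +i* _); under eq_Rintegral do rewrite mul0r;
    rewrite /Rintegral integral0.
Qed.

(** The Fourier transform of a modulated envelope is a pair of compactly supported bumps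
    around plus and minus its frequency. *)
Lemma spec_cos mu : exists phi, spec (fun x => envelope x * cos (2 * pi * lin mu x)) phi /\
  forall xi, phi xi != 0 ->
    (forall i, `|mu i - tnth xi i| <= 1) \/ (forall i, `|mu i + tnth xi i| <= 1).
Proof.
(* The two bumps, one for each exponential in the cosine. *)
pose P (xi : Rn) : R := \prod_(i < n) tent (2 * pi * (mu i - tnth xi i)).
pose M (xi : Rn) : R := \prod_(i < n) tent (2 * pi * (mu i + tnth xi i)).
exists (fun xi => 2^-1 * P xi + 2^-1 * M xi).
have twopi : 0 < 2 * pi :> R by rewrite mulr_gt0// pi_gt0.
have mtent (a : R) (i : 'I_n) (c : R) : measurable_fun setT (fun xi : Rn => tent (2 * pi * (a + c * tnth xi i))).
  apply: measurableT_comp; first by apply: continuous_measurable_fun; exact: continuous_tent.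
  by apply: measurable_funM => //; apply: measurable_funD => //; apply: measurable_funM => //;
    exact: measurable_tnth_Rn.
have PE : P = fun xi => \prod_(i < n) tent (2 * pi * (mu i + -1 * tnth xi i)).
  by apply/funext => xi; apply: eq_bigr => i _; rewrite mulN1r.
have ME : M = fun xi => \prod_(i < n) tent (2 * pi * (mu i + 1 * tnth xi i)).
  by apply/funext => xi; apply: eq_bigr => i _; rewrite mul1r.
have mP : measurable_fun setT P by rewrite PE; apply: measurable_prod => i _; exact: mtent.
have mM : measurable_fun setT M by rewrite ME; apply: measurable_prod => i _; exact: mtent.
have iP : lam.-integrable setT (EFin \o (fun xi => P xi ^+ 2)).
  have := @integrable_prod R n (fun i x => tent (2 * pi * (mu i - x)) ^+ 2).
  rewrite (_ : (fun xi => P xi ^+ 2) = fun xi => \prod_(i < n) tent (2 * pi * (mu i - tnth xi i)) ^+ 2).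
    apply=> i; have := integrable_tent_sqr (- mu i).
    by congr (_.-integrable _ _); apply/funext => x /=; rewrite -tentN -mulrN opprD opprK addrC.
  by apply/funext => xi; rewrite prodrXl.
have iM : lam.-integrable setT (EFin \o (fun xi => M xi ^+ 2)).
  have := @integrable_prod R n (fun i x => tent (2 * pi * (mu i + x)) ^+ 2).
  rewrite (_ : (fun xi => M xi ^+ 2) = fun xi => \prod_(i < n) tent (2 * pi * (mu i + tnth xi i)) ^+ 2).
    apply=> i; have := integrable_tent_sqr (mu i).
    by congr (_.-integrable _ _); apply/funext => x /=; rewrite addrC.
  by apply/funext => xi; rewrite prodrXl.
split; last first.
  have supp (F : 'I_n -> R) : \prod_(i < n) tent (2 * pi * F i) != 0 -> forall i, `|F i| <= 1.
    move=> /prodf_neq0 h i; have := h i isT; apply: contraNT; rewrite -ltNge => F1.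
    apply/eqP/tent_eq0; rewrite normrM (gtr0_norm twopi).
    have := pi_ge2 R; nra.
  move=> xi; have [P0|/supp] := eqVneq (P xi) 0; last by left.
  have [M0|/supp] := eqVneq (M xi) 0; last by right.
  by rewrite P0 M0 mulr0 addr0 eqxx.
split.
- apply: measurable_funM; first exact: measurable_envelope.
  rewrite (_ : (fun x => _) = fun x => cos (lin (fun i => 2 * pi * mu i) x)).
    exact: measurable_cos_lin.
  by apply/funext => x; rewrite linZ.
- exists 1 => x; rewrite normrM mul1r (ger0_norm (envelope_ge0 x)) ler_piMr ?envelope_ge0//.
  exact: cos_max.
- by apply: measurable_funD; apply: measurable_funM.
- apply: (@le_integrable _ _ _ lam setT measurableT _ (EFin \o (fun x => P x ^+ 2 + M x ^+ 2))).
  + by apply/measurable_EFinP; apply: measurable_funX; apply: measurable_funD; apply: measurable_funM.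
  + move=> x _ /=; rewrite lee_fin !ger0_norm ?sqr_ge0 ?addr_ge0 ?sqr_ge0//.
    by have := sqr_ge0 (P x - M x); have := sqr_ge0 (P x + M x); nra.
  + exact: (integrableD measurableT iP iM).
- apply/funext => xi; rewrite fourier_realE /realC.
  set a := fun i => 2 * pi * (mu i + tnth xi i); set b := fun i => 2 * pi * (mu i - tnth xi i).
  have La x : lin a x = 2 * pi * lin mu x + lin (fun i => 2 * pi * tnth xi i) x.
    by rewrite -linZ -linD; apply: eq_bigr => i _; rewrite /a mulrDr.
  have Lb x : lin b x = 2 * pi * lin mu x - lin (fun i => 2 * pi * tnth xi i) x.
    by rewrite -linZ -linB; apply: eq_bigr => i _; rewrite /b mulrBr.
  have [ac as_ eac eas] := fejer_tensor_cos_sin a.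
  have [bc bs ebc ebs] := fejer_tensor_cos_sin b.
  have sc k (F : Rn -> R) : lam.-integrable setT (EFin \o F) ->
      lam.-integrable setT (EFin \o (fun x => k * F x)).
    by move=> iF; exact: (integrableZl measurableT k iF).
  congr (_ +i* _).
    transitivity (\int[lam]_x (2^-1 * (envelope x * cos (lin b x)) + 2^-1 * (envelope x * cos (lin a x)))).
      by apply: eq_Rintegral => x _; rewrite -mulrA cos_mul_cos La Lb; field.
    by rewrite RintegralD ?RintegralZl ?eac ?ebc//; exact: sc.
  transitivity (\int[lam]_x (2^-1 * (envelope x * sin (lin b x)) + - 2^-1 * (envelope x * sin (lin a x)))).
    by apply: eq_Rintegral => x _; rewrite La Lb sinB sinD; field.
  by rewrite RintegralD ?RintegralZl ?eas ?ebs ?mulr0 ?addr0//; exact: sc.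
Qed.

End RnFourier.

(** * Multipliers that are constant on the spectrum *)

Section Multiplier.
Context {R : realType} {n : nat}.
Local Open Scope complex_scope.
Local Notation Rn := (Rn R n).
Local Notation lam := (@lebesgue_Rn R n).
Implicit Types (f h phi kap : Rn -> R) (mu : 'I_n -> R) (p : R).

Lemma normc_real (x : R) : Normc.normc x%:C = `|x|.
Proof. by rewrite /= expr0n addr0 sqrtr_sqr. Qed.

Lemma LnormC_real p f : p != 0 ->
  LnormC p (realC f) = ((\int[lam]_x (`|f x| `^ p)%:E) `^ p^-1)%E.
Proof.
move=> p0; rewrite /LnormC unlock; congr (_ `^ _)%E; apply: eq_integral => x _.
by rewrite /realC normc_real /= normr_id.
Qed.

Lemma Lnorm_real p f : p != 0 ->
  Lnorm lam p%:E (EFin \o f) = ((\int[lam]_x (`|f x| `^ p)%:E) `^ p^-1)%E.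
Proof. by move=> p0; rewrite unlock. Qed.

Lemma LfunC_real p f : 0 < p -> measurable_fun setT f ->
  lam.-integrable setT (EFin \o (fun x => `|f x| `^ p)) -> LfunC p (realC f).
Proof.
move=> p0 mf fi; split; [exact: mf|exact: measurable_cst|].
rewrite LnormC_real ?gt_eqF// poweR_lty//.
case/integrableP: fi => _; apply: le_lt_trans; rewrite le_eqVlt; apply/orP; left; apply/eqP.
by apply: eq_integral => x _ /=; rewrite [in RHS]ger0_norm// powR_ge0.
Qed.

Lemma measurable_powR_norm p f : measurable_fun setT f -> measurable_fun setT (fun x => `|f x| `^ p).
Proof.
move=> mf; apply: (measurableT_comp (@measurable_powR R p)).
by apply: measurableT_comp => //; exact: normr_measurable.
Qed.

(** The envelope is at most [1], so its powers are dominated by the envelope. *)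
Lemma integrable_powR_dom p f (K : R) : 1 <= p -> measurable_fun setT f ->
  (forall x, `|f x| <= K * envelope x) ->
  lam.-integrable setT (EFin \o (fun x => `|f x| `^ p)).
Proof.
move=> p1 mf fK.
have fK' x : `|f x| <= `|K| * envelope x.
  by apply: (le_trans (fK x)); rewrite ler_wpM2r ?envelope_ge0 ?ler_norm.
apply: (@le_integrable _ _ _ lam setT measurableT _ (EFin \o (fun x => `|K| `^ p * envelope x))).
- by apply/measurable_EFinP; exact: measurable_powR_norm.
- move=> x _ /=; rewrite lee_fin [leLHS]ger0_norm ?powR_ge0//.
  rewrite [leRHS]ger0_norm ?mulr_ge0 ?powR_ge0 ?envelope_ge0//.
  apply: (@le_trans _ _ ((`|K| * envelope x) `^ p)).
    by rewrite ge0_ler_powR ?nnegrE ?mulr_ge0 ?envelope_ge0//; lra.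
  rewrite powRM ?envelope_ge0// ler_wpM2l ?powR_ge0//.
  have [->|e0] := eqVneq (envelope x) 0; first by rewrite powR0//; lra.
  rewrite -[leRHS]powRr1 ?envelope_ge0//.
  by apply: ger_powR => //; rewrite lt_neqAle eq_sym e0 envelope_ge0 envelope_le1.
- exact: (integrableZl measurableT _ integrable_envelope).
Qed.

Lemma LfunC_spec p f phi : 1 <= p -> spec f phi -> LfunC p (realC f).
Proof.
move=> p1 [mf [K fK] _ _ _]; apply: LfunC_real => //; first by lra.
exact: integrable_powR_dom fK.
Qed.

Lemma LfunC2_spec f phi : spec f phi -> LfunC 2 (realC phi).
Proof.
move=> [_ _ mp sp _]; apply: LfunC_real => //.
congr (_.-integrable _ _): sp; apply/funext => x /=.
by rewrite powR_mulrn// real_normK// num_real.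
Qed.

Lemma cvg_Lp_cst p (f : Rn -> R[i]) : p != 0 -> cvg_Lp p (fun=> f) f.
Proof.
move=> p0; rewrite /cvg_Lp (_ : (fun k : nat => _) = cst 0%E); first exact: cvg_cst.
apply/funext => k /=.
rewrite (_ : (fun x => _) = realC (fun=> 0)); last by apply/funext => x; rewrite subrr.
rewrite LnormC_real//; under eq_integral do rewrite normr0 powR0//.
by rewrite integral0 poweR0r// invr_neq0.
Qed.

Lemma spec_fourier_L2 f phi : spec f phi -> fourier_L2 (realC f) (realC phi).
Proof.
move=> sf; split; [by apply: LfunC_spec sf; lra|exact: LfunC2_spec sf|].
exists (fun=> realC f); split.
- by move=> _; split; apply: LfunC_spec sf; lra.
- exact: cvg_Lp_cst.
- by rewrite (spec_fourier sf); exact: cvg_Lp_cst.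
Qed.

(** The multiplier [kap] on functions with an explicit Fourier transform, where no limit
    is involved. *)
Definition mult kap f h : Prop :=
  exists phi, spec f phi /\ spec h (fun xi => kap xi * phi xi).

(** Constant approximating sequences suffice. *)
Lemma mult_multiplier_op p kap f h : 1 <= p -> mult kap f h ->
  multiplier_op p kap (realC f) (realC h).
Proof.
move=> p1 [phi [sf sh]]; have p0 : p != 0 by rewrite gt_eqF//; lra.
split; [exact: LfunC_spec sf|exact: LfunC_spec sh|].
exists (fun=> realC f), (fun=> realC h); split; try exact: cvg_Lp_cst.
move=> _; split; [exact: LfunC_spec sf|exact: LfunC_spec sh|].
exists (realC phi); split; first exact: spec_fourier_L2.
rewrite (_ : (fun xi => _) = realC (fun xi => kap xi * phi xi)); first exact: spec_fourier_L2.
by apply/funext => xi; rewrite /realC rmorphM.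
Qed.

Lemma mult0 kap : mult kap (fun=> 0) (fun=> 0).
Proof.
exists (fun=> 0); split; first exact: spec0.
by rewrite (_ : (fun xi => _) = fun=> 0); [exact: spec0|apply/funext => xi; rewrite mulr0].
Qed.

Lemma mult_lin kap f1 h1 f2 h2 (a : R) : mult kap f1 h1 -> mult kap f2 h2 ->
  mult kap (fun x => a * f1 x + f2 x) (fun x => a * h1 x + h2 x).
Proof.
move=> [phi1 [sf1 sh1]] [phi2 [sf2 sh2]].
exists (fun x => a * phi1 x + phi2 x); split; first exact: spec_lin.
rewrite (_ : (fun xi => kap xi * (a * phi1 xi + phi2 xi)) =
  fun xi => a * (kap xi * phi1 xi) + kap xi * phi2 xi).
  exact: spec_lin.
by apply/funext => xi; rewrite mulrDr mulrCA.
Qed.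

Definition flat kap (b : R) mu : Prop := forall xi : Rn,
  (forall i, `|mu i - tnth xi i| <= 1) \/ (forall i, `|mu i + tnth xi i| <= 1) -> kap xi = b.

(** The two bumps of the Fourier transform lie where [kap] is constant. *)
Lemma mult_cos kap b mu : flat kap b mu ->
  mult kap (fun x => envelope x * cos (2 * pi * lin mu x))
           (fun x => b * (envelope x * cos (2 * pi * lin mu x))).
Proof.
move=> kb; have [phi [sf supp]] := spec_cos mu.
exists phi; split => //.
have -> : (fun xi => kap xi * phi xi) = fun xi => b * phi xi + 0.
  apply/funext => xi; rewrite addr0; have [->|/supp/kb->//] := eqVneq (phi xi) 0.
  by rewrite !mulr0.
rewrite (_ : (fun x => _) = fun x => b * (envelope x * cos (2 * pi * lin mu x)) + 0).
  by apply: spec_lin => //; exact: spec0.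
by apply/funext => x; rewrite addr0.
Qed.

Lemma mult_span kap b (K : set (Rn -> R)) H :
  (forall phi, K phi -> exists mu, flat kap b mu /\ phi = lin mu) -> cos_span K H ->
  mult kap (fun x => envelope x * H x) (fun x => b * (envelope x * H x)).
Proof.
move=> Kb; elim=> [|c phi H' /Kb[mu [kb ->]] _ IH].
  have := mult0 kap; congr mult; apply/funext => x; by rewrite !mulr0.
have := mult_lin c (mult_cos kb) IH.
congr mult; apply/funext => x; ring.
Qed.

End Multiplier.

(** * From oscillating integrals to averages over independent angles *)

(** The position of a node in the breadth-first enumeration of the tree: an injective
    integer that increases along every path. *)
Definition heap_index (s : seq bool) : nat := foldl (fun h (b : bool) => (2 * h + b)%N) 1%N s.

Lemma heap_rcons s b : heap_index (rcons s b) = (2 * heap_index s + b)%N.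
Proof. by rewrite /heap_index foldl_rcons. Qed.

Lemma heap_gt0 s : (0 < heap_index s)%N.
Proof. by elim/last_ind: s => // s b IHs; rewrite heap_rcons; lia. Qed.

Lemma heap_inj : injective heap_index.
Proof.
elim/last_ind => [|s b IHs] t; case/lastP: t => [|t c] //.
- by rewrite heap_rcons; have := heap_gt0 t; rewrite /heap_index /=; lia.
- by rewrite heap_rcons; have := heap_gt0 s; rewrite /heap_index /=; lia.
- rewrite !heap_rcons => h; have bc : b = c by case: b c h => [] [] //; lia.
  by rewrite bc in h *; rewrite (IHs t)//; lia.
Qed.

Lemma heap_prefix s t : prefix s t -> s != t -> (heap_index s < heap_index t)%N.
Proof.
move=> /prefixP[u ->]; elim/last_ind: u => [|u b IHu]; first by rewrite cats0 eqxx.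
move=> _; rewrite -rcons_cat heap_rcons.
have := heap_gt0 s; have [->|u0] := eqVneq u [::]; first by rewrite cats0; lia.
have := IHu; rewrite -[X in X != _]cats0 eqseq_cat// eqxx /= eq_sym u0 => /(_ isT).
lia.
Qed.

Lemma seq_max (T : eqType) (f : T -> nat) (r : seq T) x : x \in r ->
  exists2 y, y \in r & forall z, z \in r -> (f z <= f y)%N.
Proof.
elim: r x => // a r IHr x _; case: (r =P [::]) => [->|/eqP].
  by exists a; [exact: mem_head|move=> z; rewrite inE => /eqP ->].
case: r IHr => // b r IHr _; have [y yr ymax] := IHr b (mem_head _ _).
have [ay|ya] := leqP (f a) (f y).
  exists y; first by rewrite inE yr orbT.
  by move=> z; rewrite inE => /predU1P[->//|/ymax].
exists a; first exact: mem_head.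
by move=> z; rewrite inE => /predU1P[->//|/ymax zy]; apply: leq_trans zy (ltnW ya).
Qed.

Section Frequencies.
Variables (R : realType) (n npairs d : nat) (rho : nat -> seq bool -> R).
Hypothesis npairs_le : (2 * npairs <= n)%N.

(** The angle of the node [s] of tree [i], as a function on R^n: a phase of direction
    [(- rho, 1)] in the plane of the coordinates [2 i] and [2 i + 1].  Different
    powers of [T] make the angles asymptotically independent. *)
Definition angles (T : nat) (x : Rn R n) : nat -> seq bool -> R := fun i s =>
  T%:R ^+ heap_index s * (nth 0 x (2 * i).+1 - rho i s * nth 0 x (2 * i)).

Definition phase (k : nat -> seq bool -> int) (th : nat -> seq bool -> R) : R :=
  \sum_(i < npairs) \sum_(s <- paths d) (k i s)%:~R * th i s.

Definition freq2 (T : nat) (k : seq bool -> int) : R :=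
  \sum_(s <- paths d) (k s)%:~R * T%:R ^+ heap_index s.

Definition freq1 (T : nat) (i : nat) (k : seq bool -> int) : R :=
  \sum_(s <- paths d) (k s)%:~R * - (rho i s * T%:R ^+ heap_index s).

(** The frequency vector of a phase, once the angles are functions on R^n. *)
Definition freq (T : nat) (k : nat -> seq bool -> int) (j : nat) : R :=
  if (j./2 < npairs)%N then
    if odd j then freq2 T (k j./2) else freq1 T j./2 (k j./2)
  else 0.

Lemma sum_pairs m (F : nat -> R) :
  \sum_(0 <= j < (2 * m)%N) F j = \sum_(i < m) (F (2 * i)%N + F (2 * i).+1).
Proof.
elim: m => [|m IHm]; first by rewrite muln0 big_geq// big_ord0.
rewrite big_ord_recr/= -IHm mulnS addSn addSn add0n.
by rewrite !big_nat_recr//= addrA.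
Qed.

Lemma phase_theta T k x : phase k (angles T x) = lin (fun j : 'I_n => freq T k j) x.
Proof.
have -> : lin (fun j : 'I_n => freq T k j) x = \sum_(0 <= j < n) freq T k j * nth 0 x j.
  by rewrite big_mkord; apply: eq_bigr => j _; rewrite (tnth_nth 0).
rewrite (big_cat_nat _ npairs_le)//= [X in _ + X]big1_seq ?addr0; last first.
  move=> j /andP[_]; rewrite mem_index_iota => /andP[kj _].
  by rewrite /freq ifF ?mul0r//; lia.
rewrite sum_pairs; apply: eq_bigr => i _; rewrite /freq.
have -> : (2 * i)./2 = i by lia.
have -> : (2 * i).+1./2 = i by lia.
rewrite ltn_ord; have -> : odd (2 * i) = false by lia.
have -> /= : odd (2 * i).+1 by lia.
rewrite /freq1 /freq2 !mulr_suml -big_split/=; apply: eq_bigr => s _.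
by rewrite /angles; ring.
Qed.

Lemma paths_uniq : uniq (paths d).
Proof.
elim: d => //= m IHm; rewrite cat_uniq !map_inj_uniq ?IHm//=; try by move=> ? ? [].
rewrite andbT mem_cat; apply/andP; split.
  by apply/norP; split; apply/mapP => -[].
by apply/hasPn => _ /mapP[s _ ->]; apply/mapP => -[].
Qed.

(** A sum of powers is dominated by its leading term. *)
Lemma lower_terms (c : seq bool -> R) (s0 : seq bool) (C : R) (T : nat) :
  0 <= C -> (0 < T)%N ->
  (forall s, s \in paths d -> s != s0 -> c s != 0 -> (heap_index s < heap_index s0)%N /\ `|c s| <= C) ->
  `|\sum_(s <- paths d | s != s0) c s * T%:R ^+ heap_index s| <=
  (size (paths d))%:R * C * T%:R ^+ (heap_index s0).-1.
Proof.
move=> C0 T0 cs; apply: (le_trans (ler_norm_sum _ _ _)).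
have -> : (size (paths d))%:R * C * T%:R ^+ (heap_index s0).-1 =
    \sum_(s <- paths d) C * T%:R ^+ (heap_index s0).-1.
  by rewrite big_const_seq count_predT iter_addr_0 -mulrA mulr_natl.
have CT : 0 <= C * T%:R ^+ (heap_index s0).-1 :> R by rewrite mulr_ge0.
rewrite big_mkcond big_seq [leRHS]big_seq; apply: ler_sum => s sp.
case: ifP => // ss0; have [->|c0] := eqVneq (c s) 0; first by rewrite mul0r normr0.
have [h1 h2] := cs s sp ss0 c0.
rewrite normrM (ger0_norm (exprn_ge0 _ _))// ler_pM//.
by rewrite ler_weXn2l ?ler1n//; lia.
Qed.

(** Distinct nodes have distinct powers of [T], so the node of largest index with
    a non-zero coefficient prevails. *)
Lemma freq2_infty (k : seq bool -> int) : ~~ all (fun s => k s == 0) (paths d) ->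
  (fun T : nat => `|freq2 T k|) @ \oo --> +oo.
Proof.
move=> /allPn[s1 s1p k1].
have [s0 /andP[s0p k0] s0max] : exists2 s0, (s0 \in paths d) && (k s0 != 0) &
    forall s, s \in paths d -> k s != 0 -> (heap_index s <= heap_index s0)%N.
  have s1f : s1 \in [seq s <- paths d | k s != 0] by rewrite mem_filter k1.
  have [s0 s0f s0max] := seq_max heap_index s1f.
  exists s0; first by move: s0f; rewrite mem_filter andbC.
  by move=> s sp ks; apply: s0max; rewrite mem_filter ks.
pose D : R := \sum_(s <- paths d) `|(k s)%:~R|.
have D0 : 0 <= D by apply: sumr_ge0.
pose C := (size (paths d))%:R * D.
apply/cvgryPge => A; near=> T.
have T1 : (1 <= T)%N by near: T; exists 1%N.
have TA : `|A| + C <= T%:R.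
  near: T; exists (Num.bound (`|A| + C)) => // T /= bT.
  apply: (le_trans (ltW (archi_boundP _))); first by rewrite addr_ge0 ?mulr_ge0.
  by rewrite ler_nat.
rewrite /freq2 (bigD1_seq s0)//= ?paths_uniq//.
have low := @lower_terms (fun s => (k s)%:~R) s0 D T D0 T1 _.
have {}low : `|\sum_(s <- paths d | s != s0) (k s)%:~R * T%:R ^+ heap_index s| <=
    (size (paths d))%:R * D * T%:R ^+ (heap_index s0).-1.
  apply: low => s sp ss0; rewrite intr_eq0 => ks; split.
    have := s0max s sp ks; rewrite leq_eqVlt => /orP[/eqP/heap_inj e|//].
    by rewrite e eqxx in ss0.
  by rewrite /D (bigD1_seq s)//= ?paths_uniq// lerDl sumr_ge0.
set X := \sum_(s <- paths d | s != s0) _ in low *.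
have e0 : T%:R ^+ heap_index s0 = T%:R * T%:R ^+ (heap_index s0).-1 :> R.
  by rewrite -exprS prednK ?heap_gt0.
have lead : T%:R * T%:R ^+ (heap_index s0).-1 <= `|(k s0)%:~R * T%:R ^+ heap_index s0| :> R.
  rewrite normrM (ger0_norm (exprn_ge0 _ _))// -e0 ler_peMl ?exprn_ge0//.
  by rewrite -intr_norm -[1]/(1%:~R) ler_int; move: k0; lia.
have t1 : 1 <= T%:R ^+ (heap_index s0).-1 :> R by rewrite exprn_ege1// ler1n.
have := lerB_dist ((k s0)%:~R * T%:R ^+ heap_index s0 : R) (- X); rewrite normrN opprK.
have AN := ler_norm A.
have : (T%:R - C) * 1 <= (T%:R - C) * T%:R ^+ (heap_index s0).-1.
  by rewrite ler_wpM2l// subr_ge0 (le_trans _ TA)// lerDr.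
rewrite -/C in low *; lra.
Unshelve. all: by end_near. Qed.

Section Limit.
Variables (psi : R -> R) (K : R).
Hypothesis ipsi : (@lebesgue_measure R).-integrable setT (EFin \o psi).
Hypothesis cpsi : continuous psi.
Hypothesis psi_ge0 : forall x, 0 <= psi x.
Hypothesis psiN : forall x, psi (- x) = psi x.
Hypothesis psi_le : forall x, psi x <= K * decay x.
Local Notation lam := (@lebesgue_Rn R n).

Let hat (a : R) := \int[@lebesgue_measure R]_y (psi y * cos (a * y)).

Definition mass : R := \int[lam]_x tensor psi x.

Lemma hat_cvg0 (b : nat -> R) : (fun T => `|b T|) @ \oo --> +oo ->
  (fun T => hat (2 * pi * b T)) @ \oo --> (0 : R).
Proof.
move=> boo; apply: (riemann_lebesgue cpsi psi_ge0 psi_le).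
rewrite (_ : (fun k => _) = fun k => 2 * pi * `|b k|).
  have pi2 : 0 < 2 * pi :> R by rewrite mulr_gt0// pi_gt0.
  apply/cvgryPge => A; move/cvgryPge/(_ (A / (2 * pi))) : boo; apply: filterS => T.
  by rewrite ler_pdivrMr// mulrC.
by apply/funext => k; rewrite normrM (gtr0_norm (mulr_gt0 _ _))// pi_gt0.
Qed.

Lemma hat_le (a : R) : `|hat a| <= hat 0.
Proof.
have ic a' := integrable_mul_cos ipsi a'.
apply: (le_trans (le_normr_Rintegral _ (ic a))) => //.
apply: le_Rintegral; [by []|exact: integrable_norm|exact: (ic 0)|].
by move=> x _; rewrite normrM mul0r cos0 mulr1 ger0_norm// ler_piMr// cos_max.
Qed.

Definition all_phases : set ((nat -> seq bool -> R) -> R) :=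
  [set phi | exists k, phi = phase k].

(** The integral is a product of one-dimensional transforms.  If some coefficient is
    not zero, the coordinate [2 i + 1] of its tree has a frequency tending to
    infinity, and Riemann-Lebesgue applies to this factor. *)
Lemma cos_integral_limit (k : nat -> seq bool -> int) :
  (fun T : nat => \int[lam]_x (tensor psi x * cos (2 * pi * phase k (angles T x)))) @ \oo -->
  (if all (fun i => all (fun s => k i s == 0) (paths d)) (iota 0 npairs) then mass else 0).
Proof.
have tcs a := Rintegral_tensor_cos_sin ipsi cpsi psi_ge0 psiN (n := n) a.
have E T : \int[lam]_x (tensor psi x * cos (2 * pi * phase k (angles T x))) =
    \prod_(j < n) hat (2 * pi * freq T k j).
  have [_ _ <- _] := tcs (fun j => 2 * pi * freq T k j).
  by apply: eq_Rintegral => x _; rewrite phase_theta linZ.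
rewrite (funext E); case: ifPn => [/allP k0|/allPn].
  rewrite (_ : (fun T => _) = fun=> mass); first exact: cvg_cst.
  have z s i : (i < npairs)%N -> s \in paths d -> k i s = 0.
    move=> ik sp; have : all (fun s => k i s == 0) (paths d) by apply: k0; rewrite mem_iota.
    by move=> /allP ki; exact/eqP/ki.
  apply/funext => T; have [_ _ <- _] := tcs (fun j => 2 * pi * freq T k j).
  apply: eq_Rintegral => x _; rewrite [lin _ _]big1 ?cos0 ?mulr1// => j _.
  rewrite /freq; case: ifP => [jk|_]; last by rewrite mulr0 mul0r.
  rewrite /freq1 /freq2 !big_seq !big1 ?if_same ?mulr0 ?mul0r// => s sp.
    by rewrite z// mul0r.
  by rewrite z// mul0r.
move=> [i +]; rewrite mem_iota add0n => /andP[_ ik] ki.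
have jn : ((2 * i).+1 < n)%N by lia.
pose j : 'I_n := Ordinal jn.
have fj T : freq T k j = freq2 T (k i).
  have oj : odd (2 * i).+1 by lia.
  have hj : ((2 * i).+1)./2 = i by lia.
  by rewrite -[LHS]/(freq T k (2 * i).+1) /freq hj ik oj.
have h0 : (fun T => hat (2 * pi * freq T k j)) @ \oo --> (0 : R).
  rewrite (_ : (fun T => _) = fun T => hat (2 * pi * freq2 T (k i))).
    by apply: hat_cvg0; exact: freq2_infty.
  by apply/funext => T; rewrite fj.
have hat0 : 0 <= hat 0 by apply: le_trans (hat_le 0).
apply/norm_cvg0P.
apply: (squeeze_cvgr (f := fun=> 0)
  (h := fun T => `|hat (2 * pi * freq T k j)| * hat 0 ^+ n.-1)).
- near=> T; rewrite normr_ge0/= (bigD1 j)//= normrM ler_wpM2l//.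
  rewrite normr_prod; apply: (@le_trans _ _ (\prod_(i0 < n | i0 != j) hat 0)).
    by apply: ler_prod => i0 _; rewrite normr_ge0 hat_le.
  by rewrite prodr_const cardC1 card_ord.
- exact: cvg_cst.
- rewrite -[X in _ --> X](mul0r (hat 0 ^+ n.-1)); apply: cvgM; last exact: cvg_cst.
  exact/norm_cvg0P.
Unshelve. all: by end_near. Qed.

Lemma integrable_span T H : cos_span all_phases H ->
  lam.-integrable setT (EFin \o (fun x => tensor psi x * H (angles T x))).
Proof.
elim=> [|c _ H' [k ->] _ IH].
  rewrite (_ : _ \o _ = cst 0%E); first exact: integrable0.
  by apply/funext => x /=; rewrite mulr0.
have [i1 _ _ _] := Rintegral_tensor_cos_sin ipsi cpsi psi_ge0 psiN
  (n := n) (fun j => 2 * pi * freq T k j).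
have := integrableD measurableT (integrableZl measurableT c i1) IH.
congr (_.-integrable _ _); apply/funext => x /=.
by rewrite -EFinM -EFinD phase_theta linZ; congr EFin; ring.
Qed.

(** Angles become independent as [T] grows: on a single cosine both sides vanish
    in the limit unless the phase does, by Riemann-Lebesgue on the left and by orthogonality of
    characters on the right, and both sides are linear. *)
Lemma mean_limit H : cos_span all_phases H ->
  exists M0, forall M, (M0 <= M)%N ->
  (fun T : nat => \int[lam]_x (tensor psi x * H (angles T x))) @ \oo --> mass * forest_mean M d npairs H.
Proof.
elim=> [|c _ H' [k ->] sH' [M0 IH]].
  exists 1%N => M M0; rewrite forest_mean_cst// mulr0.
  under eq_fun do under eq_Rintegral do rewrite mulr0.
  rewrite (_ : (fun _ => _) = fun=> 0); first exact: cvg_cst.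
  by apply/funext => T; rewrite /Rintegral integral0.
(* The grid must be finer than every coefficient of every phase in the span. *)
pose S := (\sum_(i < npairs) \sum_(s <- paths d) absz (k i s))%N.
exists (maxn M0 S.+1) => M; rewrite geq_max => /andP[M0M SM].
have Mgt0 : (0 < M)%N by apply: leq_ltn_trans SM.
rewrite (_ : forest_mean M d npairs _ = c * forest_mean M d npairs (fun th => cos (0 + 2 * pi * phase k th)) + forest_mean M d npairs H'); last first.
  rewrite -forest_meanZ -forest_meanD; congr forest_mean; apply/funext => th.
  by rewrite add0r.
rewrite forest_mean_cos//; last first.
  move=> i s ik sp; apply: leq_ltn_trans SM.
  rewrite /S (bigD1 (Ordinal ik))//= (bigD1_seq s)//= ?paths_uniq//.
  by rewrite -addnA leq_addr.
rewrite cos0 [mass * _]mulrDr.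
have [i1 _ _ _] := Rintegral_tensor_cos_sin ipsi cpsi psi_ge0 psiN (n := n) (fun j => 0).
rewrite (_ : (fun T => _) = fun T : nat =>
   c * \int[lam]_x (tensor psi x * cos (2 * pi * phase k (angles T x))) +
   \int[lam]_x (tensor psi x * H' (angles T x))).
  apply: cvgD; last exact: IH.
  rewrite mulrCA; apply: cvgM; first exact: cvg_cst.
  by have := @cos_integral_limit k; case: ifP; rewrite ?mulr1 ?mulr0.
apply/funext => T; have ic : lam.-integrable setT
    (EFin \o (fun x => tensor psi x * cos (2 * pi * phase k (angles T x)))).
  apply: (@integrable_span T (fun th => cos (2 * pi * phase k th))).
  by apply: cos_span1; exists k.
have ic' := integrable_span T sH'.
rewrite -RintegralZl// -RintegralD//; first by apply: eq_Rintegral => x _; ring.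
exact: (integrableZl measurableT c ic).
Qed.

End Limit.
End Frequencies.

(** * Sectors on which the cutoffs are constant *)

(** In-order positions of the nodes of the complete tree of depth [d]: the root is at
    [0], and the steps down from it have lengths [2 ^ (d - 1)], [2 ^ (d - 2)], and so
    on. *)
Fixpoint inorder_pos (d : nat) (s : seq bool) : int :=
  if s is b :: s' then (if b then 2 ^+ d.-1 else - 2 ^+ d.-1) + inorder_pos d.-1 s' else 0.

Lemma mem_paths d s : (s \in paths d) = (size s <= d)%N.
Proof.
elim: d s => [|d IHd] [|b s] //=.
rewrite inE/= mem_cat; apply/orP/idP => [[] /mapP[t td [_ ->]]|sd].
- by rewrite ltnS -IHd.
- by rewrite ltnS -IHd.
- by case: b; [right|left]; apply: map_f; rewrite IHd.
Qed.

Lemma mem_leaves d t : (t \in leaves d) = (size t == d).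
Proof.
elim: d t => [|d IHd] [|b t] //=.
  by rewrite mem_cat; apply/orP => -[] /mapP[].
rewrite mem_cat eqSS; apply/orP/idP => [[] /mapP[t' td [_ ->]]|sd].
- by rewrite -IHd.
- by rewrite -IHd.
- by case: b; [right|left]; apply: map_f; rewrite IHd.
Qed.

Lemma pos_bound d s : (size s <= d)%N -> (`|inorder_pos d s| < 2 ^+ d)%R.
Proof.
elim: d s => [|d IHd] [|b s] //= sd; first by rewrite normr0 exprn_gt0.
have := IHd s sd; rewrite exprS; set X := 2 ^+ d; move: (inorder_pos d s) => y.
by case: b; lia.
Qed.

(** The subtree below a child is confined to one side of its parent, since the
    remaining steps add up to less than the step to the child. *)
Lemma before_pos d s t : (size s <= d)%N -> size t = d -> before s t = (inorder_pos d s <= inorder_pos d t)%R.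
Proof.
elim: d s t => [|d IHd] [|c s] [|b t] //= sd.
  move=> [td]; have := @pos_bound d t; rewrite td => /(_ (leqnn _)).
  by set X := 2 ^+ d; move: (inorder_pos d t) => y; case: b; lia.
move=> [td]; have := @pos_bound d t; rewrite td => /(_ (leqnn _)).
have := pos_bound sd; case: eqP => [->|cb]; first by rewrite lerD2l -IHd.
set X := 2 ^+ d; move: (inorder_pos d t) (inorder_pos d s) => y z.
by case: b c cb => [] [] //; lia.
Qed.

Section SectorFreq.
Variables (R : realType) (d : nat) (rho : nat -> seq bool -> R) (i D : nat) (eta : R).
Hypotheses (rho_gt0 : forall s, 0 < rho i s) (eta_gt0 : 0 < eta).

(** For large [T] the leading term of the frequency of a piece, the one at its own
    node, prevails over all others, and over errors of size [1]; it has direction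
    [(- rho, 1)]. *)
Lemma sector_freq : \forall T \near \oo, forall s (k : seq bool -> int),
  s \in paths d ->
  (forall s', s' \in paths d -> k s' != 0 -> prefix s' s) ->
  (forall s', s' \in paths d -> `|k s'| <= D%:Z) -> k s != 0 ->
  forall X1 X2 : R,
  (`|freq1 d rho T i k - X1| <= 1 /\ `|freq2 R d T k - X2| <= 1) \/
  (`|freq1 d rho T i k + X1| <= 1 /\ `|freq2 R d T k + X2| <= 1) ->
  `|X1 / X2 + rho i s| <= eta * rho i s.
Proof.
pose P : R := (size (paths d))%:R.
pose rmax := \sum_(s <- paths d) rho i s.
pose rinv := \sum_(s <- paths d) (rho i s)^-1.
have rmax0 : 0 <= rmax by apply: sumr_ge0 => s _; exact: ltW.
have rinv0 : 0 <= rinv by apply: sumr_ge0 => s _; rewrite invr_ge0 ltW.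
have le_rmax s : s \in paths d -> rho i s <= rmax.
  move=> sp; rewrite /rmax (bigD1_seq s)//= ?paths_uniq// lerDl.
  by apply: sumr_ge0 => ? _; exact: ltW.
have le_rinv s : s \in paths d -> (rho i s)^-1 <= rinv.
  move=> sp; rewrite /rinv (bigD1_seq s)//= ?paths_uniq// lerDl.
  by apply: sumr_ge0 => ? _; rewrite invr_ge0 ltW.
pose C := P * (D%:R * rmax) + 1 + rmax.
have C0 : 0 <= C by rewrite !addr_ge0// !mulr_ge0.
(* [C] bounds the error in the numerator relative to the leading power over [T];
   [T >= B] makes the denominator larger than [C / (eta * rho)]. *)
pose B := P * D%:R + 1 + C * (eta^-1 * rinv) + 1.
near=> T.
have TB : B <= T%:R.
  near: T; exists (Num.bound B) => // T /= bT.
  apply: (le_trans (ltW (archi_boundP _))); last by rewrite ler_nat.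
  by rewrite !addr_ge0// !mulr_ge0// invr_ge0 ltW.
have T1 : (0 < T)%N by near: T; exists 1%N.
move=> s k sp kpre kD ks.
have ksm s' : s' \in paths d -> s' != s -> k s' != 0 -> (heap_index s' < heap_index s)%N.
  by move=> s'p s's ks'; apply: heap_prefix => //; exact: kpre.
have kDR s' : s' \in paths d -> `|(k s')%:~R| <= D%:R :> R.
  by move=> s'p; rewrite -intr_norm -[D%:R]/(D%:~R) ler_int; exact: kD.
pose t : R := T%:R ^+ (heap_index s).-1.
have t1 : 1 <= t by rewrite exprn_ege1// ler1n.
have Tt : T%:R ^+ heap_index s = T%:R * t by rewrite /t -exprS prednK ?heap_gt0.
set f1 := freq1 _ _ _ _ _; set f2 := freq2 _ _ _ _.
have f2E : f2 = (k s)%:~R * (T%:R * t) + \sum_(s' <- paths d | s' != s) (k s')%:~R * T%:R ^+ heap_index s'.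
  by rewrite /f2 /freq2 (bigD1_seq s)//= ?paths_uniq// Tt.
have low2 : `|\sum_(s' <- paths d | s' != s) (k s')%:~R * T%:R ^+ heap_index s'| <= P * D%:R * t.
  apply: lower_terms => // s' s'p s's; rewrite intr_eq0 => ks'.
  by split; [exact: ksm|exact: kDR].
have low1 : `|f1 + rho i s * f2| <= P * (D%:R * rmax) * t.
  rewrite (_ : f1 + rho i s * f2 =
      \sum_(s' <- paths d | s' != s) ((k s')%:~R * (rho i s - rho i s')) * T%:R ^+ heap_index s').
    apply: lower_terms => //; first by rewrite mulr_ge0.
    move=> s' s'p s's; rewrite mulf_eq0 intr_eq0 negb_or => /andP[ks' _].
    split; first exact: ksm.
    rewrite normrM ler_pM//; first exact: kDR.
    have := rho_gt0 s; have := rho_gt0 s'; have := le_rmax s sp; have := le_rmax s' s'p.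
    by rewrite ler_norml; lra.
  rewrite /f1 /f2 /freq1 /freq2 mulr_sumr -big_split/= (bigD1_seq s)//= ?paths_uniq//.
  rewrite [X in X + _](_ : _ = 0) ?add0r; last by ring.
  by apply: eq_bigr => s' _; ring.
have f2_ge : T%:R * t - P * D%:R * t <= `|f2|.
  have lead : T%:R * t <= `|(k s)%:~R * (T%:R * t)|.
    have Tt0 : 0 <= T%:R * t by rewrite mulr_ge0// (le_trans _ t1).
    rewrite normrM (ger0_norm Tt0) ler_peMl//.
    by rewrite -intr_norm -[1]/(1%:~R) ler_int; move: ks; lia.
  rewrite f2E; have := lerB_dist ((k s)%:~R * (T%:R * t) : R) (- \sum_(s' <- paths d | s' != s) (k s')%:~R * T%:R ^+ heap_index s').
  by rewrite normrN opprK; move: low2 lead; set A := `| _ + _|; lra.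
have main X1 X2 : `|f1 - X1| <= 1 -> `|f2 - X2| <= 1 -> `|X1 / X2 + rho i s| <= eta * rho i s.
  move=> h1 h2; have r0 := rho_gt0 s; have rm := le_rmax s sp.
  have X2_ge : t * (T%:R - P * D%:R - 1) <= `|X2|.
    have := ler_normD (f2 - X2) X2; rewrite subrK; move: f2_ge.
    have -> : t * (T%:R - P * D%:R - 1) = T%:R * t - P * D%:R * t - t by ring.
    lra.
  have num : `|X1 + rho i s * X2| <= t * C.
    have -> : X1 + rho i s * X2 = (f1 + rho i s * f2) - (f1 - X1) - rho i s * (f2 - X2) by ring.
    apply: (le_trans (ler_normB _ _)); rewrite normrM (gtr0_norm r0).
    have h3 := ler_normB (f1 + rho i s * f2) (f1 - X1).
    have h4 : rho i s * `|f2 - X2| <= rho i s * 1 by rewrite ler_wpM2l// ltW.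
    have h5 : (1 + rmax) * 1 <= (1 + rmax) * t by rewrite ler_wpM2l// addr_ge0.
    rewrite /C; move: low1 h1 h3 h4 h5; set A := `|_ - (_ - _)|; lra.
  have key : C <= eta * rho i s * (T%:R - P * D%:R - 1).
    have : C * (eta^-1 * (rho i s)^-1) <= T%:R - P * D%:R - 1.
      apply: (@le_trans _ _ (C * (eta^-1 * rinv))).
        by rewrite ler_wpM2l// ler_wpM2l ?invr_ge0 ?(ltW eta_gt0)// le_rinv.
      by move: TB; rewrite /B; lra.
    rewrite -(ler_pM2l (mulr_gt0 eta_gt0 r0)); apply: le_trans.
    by rewrite le_eqVlt; apply/orP; left; apply/eqP; field; rewrite !gt_eqF.
  have X20 : 0 < `|X2|.
    apply: lt_le_trans X2_ge; rewrite mulr_gt0 ?(lt_le_trans _ t1)//.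
    have : 0 <= C * (eta^-1 * rinv) by rewrite !mulr_ge0// invr_ge0 ltW.
    by move: TB; rewrite /B; lra.
  have -> : X1 / X2 + rho i s = (X1 + rho i s * X2) / X2.
    by field; rewrite -normr_gt0.
  rewrite normrM normfV ler_pdivrMr//; apply: (le_trans num).
  apply: (@le_trans _ _ (eta * rho i s * (t * (T%:R - P * D%:R - 1)))); last first.
    by rewrite ler_wpM2l// mulr_ge0 ?(ltW eta_gt0)// ltW.
  by rewrite [leRHS]mulrCA ler_wpM2l// (le_trans _ t1).
move=> X1 X2 [[h1 h2]|[h1 h2]]; first exact: main.
by have := main (- X1) (- X2); rewrite !opprK invrN mulrNN; apply.
Unshelve. all: by end_near. Qed.

End SectorFreq.

Section Sector.
Variables (R : realType) (n : nat) (phip phim : R -> R).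
Hypotheses (n_ge2 : (2 <= n)%N) (phipP : cutoff_pos n phip) (phimP : cutoff_neg n phim).

(** The ratios form a lacunary sequence indexed by the positions, which
    alternates with the dilates by powers of [2] of the transition interval of the
    cutoff: up to sign and inversion this is [[n, n + 1]] or [[2 n, 2 (n + 1)]], and
    [n + 1 < n + 3/2 < 2 n]. *)
Definition node_ratio (e : bool) (a : int) : R :=
  if e then (n%:R + 3 / 2) * 2 ^ a else 2 ^ (- a) / (n%:R + 3 / 2).

(** The positions at which the multiplier of scale [l] equals [1]. *)
Definition kept (e : bool) (l a : int) : bool := if e then l < - a else a <= l.

(** At the ratio [n + 3/2] the sector has half-width less than [1/4], so it stays between
    [n + 1] and [2 n]. *)
Definition sector_tol : R := (4 * (n%:R + 2))^-1.

Let n2 : 2 <= n%:R :> R. Proof. by rewrite ler_nat. Qed.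

Lemma node_ratio_gt0 e a : 0 < node_ratio e a.
Proof.
have c0 : 0 < n%:R + 3 / 2 :> R by rewrite ltr_pwDr//; lra.
by rewrite /node_ratio; case: e; rewrite ?divr_gt0 ?mulr_gt0 ?exprz_gt0.
Qed.

Lemma sector_tol_bounds : 0 < sector_tol /\ sector_tol <= 1 / 16 /\ sector_tol * (n%:R + 2) = 1 / 4.
Proof.
have n0 : 0 < 4 * (n%:R + 2) :> R by have := n2; lra.
split; first by rewrite invr_gt0.
split; last by rewrite /sector_tol; field; have := n2; lra.
by rewrite /sector_tol div1r lef_pV2 ?posrE//; have := n2; lra.
Qed.

Lemma exprz_le_half (m : int) : m < 0 -> 2 ^ m <= 2^-1 :> R.
Proof.
move=> m0; rewrite -[2^-1]/(2 ^ (-1)) ler_eXz2l//; last lra.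
Qed.

Lemma exprz_ge_one (m : int) : 0 <= m -> 1 <= 2 ^ m :> R.
Proof. by case: m => // k _; apply: exprn_ege1; lra. Qed.

(** Inside a narrow sector the argument of the cutoff stays on one side of the
    transition interval: for [+] it is at most [(n + 3/2) / 2] times [1 + sector_tol] in
    absolute value or at least [(n + 3/2) (1 - sector_tol) > n + 1], and
    symmetrically for [-]. *)
Lemma cutoff_const e l a (q : R) : `|q + node_ratio e a| <= sector_tol * node_ratio e a ->
  (if e then phip else phim) (2 ^ l * q) = (kept e l a)%:R.
Proof.
have [t0 [t1 t2]] := sector_tol_bounds; set c : R := n%:R + 3 / 2.
have N2 := n2; have c0 : 0 < c by rewrite /c; lra.
have l0 : 0 < 2 ^ l :> R by rewrite exprz_gt0.
move=> qr; have {qr} : `|2 ^ l * q + 2 ^ l * node_ratio e a| <= sector_tol * (2 ^ l * node_ratio e a).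
  by rewrite -mulrDr normrM (gtr0_norm l0) mulrCA ler_pM2l.
move: (2 ^ l * q) => y; case: e => /=; rewrite /node_ratio -/c.
  rewrite mulrCA -expfzDr ?pnatr_eq0// ler_norml => /andP[y1 y2].
  have [_ _ p0 p1] := phipP; have [la|la] := ltP l (- a).
    have h : 2 ^ (l + a) <= 2^-1 :> R by apply: exprz_le_half; lia.
    have h0 : 0 < 2 ^ (l + a) :> R by rewrite exprz_gt0.
    rewrite p1//; move: (2 ^ (l + a)) h h0 y1 y2 => z h h0 y1 y2.
    have cz : c * z <= c / 2 by rewrite ler_pM2l.
    have : sector_tol * (c * z) <= 1 / 16 * (c * z) by rewrite ler_wpM2r// mulr_ge0// ltW.
    by rewrite /c in cz y1 *; lra.
  have h : 1 <= 2 ^ (l + a) :> R by apply: exprz_ge_one; lia.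
  rewrite p0//; move: (2 ^ (l + a)) h y1 y2 => z h y1 y2.
  have cz : (1 - sector_tol) * c <= (1 - sector_tol) * (c * z).
    by rewrite ler_wpM2l ?ler_peMr ?(ltW c0)//; lra.
  by rewrite -natr1; rewrite /c in cz y2 *; nra.
have -> : 2 ^ l * (2 ^ (- a) / c) = 2 ^ (l - a) / c.
  by rewrite mulrA -expfzDr ?pnatr_eq0.
set w := _ / c; have wE : c * w = 2 ^ (l - a) by rewrite /w mulrC divfK// gt_eqF.
have w0 : 0 < w by rewrite divr_gt0// exprz_gt0.
rewrite ler_norml => /andP[y1 y2].
have [_ _ p1 p0] := phimP; have [al|la] := leP a l.
  have h : 1 <= c * w by rewrite wE; apply: exprz_ge_one; lia.
  rewrite p1//; apply: (@le_lt_trans _ _ (- ((1 - sector_tol) * w))); first by lra.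
  rewrite ltrN2 invf_plt ?posrE; [|lra|by rewrite mulr_gt0//; lra].
  rewrite -[ltLHS]mul1r ltr_pdivrMr; last by rewrite mulr_gt0//; lra.
  have : sector_tol * w <= 1 / 16 * w by rewrite ler_wpM2r// ltW.
  by move=> tw; apply: (le_lt_trans h); rewrite /c; nra.
have h : c * w <= 2^-1 by rewrite wE; apply: exprz_le_half; lia.
rewrite p0//; apply: (@lt_le_trans _ _ (- ((1 + sector_tol) * w))); last by lra.
rewrite ltrN2 -natr1 -[ltRHS]mul1r ltr_pdivlMr; last by lra.
by rewrite /c in h; nra.
Qed.

End Sector.

(** * Spectra of the pieces of a tree sum *)

Section PieceSpectrum.
Variables (R : realType) (npairs d D : nat) (r : R -> R).
Hypothesis span_r : cos_span (harmonics 1 D) r.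
Local Notation assignment := (nat -> seq bool -> R).
Local Notation phase := (@phase R npairs d).
Implicit Types (th : assignment) (k : nat -> seq bool -> int).

Lemma phaseD k1 k2 : phase (fun i s => k1 i s + k2 i s) = fun th => phase k1 th + phase k2 th.
Proof.
apply/funext => th; rewrite /phase -big_split/=; apply: eq_bigr => i _.
by rewrite -big_split/=; apply: eq_bigr => s _; rewrite intrD mulrDl.
Qed.

Lemma phaseB k1 k2 : phase (fun i s => k1 i s - k2 i s) = fun th => phase k1 th - phase k2 th.
Proof.
apply/funext => th; rewrite /phase -sumrB; apply: eq_bigr => i _.
by rewrite -sumrB; apply: eq_bigr => s _; rewrite intrB mulrBl.
Qed.

Lemma phase0 : phase (fun _ _ => 0) = fun=> 0.
Proof. by apply/funext => th; apply: big1 => i _; apply: big1 => s _; rewrite mul0r. Qed.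

Definition single (i : nat) (s : seq bool) (j : int) : nat -> seq bool -> int :=
  fun i' s' => if (i' == i) && (s' == s) then j else 0.

Lemma phase_single i s j : (i < npairs)%N -> s \in paths d ->
  phase (single i s j) = fun th => j%:~R * th i s.
Proof.
move=> ik sp; apply/funext => th.
rewrite /phase (bigD1 (Ordinal ik))//= [X in _ + X]big1 ?addr0; last first.
  move=> i' ii'; apply: big1 => s' _; rewrite /single ifF ?mul0r//.
  by apply/negbTE; rewrite negb_and; apply/orP; left; exact: ii'.
rewrite (bigD1_seq s)//= ?paths_uniq// [X in _ + X]big1 ?addr0; last first.
  by move=> s' s's; rewrite /single (negPf s's) andbF mul0r.
by rewrite /single !eqxx.
Qed.

(** Spectra given by conditions on the coefficients. *)
Definition phases (C : (nat -> seq bool -> int) -> Prop) : set (assignment -> R) :=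
  [set phi | exists2 k, C k & phi = phase k].

Lemma phasesM C1 C2 C H1 H2 :
  (forall k1 k2, C1 k1 -> C2 k2 -> C (fun i s => k1 i s + k2 i s) /\ C (fun i s => k1 i s - k2 i s)) ->
  cos_span (phases C1) H1 -> cos_span (phases C2) H2 ->
  cos_span (phases C) (fun th => H1 th * H2 th).
Proof.
move=> CC; apply: cos_spanM => _ _ [k1 Ck1 ->] [k2 Ck2 ->].
have [? ?] := CC _ _ Ck1 Ck2.
rewrite -phaseD -phaseB; split.
  by exists (fun i s => k1 i s + k2 i s).
by exists (fun i s => k1 i s - k2 i s).
Qed.

Lemma phases_cst C c : C (fun _ _ => 0) -> cos_span (phases C) (fun=> c).
Proof. by move=> C0; apply: cos_span_cst; exists (fun _ _ => 0) => //; rewrite phase0. Qed.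

Lemma phases_sub C1 C2 H : (forall k, C1 k -> C2 k) ->
  cos_span (phases C1) H -> cos_span (phases C2) H.
Proof. by move=> C12; apply: cos_span_sub => phi [k Ck ->]; exists k => //; exact: C12. Qed.

Definition at_node i s (k : nat -> seq bool -> int) : Prop :=
  exists2 j : int, (`|j| <= D%:Z)%R & k = single i s j.

(** Odd multiples of the angle of one node; oddness is remembered as being
    non-zero. *)
Definition odd_at_node i s (k : nat -> seq bool -> int) : Prop :=
  exists2 j : int, (`|j| <= D%:Z)%R /\ j != 0 & k = single i s j.

Lemma span_r_node i s : (i < npairs)%N -> s \in paths d ->
  cos_span (phases (odd_at_node i s)) (fun th => r (th i s)).
Proof.
move=> ik sp; apply: (cos_span_comp (u := fun th : assignment => th i s) _ span_r).
move=> _ [j [jD ->]]; exists (single i s (2 * j + 1)).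
  by exists (2 * j + 1) => //; split=> //; lia.
by rewrite phase_single.
Qed.

Lemma span_branch i s b : (i < npairs)%N -> s \in paths d ->
  cos_span (phases (at_node i s)) (fun th => branch r b (th i s)).
Proof.
move=> ik sp.
rewrite (_ : (fun th => _) = fun th : assignment => 1 / 2 + (if b then 1 / 2 else - (1 / 2)) * r (th i s)); last first.
  by apply/funext => th; rewrite /branch; case: b; field.
apply: cos_spanD.
  by apply: phases_cst; exists 0 => //; apply/funext => i'; apply/funext => s'; rewrite /single if_same.
apply: cos_spanZ; apply: phases_sub (span_r_node ik sp).
by move=> k [j [jD _] ->]; exists j.
Qed.

(** The spectrum of the weight of [u ++ s] seen from [u]: proper ancestors of the
    node, none of them above [u]. *)
Definition below i (u s : seq bool) (k : nat -> seq bool -> int) : Prop :=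
  (forall i' s', k i' s' != 0 ->
     i' = i /\ exists v, [/\ s' = u ++ v, prefix v s & v != s]) /\
  forall i' s', (`|k i' s'| <= D%:Z)%R.

Lemma below0 i u s : below i u s (fun _ _ => 0).
Proof. by split=> // i' s'; rewrite eqxx. Qed.

(** One branching factor per proper ancestor; each of them involves a node that no other
    factor involves, so coefficients do not add up. *)
Lemma span_weight i s u : (i < npairs)%N -> (size (u ++ s) <= d)%N ->
  cos_span (phases (below i u s)) (fun th => weight r s (fun v => th i (u ++ v))).
Proof.
move=> ik; elim: s u => [|b s IHs] u us; first exact: (phases_cst _ (below0 i u [::])).
have us' : (size (rcons u b ++ s) <= d)%N by rewrite cat_rcons.
have up : u \in paths d.
  by rewrite mem_paths; apply: leq_trans us; rewrite size_cat leq_addr.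
have := phasesM (C := below i u (b :: s)) _ (span_branch b ik up) (IHs _ us').
rewrite (_ : (fun th : assignment => branch r b (th i u) * _) =
  fun th => weight r (b :: s) (fun v => th i (u ++ v))); last first.
  apply/funext => th /=; rewrite cats0; congr (_ * weight r s _).
  by apply/funext => v; rewrite /subtree cat_rcons.
apply=> _ k2 [j jD ->] [k2s k2D].
have k2u : k2 i u = 0.
  apply/eqP; apply: contraT => /k2s[_ [v [e _ _]]]; exfalso.
  by move/(congr1 size): e; rewrite size_cat size_rcons; lia.
have aux (j' : int) (k2' : nat -> seq bool -> int) : (`|j'| <= D%:Z)%R ->
    (forall i' s', (k2' i' s' == 0) = (k2 i' s' == 0)) ->
    (forall i' s', (`|k2' i' s'| <= D%:Z)%R) ->
    below i u (b :: s) (fun i' s' => single i u j' i' s' + k2' i' s').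
  move=> jD' k2z k2D'; split=> i' s'; rewrite /single.
    case: ifPn => [/andP[/eqP -> /eqP ->] _|_].
      by split=> //; exists [::]; rewrite cats0.
    rewrite add0r k2z => /k2s[-> [v [-> pv vs]]]; split=> //.
    by exists (b :: v); rewrite cat_rcons; split=> //=; rewrite ?eqxx//; apply: contra vs => /eqP[->].
  case: ifPn => [/andP[/eqP -> /eqP ->]|_]; last by rewrite add0r.
  have /eqP -> : k2' i u == 0 by rewrite k2z k2u.
  by rewrite addr0.
split; first exact: aux.
have := @aux j (fun i' s' => - k2 i' s') jD _ _; apply.
  by move=> i' s'; rewrite oppr_eq0.
by move=> i' s'; rewrite normrN.
Qed.

(** All nodes are ancestors of [s], which itself is present: the frequency is led by
    that of [s], whose index is the largest. *)
Definition led_by i s (k : nat -> seq bool -> int) : Prop :=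
  [/\ forall i' s', k i' s' != 0 -> i' = i /\ prefix s' s,
      forall i' s', (`|k i' s'| <= D%:Z)%R & k i s != 0].

(** The weight involves only the proper ancestors of [s], and [r] is odd. *)
Lemma span_piece i s : (i < npairs)%N -> s \in paths d ->
  cos_span (phases (led_by i s)) (fun th => piece r s (th i)).
Proof.
move=> ik sp; have sd : (size ([::] ++ s) <= d)%N by rewrite -mem_paths.
apply: (phasesM _ (span_weight ik sd) (span_r_node ik sp)).
move=> k1 _ [k1s k1D] [j [jD j0] ->].
have k1i : k1 i s = 0.
  apply/eqP; apply: contraT => /k1s[_ [v [/= e _ vs]]].
  by rewrite e eqxx in vs.
have aux j' : (`|j'| <= D%:Z)%R -> j' != 0 -> led_by i s (fun i' s' => k1 i' s' + single i s j' i' s').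
  move=> jD' j0'; split; rewrite /single.
  - move=> i' s'; case: ifPn => [/andP[/eqP -> /eqP ->] _|_].
      by split=> //; exact: prefix_refl.
    by rewrite addr0 => /k1s[-> [v [-> pv _]]].
  - move=> i' s'; case: ifPn => [/andP[/eqP -> /eqP ->]|_]; last by rewrite addr0.
    by rewrite k1i add0r.
  - by rewrite !eqxx k1i add0r.
split; first exact: aux.
have := @aux (- j); rewrite normrN oppr_eq0 => /(_ jD j0).
congr led_by; apply/funext => i'; apply/funext => s'.
by rewrite /single; case: ifP => _; rewrite ?subr0 ?addr0.
Qed.

Definition selected (P : pred (seq bool)) (th : seq bool -> R) : R :=
  \sum_(s <- paths d | P s) piece r s th.

Lemma cos_span_big (X : Type) (I : eqType) (q : seq I) (P : pred I) (F : I -> X -> R) K :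
  (forall i, i \in q -> cos_span K (F i)) ->
  cos_span K (fun x => \sum_(i <- q | P i) F i x).
Proof.
elim: q => [|i q IHq] KF.
  rewrite (_ : (fun x => _) = fun=> 0); first exact: cos_span0.
  by apply/funext => x; rewrite big_nil.
have := IHq (fun j jq => KF j (mem_behead (s := i :: q) jq)).
rewrite (_ : (fun x => \sum_(j <- i :: q | P j) F j x) = fun x =>
  (if P i then F i x else 0) + \sum_(j <- q | P j) F j x); last first.
  by apply/funext => x; rewrite big_cons; case: ifP; rewrite ?add0r.
apply: cos_spanD; case: (P i); last exact: cos_span0.
by apply: KF; exact: mem_head.
Qed.

Definition off i (k : nat -> seq bool -> int) : Prop := forall s, k i s = 0.

Lemma span_selected_off i i' P : (i' < npairs)%N -> i' != i ->
  cos_span (phases (off i)) (fun th => selected P (th i')).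
Proof.
move=> ik' ii'; apply: cos_span_big => s sp.
apply: phases_sub (span_piece ik' sp) => k [ks _ _] s'.
by apply/eqP; apply: contraT => /ks[e _]; rewrite e eqxx in ii'.
Qed.

Lemma cos_span_prod (X : Type) (I : Type) (q : seq I) (P : pred I) (F : I -> X -> R) (K : set (X -> R)) :
  K (fun=> 0) -> (forall u v, K u -> K v -> K (fun x => u x + v x) /\ K (fun x => u x - v x)) ->
  (forall i, P i -> cos_span K (F i)) ->
  cos_span K (fun x => \prod_(i <- q | P i) F i x).
Proof.
move=> K0 KK KF; elim: q => [|i q IHq].
  rewrite (_ : (fun x => _) = fun=> 1); first exact: cos_span_cst.
  by apply/funext => x; rewrite big_nil.
rewrite (_ : (fun x => _) = fun x =>
  (if P i then F i x else 1) * \prod_(j <- q | P j) F j x); last first.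
  by apply/funext => x; rewrite big_cons; case: ifP; rewrite ?mul1r.
by apply: (cos_spanM KK) IHq; case: (boolP (P i)) => [/KF //|_]; exact: cos_span_cst.
Qed.

Lemma off_closed i : (phases (off i)) (fun=> 0) /\
  (forall u v, phases (off i) u -> phases (off i) v ->
    phases (off i) (fun x => u x + v x) /\ phases (off i) (fun x => u x - v x)).
Proof.
split; first by exists (fun _ _ => 0); rewrite ?phase0.
move=> _ _ [k1 k10 ->] [k2 k20 ->]; rewrite -phaseD -phaseB.
by split; eexists; try reflexivity; move=> s; rewrite k10 k20 ?subrr ?addr0.
Qed.

(** Only the coefficients at tree [i] decide where a product of pieces is located with
    respect to the pair of coordinates of tree [i]. *)
Definition led_at i s (k : nat -> seq bool -> int) : Prop :=
  [/\ forall s', k i s' != 0 -> prefix s' s,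
      forall s', (`|k i s'| <= D%:Z)%R & k i s != 0].

(** The factors for the other trees have no coefficient at tree [i]. *)
Lemma span_piece_rest (i : 'I_npairs) s (P : 'I_npairs -> pred (seq bool)) : s \in paths d ->
  cos_span (phases (led_at i s)) (fun th => piece r s (th i) *
     \prod_(i' < npairs | i' != i) selected (P i') (th i')).
Proof.
move=> sp; have [off0 offM] := off_closed i.
have rest : cos_span (phases (off i)) (fun th => \prod_(i' < npairs | i' != i) selected (P i') (th i')).
  apply: cos_span_prod => // i' ii'; exact: span_selected_off.
apply: (phasesM _ (span_piece (ltn_ord i) sp) rest) => k1 k2 [k1s k1D k1i] k20.
split; split=> [s'|s'|]; rewrite k20 ?addr0 ?subr0//; by move=> /k1s[].
Qed.

End PieceSpectrum.

(** * The multipliers truncate tree sums *)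

Section Compose.
Variables (R : realType) (n npairs d D : nat) (r : R -> R).
Hypothesis npairs_le : (2 * npairs <= n)%N.
Hypothesis span_r : cos_span (harmonics 1 D) r.
Local Notation Rn := (Rn R n).
Implicit Types (P : 'I_npairs -> pred (seq bool)) (rho : nat -> seq bool -> R).

(** The envelope times a product of selections of pieces, one per tree: the form of
    the test function and of all its images. *)
Definition filtered rho T P (x : Rn) : R :=
  envelope x * \prod_(i < npairs) selected d r (P i) (angles rho T x i).

Lemma mult_sum_seq (kap : Rn -> R) (I : eqType) (q : seq I) (F G : I -> Rn -> R) :
  (forall i, i \in q -> mult kap (F i) (G i)) ->
  mult kap (fun x => \sum_(i <- q) F i x) (fun x => \sum_(i <- q) G i x).
Proof.
elim: q => [|i q IHq] FG.
  by have := mult0 kap; congr mult; apply/funext => x; rewrite big_nil.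
have FGq j : j \in q -> mult kap (F j) (G j) by move=> jq; apply: FG; rewrite inE jq orbT.
have := mult_lin 1 (FG i (mem_head _ _)) (IHq FGq).
by congr mult; apply/funext => x; rewrite big_cons mul1r.
Qed.

(** Expanding the factor of tree [i] into pieces, each term has its spectrum in the
    sector of one node, where the multiplier is a constant. *)
Lemma mult_filtered rho T (kap : Rn -> R) (i : 'I_npairs) (b : pred (seq bool)) P :
  (forall s k, s \in paths d -> led_at D i s k ->
     flat kap (b s)%:R (fun j : 'I_n => freq npairs d rho T k j)) ->
  mult kap (filtered rho T P) (filtered rho T (fun i' s => P i' s && ((i' == i) ==> b s))).
Proof.
move=> fl; pose rest th := \prod_(i' < npairs | i' != i) selected d r (P i') (th i').
pose term s (x : Rn) := envelope x * (piece r s (angles rho T x i) * rest (angles rho T x)).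
have E x : filtered rho T P x = \sum_(s <- [seq s <- paths d | P i s]) term s x.
  rewrite big_filter /filtered (bigD1 i)//= -/(rest (angles rho T x)).
  by rewrite {1}/selected mulr_suml mulr_sumr.
have E' x : filtered rho T (fun i' s => P i' s && ((i' == i) ==> b s)) x =
    \sum_(s <- [seq s <- paths d | P i s]) (b s)%:R * term s x.
  rewrite big_filter /filtered (bigD1 i)//=.
  have -> : \prod_(i' < npairs | i' != i) selected d r (fun s => P i' s && ((i' == i) ==> b s))
      (angles rho T x i') = rest (angles rho T x).
    by apply: eq_bigr => i' /negPf ii'; apply: eq_bigl => s; rewrite ii' andbT.
  rewrite {1}/selected mulr_suml mulr_sumr eqxx/=.
  rewrite big_mkcond [RHS]big_mkcond; apply: eq_bigr => s _ /=.
  by case: (P i s) => //=; case: (b s); rewrite /= ?mul1r ?mul0r.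
rewrite (funext E) (funext E'); apply: mult_sum_seq => s; rewrite mem_filter => /andP[_ sp].
apply: (@mult_span _ _ _ _ [set phi | exists2 k, led_at D i s k & phi = lin (fun j : 'I_n => freq npairs d rho T k j)]
  (fun x => piece r s (angles rho T x i) * rest (angles rho T x))).
  by move=> _ [k lk ->]; eexists; split; [exact: fl lk|].
apply: (cos_span_comp (u := angles rho T) _ (span_piece_rest span_r i P sp)).
by move=> _ [k lk ->]; exists k => //; apply/funext => x; rewrite /comp phase_theta.
Qed.

Variables (phip phim : R -> R).
Hypotheses (n_ge2 : (2 <= n)%N) (phipP : cutoff_pos n phip) (phimP : cutoff_neg n phim).
Variables (sigma : 'I_npairs -> Sigma n) (e : signs n).
Hypothesis sigma1 : forall i, (val (sigma i)).1 = (2 * i)%N :> nat.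
Hypothesis sigma2 : forall i, (val (sigma i)).2 = (2 * i).+1 :> nat.

(** The ratio at a node of tree [i] depends on the sign prescribed for the pair
    [sigma i]; indices beyond the last tree get an arbitrary sign. *)
Definition slope (i : nat) (s : seq bool) : R :=
  node_ratio R n (if insub i is Some j then e (sigma j) else true) (inorder_pos d s).

(** The tolerance of the frequencies in [sector_freq] is the one that [cutoff_const] allows,
    and all but finitely many [T] suit the finitely many trees at once. *)
Lemma flat_kappa : \forall T \near \oo, forall (i : 'I_npairs) s k l, s \in paths d -> led_at D i s k ->
  flat (kappa phip phim (e (sigma i)) (sigma i) l) (kept (e (sigma i)) l (inorder_pos d s))%:R
       (fun j : 'I_n => freq npairs d slope T k j).
Proof.
have [tol0 _] := @sector_tol_bounds R n n_ge2.
have near_all := filter_forall _ (fun i : 'I_npairs =>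
  sector_freq d D (rho := slope) (i := i) (fun s => node_ratio_gt0 R n _ _) tol0).
apply: filterS (near_all _) => T sec i s k l sp [kpre kD ks] xi near_xi.
rewrite /kappa; apply: (cutoff_const n_ge2 phipP phimP).
have slopeE : slope i s = node_ratio R n (e (sigma i)) (inorder_pos d s) by rewrite /slope valK.
rewrite -slopeE; apply: (sec i s (k i)) => //.
- by move=> s' _; exact: kpre.
have f1 : freq npairs d slope T k (val (sigma i)).1 = freq1 d slope T i (k i).
  rewrite sigma1 /freq; have -> : (2 * i)./2 = i by lia.
  by rewrite ltn_ord; have -> : odd (2 * i) = false by lia.
have f2 : freq npairs d slope T k (val (sigma i)).2 = freq2 R d T (k i).
  rewrite sigma2 /freq; have -> : (2 * i).+1./2 = i by lia.
  by rewrite ltn_ord; have -> : odd (2 * i).+1 by lia.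
by rewrite -f1 -f2; case: near_xi => h; [left|right]; split; exact: h.
Qed.

Hypothesis sigma_inj : injective sigma.

(** The multipliers of the pairs are applied one after the other, each of them
    selecting in its own tree. *)
Lemma K_op_filtered p : 1 <= p -> \forall T \near \oo, forall l : scales n,
  K_op phip phim p e [set sigma i | i : 'I_npairs]%SET l
    (realC (filtered slope T (fun _ => xpredT)))
    (realC (filtered slope T (fun i s => kept (e (sigma i)) (l (sigma i)) (inorder_pos d s)))).
Proof.
move=> p1; apply: filterS flat_kappa => T fl l.
(* After the multipliers of the pairs in [us], only their trees are truncated.  Truncations are
   idempotent, so the induction runs over arbitrary lists of pairs. *)
pose keep (us : seq (Sigma n)) (i : 'I_npairs) s := (sigma i \in us) ==> kept (e (sigma i)) (l (sigma i)) (inorder_pos d s).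
have step us : {subset us <= [set sigma i | i : 'I_npairs]%SET} ->
    multiplier_comp p [seq kappa phip phim (e s) s (l s) | s <- us]
      (realC (filtered slope T (fun _ => xpredT))) (realC (filtered slope T (keep us))).
  elim: us => [|u us IHus] sub_us //=.
  have /imsetP[i _ ui] := sub_us u (mem_head _ _).
  exists (realC (filtered slope T (keep us))); split.
    by apply: IHus => v vus; apply: sub_us; rewrite inE vus orbT.
  apply: mult_multiplier_op => //.
  have := @mult_filtered slope T (kappa phip phim (e u) u (l u)) i
    (fun s => kept (e u) (l u) (inorder_pos d s)) (keep us).
  rewrite ui => /(_ (fun s k sp lk => fl i s k _ sp lk)).
  congr mult; congr filtered; apply/funext => i'; apply/funext => s.
  rewrite /keep inE (inj_eq sigma_inj); case: eqP => [->|] /=; last by rewrite andbT.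
  by case: (sigma i \in us) => /=; rewrite ?andbb.
have := step (enum [set sigma i | i : 'I_npairs]%SET) _.
rewrite /K_op (_ : keep _ = fun i s => kept (e (sigma i)) (l (sigma i)) (inorder_pos d s)).
  by apply=> u; rewrite mem_enum.
by apply/funext => i; apply/funext => s; rewrite /keep mem_enum imset_f.
Qed.

(** The scale at which the multiplier of pair [sigma i] keeps exactly the nodes before
    the leaf [t i]; for the sign [+] the order of the scales is reversed. *)
Definition scale_of (t : 'I_npairs -> seq bool) : scales n := [ffun u =>
  if [pick i | sigma i == u] is Some i then
    (if e u then - inorder_pos d (t i) - 1 else inorder_pos d (t i)) else 0].

Lemma kept_scale_of t i s : size (t i) = d -> s \in paths d ->
  kept (e (sigma i)) (scale_of t (sigma i)) (inorder_pos d s) = before s (t i).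
Proof.
move=> td; rewrite mem_paths => sd; rewrite (before_pos sd td) /scale_of ffunE.
case: pickP => [j /eqP/sigma_inj ->|/(_ i)]; last by rewrite eqxx.
rewrite /kept; case: (e (sigma i)) => //=.
by move: (inorder_pos d s) (inorder_pos d (t i)) => a b; lia.
Qed.

Lemma filtered_scale_of rho T t x : (forall i, size (t i) = d) ->
  filtered rho T (fun i s => kept (e (sigma i)) (scale_of t (sigma i)) (inorder_pos d s)) x =
  envelope x * \prod_(i < npairs) part_sum r d (t i) (angles rho T x i).
Proof.
move=> td; congr (_ * _); apply: eq_bigr => i _; rewrite /selected /part_sum.
rewrite big_seq_cond [RHS]big_seq_cond; apply: eq_bigl => s.
by case: (boolP (s \in paths d)) => // sp; rewrite kept_scale_of.
Qed.

Hypothesis r_le1 : forall x, `|r x| <= 1.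

(** Some partial sum is largest. *)
Lemma linearised_le_part th : exists2 t, size t = d & `|linearised r d th| <= `|part_sum r d t th|.
Proof.
pose t0 : d.-tuple bool := [tuple false | _ < d].
pose best := [arg max_(t > t0) `|part_sum r d (tval t) th|]%O.
exists best; first by rewrite size_tuple.
apply: norm_linearised => // t; rewrite mem_leaves => td.
rewrite /best; case: Order.TotalTheory.arg_maxP => // t' _ /(_ (Tuple td)); exact.
Qed.

End Compose.

(** * Powers of the envelope *)

Section RealPowers.
Variables (R : realType).
Implicit Types (p a y : R).

(** Moments of even order are polynomial, hence computable, and control all others. *)
Lemma powR_le_even_power p y q : 1 <= p -> 0 <= y -> p <= (2 * q)%:R -> y `^ p <= 1 + y ^+ (2 * q).
Proof.
move=> p1 y0 pq; have [y1|/ltW y1] := leP y 1.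
  apply: (@le_trans _ _ 1); last by rewrite lerDl exprn_ge0.
  have -> : 1 = 1 `^ p :> R by rewrite powR1.
  by apply: ge0_ler_powR; rewrite ?nnegrE//; lra.
apply: (@le_trans _ _ (y ^+ (2 * q))); last by rewrite lerDr.
by rewrite -powR_mulrn//; exact: ler_powR.
Qed.

(** Convexity of the power: it lies above its tangent at [a].  This bounds an L^p norm
    below by a first moment. *)
Lemma powR_tangent p a y : 1 < p -> 0 < a -> 0 <= y ->
  p * a `^ (p - 1) * y - (p - 1) * a `^ p <= y `^ p.
Proof.
move=> p1 a0 y0; have p0 : 0 < p by lra.
have q0 : 0 < p / (p - 1) by rewrite divr_gt0//; lra.
have pq : p^-1 + (p / (p - 1))^-1 = 1 by field; apply/andP; split; lra.
have := conjugate_powR y0 (powR_ge0 a (p - 1)) p0 q0 pq.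
rewrite -powRrM (_ : (p - 1) * (p / (p - 1)) = p); last by field; lra.
rewrite -(ler_pM2l p0) mulrDr.
have -> : p * (y `^ p / p) = y `^ p by field; lra.
have -> : p * (a `^ p / (p / (p - 1))) = (p - 1) * a `^ p by field; apply/andP; split; lra.
have -> : p * (y * a `^ (p - 1)) = p * a `^ (p - 1) * y by ring.
lra.
Qed.

Lemma powR_prod (I : Type) (s : seq I) p (F : I -> R) : (forall i, 0 <= F i) ->
  (\prod_(i <- s) F i) `^ p = \prod_(i <- s) F i `^ p.
Proof.
move=> F0; elim: s => [|i s IHs]; first by rewrite !big_nil powR1.
by rewrite !big_cons powRM ?IHs// prodr_ge0.
Qed.

End RealPowers.

Section FejerPower.
Variables (R : realType) (p : R).
Hypothesis p1 : 1 <= p.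
Local Notation mu := (@lebesgue_measure R).

(** The one-dimensional factor of the density [envelope ^ p]. *)
Definition fejer_pow (x : R) : R := fejer x `^ p.

Lemma fejer_pow_ge0 x : 0 <= fejer_pow x. Proof. exact: powR_ge0. Qed.

Lemma fejer_powN x : fejer_pow (- x) = fejer_pow x.
Proof. by rewrite /fejer_pow fejerN. Qed.

(** Powers of order at least [1] decrease numbers below [1]. *)
Lemma fejer_pow_le x : fejer_pow x <= fejer x.
Proof.
have f0 := fejer_ge0 x; have f1 := fejer_le_half x.
rewrite /fejer_pow; have [->|e0] := eqVneq (fejer x) 0.
  by rewrite powR0// gt_eqF// (lt_le_trans ltr01 p1).
rewrite -[leRHS]powRr1//; apply: ger_powR => //.
by rewrite lt_neqAle eq_sym e0 f0 (le_trans f1)//; lra.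
Qed.

Lemma fejer_pow_le_decay x : fejer_pow x <= 3 * decay x.
Proof. exact: le_trans (fejer_pow_le x) (fejer_le_decay x). Qed.

(** At the zeros of [fejer] the power is squeezed between [0] and [fejer]. *)
Lemma continuous_fejer_pow : continuous fejer_pow.
Proof.
move=> x; have cf := @continuous_fejer R x.
have := fejer_ge0 x; rewrite le_eqVlt => /predU1P[f0|f0].
  have p0 : p != 0 by rewrite gt_eqF// (lt_le_trans ltr01 p1).
  have fp0 : fejer_pow x = 0 by rewrite /fejer_pow -f0 powR0.
  rewrite /continuous_at fp0; apply: (squeeze_cvgr (f := fun=> 0) (h := @fejer R)).
  - by near=> y; rewrite fejer_pow_ge0 fejer_pow_le.
  - exact: cvg_cst.
  - by rewrite [X in _ --> X]f0.
have E : \forall y \near x, expR (p * ln (fejer y)) = fejer_pow y.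
  near=> y; rewrite /fejer_pow /powR gt_eqF//; near: y.
  exact: (cvgr_gt (fejer x) cf).
rewrite /continuous_at -(nbhs_singleton E).
apply: cvg_trans (near_eq_cvg E) _.
apply: continuous_cvg; first exact: continuous_expR.
apply: cvgM; first exact: cvg_cst.
by apply: continuous_cvg => //; exact: continuous_ln.
Unshelve. all: by end_near. Qed.

Lemma integrable_fejer_pow : mu.-integrable setT (EFin \o fejer_pow).
Proof.
apply: (@integrable_le_decay _ _ 3); first exact: continuous_fejer_pow.
by move=> x; rewrite ger0_norm ?fejer_pow_ge0// fejer_pow_le_decay.
Qed.

Lemma tensor_fejer_pow n (x : Rn R n) : tensor fejer_pow x = envelope x `^ p.
Proof. by rewrite /envelope /tensor powR_prod// => i; exact: fejer_ge0. Qed.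

(** By continuity [fejer] exceeds [1/4] on an interval, its value at [0] being [1/2]. *)
Lemma Rintegral_fejer_pow_gt0 : 0 < \int[mu]_x fejer_pow x.
Proof.
have c0 : 0 < (1 / 4) `^ p :> R by rewrite powR_gt0//; lra.
have [e /= e0 near0] : \forall x \near 0, 1 / 4 < @fejer R x.
  by apply: (cvgr_gt _ (@continuous_fejer R 0)); rewrite fejer0; lra.
pose A : set R := [set` `]0, e[].
have iA : mu.-integrable setT (EFin \o (\1_A : R -> R)) by exact: integrable_indic_itv.
have ie : mu.-integrable setT (EFin \o (fun x : R => (1 / 4) `^ p * \1_A x)).
  exact: (integrableZl measurableT _ iA).
apply: (@lt_le_trans _ _ (\int[mu]_x ((1 / 4) `^ p * \1_A x))).
  rewrite RintegralZl// mulr_gt0// /Rintegral integral_indic ?setIT; [|exact: measurableT|exact: measurable_itv].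
  have muA : mu A = e%:E.
    by have := @lebesgue_measure_itv R `]0, e[; rewrite /= lte_fin e0 sube0.
  have : 0 < fine (mu A) by rewrite muA.
  exact.
apply: le_Rintegral => //; first exact: integrable_fejer_pow.
move=> x _; rewrite indicE; case: (boolP (x \in _)) => [|_]; last by rewrite mulr0 powR_ge0.
rewrite inE /A/= in_itv/= => /andP[x0 xe].
rewrite mulr1; apply: ge0_ler_powR; rewrite ?nnegrE ?fejer_ge0//; [exact: le_trans ler01 p1|].
by apply/ltW/near0; rewrite /= sub0r normrN gtr0_norm.
Qed.

Lemma mass_gt0 n : 0 < mass n fejer_pow.
Proof.
have [_ _ + _] := Rintegral_tensor_cos_sin integrable_fejer_pow continuous_fejer_pow
  fejer_pow_ge0 fejer_powN (n := n) (fun=> 0).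
have -> : (fun x : Rn R n => tensor fejer_pow x * cos (lin (fun=> 0) x)) = @tensor R fejer_pow n.
  by apply/funext => x; rewrite [lin _ _]big1 ?cos0 ?mulr1// => i _; rewrite mul0r.
rewrite /mass => ->; apply: prodr_gt0 => i _.
have -> : (fun y : R => fejer_pow y * cos (0 * y)) = fejer_pow.
  by apply/funext => y; rewrite mul0r cos0 mulr1.
exact: Rintegral_fejer_pow_gt0.
Qed.

End FejerPower.

Section FilteredSpan.
Variables (R : realType) (n npairs d D : nat) (r : R -> R) (rho : nat -> seq bool -> R).
Hypothesis npairs_le : (2 * npairs <= n)%N.
Hypothesis span_r : cos_span (harmonics 1 D) r.
Local Notation lam := (@lebesgue_Rn R n).
Local Notation all_phases := (@all_phases R npairs d).

Lemma all_phases0 : all_phases (fun=> 0).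
Proof. by exists (fun _ _ => 0); rewrite phase0. Qed.

Lemma all_phases_closed u v : all_phases u -> all_phases v ->
  all_phases (fun x => u x + v x) /\ all_phases (fun x => u x - v x).
Proof.
move=> [k1 ->] [k2 ->]; split.
  by exists (fun i s => k1 i s + k2 i s); rewrite phaseD.
by exists (fun i s => k1 i s - k2 i s); rewrite phaseB.
Qed.

Lemma phases_all C : phases npairs d C `<=` all_phases.
Proof. by move=> _ [k _ ->]; exists k. Qed.

Lemma span_selected i P : (i < npairs)%N -> cos_span all_phases (fun th => selected d r P (th i)).
Proof.
move=> ik; apply: cos_span_big => s sp.
exact: cos_span_sub (@phases_all _) (span_piece span_r ik sp).
Qed.

Lemma span_linearised i : (i < npairs)%N -> cos_span all_phases (fun th => linearised r d (th i)).
Proof.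
move=> ik; apply: cos_span_big => t; rewrite mem_leaves => /eqP td.
apply: (cos_spanM all_phases_closed); last exact: span_selected.
have tp : t \in paths d by rewrite mem_paths td.
apply: (cos_spanM all_phases_closed).
  have td' : (size ([::] ++ t) <= d)%N by rewrite /= td.
  exact: cos_span_sub (@phases_all _) (span_weight span_r ik td').
exact: cos_span_sub (@phases_all _) (span_branch span_r true ik tp).
Qed.

Lemma cos_spanX (X : Type) (K : set (X -> R)) H q : K (fun=> 0) ->
  (forall u v, K u -> K v -> K (fun x => u x + v x) /\ K (fun x => u x - v x)) ->
  cos_span K H -> cos_span K (fun x => H x ^+ q).
Proof.
move=> K0 KK sH; elim: q => [|q IHq].
  by rewrite (_ : (fun x => _) = fun=> 1); [exact: cos_span_cst|apply/funext => x; rewrite expr0].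
rewrite (_ : (fun x => _) = fun x => H x * H x ^+ q); last by apply/funext => x; rewrite exprS.
exact: cos_spanM KK sH IHq.
Qed.

Lemma cos_span_bounded (X : Type) (K : set (X -> R)) H : cos_span K H ->
  exists C, forall x, `|H x| <= C.
Proof.
elim=> [|c phi H' _ _ [C HC]]; first by exists 0 => x; rewrite normr0.
exists (`|c| + C) => x; apply: (le_trans (ler_normD _ _)); apply: lerD => //.
by rewrite normrM ler_piMr// cos_max.
Qed.

Lemma measurable_envelope_span T H : cos_span all_phases H ->
  measurable_fun setT (fun x : Rn R n => envelope x * H (angles rho T x)).
Proof.
move=> sH; have := integrable_span rho npairs_le (@integrable_fejer R) (@continuous_fejer R)
  (@fejer_ge0 R) (@fejerN R) T sH.
by case/integrableP => /measurable_EFinP.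
Qed.

Lemma measurable_filtered T P : measurable_fun setT (@filtered R n npairs d r rho T P).
Proof.
apply: (measurable_envelope_span _
  (H := fun th => \prod_(i < npairs) selected d r (P i) (th i))).
apply: (cos_span_prod _ all_phases0 all_phases_closed) => i _.
exact: span_selected.
Qed.

Lemma filtered_dom T P : exists C, forall x, `|@filtered R n npairs d r rho T P x| <= C * envelope x.
Proof.
have [C HC] := cos_span_bounded (cos_span_prod (index_enum 'I_npairs) (P := xpredT) all_phases0 all_phases_closed
  (fun i _ => span_selected (P i) (ltn_ord i))).
exists C => x; rewrite normrM (ger0_norm (envelope_ge0 _)) mulrC ler_wpM2r ?envelope_ge0//.
Qed.

End FilteredSpan.

(** * Norms of the test function and of its maximal function *)

Section MeanBounds.
Variables (R : realType) (d npairs q D M : nat) (r : R -> R).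
Hypotheses (q_gt0 : (0 < q)%N) (r_le1 : forall x, `|r x| <= 1) (M_gt0 : (0 < M)%N).
Hypotheses (avg_r : avg M r = 0) (avg_r2 : 1 - (2 * d.+1%:R)^-1 <= avg M (fun x => r x ^+ 2)).

Definition moment_bound : R := (2 * q)%:R ^+ (2 * q) * (2 * expR 2).

(** With [1 - rho <= 1 / (2 (d + 1))] the loss is at most one quarter. *)
Lemma mean_linearised_lower : d.+1%:R / 16 <= tree_mean M d (linearised r d).
Proof.
have := avg_r2; set rho := avg M _ => rho_ge.
have m1 : 1 <= d.+1%:R :> R by rewrite ler1n.
have rho1 : rho <= 1.
  rewrite /rho -(avg_cst M_gt0 1); apply: le_avg => x.
  by rewrite -(real_normK (num_real _)) exprn_ile1.
have := mean_linearised_ge M_gt0 avg_r (erefl rho) d.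
clearbody rho; have -> : d%:R = d.+1%:R - 1 :> R by rewrite -natr1 addrK.
move: (tree_mean M d _) (d.+1%:R) m1 rho_ge => Q m m1.
have meps : m * (2 * m)^-1 = 1 / 2 by field; lra.
have eps : (2 * m)^-1 <= 1 / 2 by rewrite div1r lef_pV2 ?posrE; lra.
move: (2 * m)^-1 meps eps => eps meps eps2 rho_ge.
have rho2 : 1 / 2 <= rho by lra.
have rho01 : 0 <= rho <= 1 by apply/andP; split; lra.
move=> /(_ rho01); apply: le_trans.
have e2 : (m - 1) * (1 - rho) <= m * eps by apply: ler_pM; lra.
have : m / 8 * (3 / 4) <= rho / 4 * m * (1 - (m - 1) * ((1 - rho) / 2)).
  apply: ler_pM; [lra|lra| |lra].
  by rewrite mulrC ler_wpM2r; lra.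
lra.
Qed.

Lemma mean_prod_linearised : (d.+1%:R / 16) ^+ npairs <=
  forest_mean M d npairs (fun th => \prod_(i < npairs) linearised r d (th i)).
Proof.
rewrite forest_mean_prod; apply: lerXn2r; rewrite ?nnegrE ?divr_ge0//.
  by apply: le_trans mean_linearised_lower; rewrite divr_ge0.
exact: mean_linearised_lower.
Qed.

Lemma mean_prod_tree_sum :
  forest_mean M d npairs (fun th => \prod_(i < npairs) (tree_sum r d (th i) / Num.sqrt d.+1%:R) ^+ (2 * q)) <=
  moment_bound ^+ npairs.
Proof.
rewrite (forest_mean_prod M d npairs (fun th => (tree_sum r d th / Num.sqrt d.+1%:R) ^+ (2 * q))).
apply: lerXn2r; rewrite ?nnegrE.
- rewrite -(tree_mean_cst M_gt0 d 0); apply: le_tree_mean => th.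
  by rewrite mulnC exprM; rewrite exprn_even_ge0.
- by rewrite mulr_ge0 ?exprn_ge0// mulr_ge0 ?expR_ge0.
- exact: mean_tree_sum_moment.
Qed.

End MeanBounds.

Lemma powR_root_le (R : realType) (p x y C : R) : 0 < p -> 0 <= x -> 0 <= y -> 0 <= C ->
  x `^ p^-1 <= C * y `^ p^-1 -> x <= C `^ p * y.
Proof.
move=> p0 x0 y0 C0 xy.
have := ge0_ler_powR (ltW p0) (x := x `^ p^-1) (y := C * y `^ p^-1).
rewrite !nnegrE powR_ge0 mulr_ge0 ?powR_ge0// => /(_ isT isT xy).
by rewrite powRM ?powR_ge0// -!powRrM mulVf ?gt_eqF// !powRr1.
Qed.

(** The comparison of norms, reduced to numbers: the p-th power of the maximal function
    has integral at least [mu h^p / 2] by the tangent at [h], that of the test function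
    at most [b^p mu (B + 2)]; and [h = b^2 / s] is larger than [b] by a factor
    of order [b]. *)
Lemma gain_of_norms (R : realType) (p C mu h b B s IF If X Y : R) :
  1 < p -> 0 <= C -> 0 < mu -> 0 < b -> 0 <= B -> 0 < s -> h = b * b / s ->
  IF <= C `^ p * If ->
  mu * ((1 - (2 * p)^-1) * h) <= X -> p * h `^ (p - 1) * X - (p - 1) * h `^ p * mu <= IF ->
  Y <= mu * (B + 1) -> If <= b `^ p * (mu + Y) ->
  (s * (2 * (B + 2)))^-1 * b <= C.
Proof.
move=> p1 C0 mu0 b0 B0 s0 hE FC lo lF up uf.
have p0 : 0 < p by lra.
have h0 : 0 < h by rewrite hE divr_gt0 ?mulr_gt0.
have [K KE] : exists K, K = 2 * (B + 2) by exists (2 * (B + 2)).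
have K1 : 1 <= K by rewrite KE; lra.
have h1 : mu * (h `^ p / 2) <= IF.
  apply: le_trans lF.
  have hp : h `^ p = h `^ (p - 1) * h.
    rewrite -[X in _ * X]powRr1 ?ltW// -powRD ?subrK//.
    by rewrite (gt_eqF h0) implybT.
  have c0 : 0 <= p * h `^ (p - 1) by rewrite mulr_ge0 ?powR_ge0 ?ltW.
  have := ler_wpM2l c0 lo; rewrite hp.
  have -> : p * h `^ (p - 1) * (mu * ((1 - (2 * p)^-1) * h)) =
      mu * (h `^ (p - 1) * h * (p - 2^-1)).
    by field; rewrite gt_eqF.
  lra.
have h2 : If <= b `^ p * (mu * (B + 2)).
  by apply: (le_trans uf); rewrite ler_wpM2l ?powR_ge0//; lra.
have h3 := ler_wpM2l (powR_ge0 C p) h2.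
have h4 : h `^ p <= C `^ p * b `^ p * K.
  have : mu * (h `^ p / 2) <= mu * (C `^ p * b `^ p * K / 2).
    apply: (le_trans h1); apply: (le_trans FC); apply: (le_trans h3).
    by rewrite le_eqVlt; apply/orP; left; apply/eqP; rewrite KE; field.
  by rewrite ler_pM2l//; lra.
have K0 : 0 <= K by lra.
have key : h `^ p <= (C * b * K) `^ p.
  rewrite !powRM ?mulr_ge0 ?(ltW b0)//; apply: (le_trans h4).
  rewrite ler_wpM2l ?mulr_ge0 ?powR_ge0// -[leLHS]powRr1//.
  by apply: ler_powR => //; exact: ltW.
have {}key : h <= C * b * K.
  rewrite leNgt; apply/negP => lt; move: key; rewrite leNgt => /negP; apply.
  by apply: gt0_ltr_powR => //; rewrite ?nnegrE ?(ltW h0)// !mulr_ge0// ltW.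
move: key; rewrite hE ler_pdivrMr// -KE => key.
rewrite mulrC ler_pdivrMr ?mulr_gt0//; last by lra.
rewrite -(ler_pM2l b0); apply: (le_trans key).
by rewrite le_eqVlt; apply/orP; left; apply/eqP; ring.
Qed.

Section Norms.
Variables (R : realType) (n npairs d D q : nat) (r : R -> R) (rho : nat -> seq bool -> R) (p : R).
Hypotheses (npairs_le : (2 * npairs <= n)%N) (q_gt0 : (0 < q)%N) (p_gt1 : 1 < p) (pq : p <= (2 * q)%:R).
Hypotheses (r_le1 : forall x, `|r x| <= 1) (span_r : cos_span (harmonics 1 D) r).
Hypothesis avg_r : forall M, (4 * D < M)%N -> avg M r = 0 /\
  1 - (2 * d.+1%:R)^-1 <= avg M (fun x => r x ^+ 2).
Local Notation lam := (@lebesgue_Rn R n).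
Local Notation Rn := (Rn R n).
Local Notation psi := (fejer_pow p).
Local Notation m := (d.+1%:R : R).

Let p1 : 1 <= p. Proof. exact: ltW. Qed.
Let p0 : 0 < p. Proof. exact: lt_trans ltr01 p_gt1. Qed.

Let tree_power (th : nat -> seq bool -> R) :=
  \prod_(i < npairs) (tree_sum r d (th i) / Num.sqrt m) ^+ (2 * q).
Let lin_prod (th : nat -> seq bool -> R) := \prod_(i < npairs) linearised r d (th i).

(** The size of the maximal function: a product of factors of order [d + 1]. *)
Definition height : R := (m / 16) ^+ npairs.

Lemma height_gt0 : 0 < height.
Proof. by rewrite exprn_gt0// divr_gt0. Qed.

Let span_tree_power : cos_span (@all_phases R npairs d) tree_power.
Proof.
apply: (cos_span_prod _ (@all_phases0 R npairs d) (@all_phases_closed R npairs d)) => i _.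
apply: (cos_spanX _ (@all_phases0 R npairs d) (@all_phases_closed R npairs d)).
rewrite (_ : (fun th => _) =
  fun th : nat -> seq bool -> R => (Num.sqrt m)^-1 * tree_sum r d (th i)).
  exact: cos_spanZ (span_selected d span_r xpredT (ltn_ord i)).
by apply/funext => th; rewrite mulrC.
Qed.

Let span_lin_prod : cos_span (@all_phases R npairs d) lin_prod.
Proof.
apply: (cos_span_prod _ (@all_phases0 R npairs d) (@all_phases_closed R npairs d)) => i _.
exact: (span_linearised d span_r (ltn_ord i)).
Qed.

Let integrable_psi_span T H : cos_span (@all_phases R npairs d) H ->
  lam.-integrable setT (EFin \o (fun x => tensor psi x * H (angles rho T x))).
Proof.
apply: (integrable_span rho npairs_le (integrable_fejer_pow p1) (continuous_fejer_pow p1)).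
- exact: fejer_pow_ge0.
- exact: fejer_powN.
Qed.

Let integrable_psi : lam.-integrable setT (EFin \o (fun x : Rn => tensor psi x)).
Proof.
have := integrable_psi_span 0 (cos_span_cst 1 (@all_phases0 R npairs d)).
by congr (_.-integrable _ _); apply/funext => x /=; rewrite mulr1.
Qed.

(** Both integrals converge, as [T] grows, to averages for which strict bounds are
    known. *)
Lemma near_integrals : \forall T \near \oo,
  \int[lam]_x (tensor psi x * tree_power (angles rho T x)) <=
    mass n psi * (moment_bound R q ^+ npairs + 1) /\
  mass n psi * ((1 - (2 * p)^-1) * height) <=
    \int[lam]_x (tensor psi x * lin_prod (angles rho T x)).
Proof.
have mass0 := mass_gt0 p1 n.
have lim H := mean_limit (d := d) rho npairs_le (integrable_fejer_pow p1) (continuous_fejer_pow p1)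
  (@fejer_pow_ge0 R p) (@fejer_powN R p) (fejer_pow_le_decay p1) (H := H).
have [M1 lim1] := lim _ span_tree_power; have [M2 lim2] := lim _ span_lin_prod.
(* Any grid fine enough for the two polynomials and for [r]. *)
pose M := maxn (maxn M1 M2) (4 * D).+1.
have DM : (4 * D < M)%N by rewrite leq_max leqnn orbT.
have M_gt0 : (0 < M)%N by apply: leq_ltn_trans DM.
have [avg0 avg2] := avg_r DM.
have {}lim1 := lim1 M _; have {}lim2 := lim2 M _.
have up := mean_prod_tree_sum d npairs q_gt0 r_le1 M_gt0 avg0.
have lo := @mean_prod_linearised R d npairs M r r_le1 M_gt0 avg0 avg2.
near=> T; split.
  apply/ltW; near: T; apply: (cvgr_lt _ (lim1 _)); first by rewrite !leq_max leqnn.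
  by rewrite ltr_pM2l// (le_lt_trans up)// ltrDl.
apply/ltW; near: T; apply: (cvgr_gt _ (lim2 _)); first by rewrite !leq_max leqnn orbT.
rewrite ltr_pM2l// (lt_le_trans _ lo)// gtr_pMl ?height_gt0// gtrBl invr_gt0.
by rewrite mulr_gt0.
Unshelve. all: by end_near. Qed.

(** The test function. *)
Definition tree_function T (x : Rn) : R := envelope x * \prod_(i < npairs) tree_sum r d (angles rho T x i).

Let sqrt_m0 : 0 < Num.sqrt m. Proof. by rewrite sqrtr_gt0. Qed.

(** Normalise every tree sum by its standard deviation and pass to the even power. *)
Lemma tree_function_powR T x : `|tree_function T x| `^ p <=
  (Num.sqrt m ^+ npairs) `^ p * (tensor psi x + tensor psi x * tree_power (angles rho T x)).
Proof.
have e0 := @envelope_ge0 R n x; have b0 : 0 <= Num.sqrt m ^+ npairs by rewrite exprn_ge0// ltW.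
pose y := \prod_(i < npairs) `|tree_sum r d (angles rho T x i) / Num.sqrt m|.
have y0 : 0 <= y by apply: prodr_ge0.
have -> : `|tree_function T x| = Num.sqrt m ^+ npairs * (envelope x * y).
  rewrite normrM (ger0_norm e0) normr_prod mulrCA; congr (_ * _).
  have -> : Num.sqrt m ^+ npairs = \prod_(i < npairs) Num.sqrt m by rewrite prodr_const card_ord.
  rewrite -big_split/=; apply: eq_bigr => i _.
  by rewrite normrM normfV (gtr0_norm sqrt_m0) mulrC divfK// gt_eqF.
rewrite !powRM// ?mulr_ge0//; apply: ler_wpM2l; first exact: powR_ge0.
rewrite tensor_fejer_pow -[X in _ <= X + _]mulr1 -mulrDr ler_wpM2l ?powR_ge0//.
apply: (le_trans (powR_le_even_power p1 y0 pq)); rewrite lerD2l /y -prodrXl le_eqVlt.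
apply/orP; left; apply/eqP; apply: eq_bigr => i _.
by rewrite exprM real_normK ?num_real// -exprM.
Qed.

Lemma measurable_tree_function T : measurable_fun setT (tree_function T).
Proof. exact: (measurable_filtered d rho npairs_le span_r T (fun _ => xpredT)). Qed.

Lemma integrable_tree_function T :
  lam.-integrable setT (EFin \o (fun x => `|tree_function T x| `^ p)).
Proof.
have [C HC] := filtered_dom n d rho span_r T (fun _ : 'I_npairs => xpredT).
exact: integrable_powR_dom p1 (measurable_tree_function T) HC.
Qed.

Lemma tree_function_norm T : \int[lam]_x (`|tree_function T x| `^ p) <=
  (Num.sqrt m ^+ npairs) `^ p *
  (mass n psi + \int[lam]_x (tensor psi x * tree_power (angles rho T x))).
Proof.
have ip := integrable_psi_span T span_tree_power.
have isum := integrableD measurableT integrable_psi ip.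
rewrite /mass -RintegralD// -RintegralZl//.
apply: le_Rintegral => //; first exact: integrable_tree_function.
- exact: (integrableZl measurableT _ isum).
- by move=> x _; exact: tree_function_powR.
Qed.

(** Tangent inequality at [height], integrated against [envelope ^ p]. *)
Lemma maximal_norm T F : lam.-integrable setT (EFin \o (fun x : Rn => `|F x| `^ p)) ->
  (forall x, envelope x * `|lin_prod (angles rho T x)| <= F x) ->
  p * height `^ (p - 1) * (\int[lam]_x (tensor psi x * lin_prod (angles rho T x))) -
    (p - 1) * height `^ p * mass n psi <= \int[lam]_x (`|F x| `^ p).
Proof.
move=> iF Fge; have h0 := height_gt0.
have il := integrable_psi_span T span_lin_prod.
have il' := integrableZl measurableT (p * height `^ (p - 1)) il.
have ip' := integrableZl measurableT ((p - 1) * height `^ p) integrable_psi.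
rewrite /mass -RintegralZl// -RintegralZl// -RintegralB//.
have iB := integrableB measurableT il' ip'.
apply: le_Rintegral => //.
move=> x _; have e0 := @envelope_ge0 R n x.
set H := lin_prod _; have H0 : 0 <= `|H| by [].
have F0 : 0 <= F x by apply: le_trans (Fge x); rewrite mulr_ge0.
apply: (@le_trans _ _ ((envelope x * `|H|) `^ p)); last first.
  apply: ge0_ler_powR; rewrite ?nnegrE ?mulr_ge0 ?(ltW p0)//.
  by rewrite [leRHS]ger0_norm// Fge.
rewrite powRM// tensor_fejer_pow.
have := powR_tangent p_gt1 h0 H0.
have : p * height `^ (p - 1) * H <= p * height `^ (p - 1) * `|H|.
  by rewrite ler_wpM2l ?ler_norm// mulr_ge0 ?powR_ge0// ltW.
move: (powR_ge0 (envelope x) p); move: (envelope x `^ p) (`|H| `^ p) => E Y E0 h1 h2.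
have h3 : p * height `^ (p - 1) * H - (p - 1) * height `^ p <= Y by lra.
have := ler_wpM2l E0 h3; rewrite mulrBr; lra.
Qed.

Definition lower_constant : R := (16 ^+ npairs * (2 * (moment_bound R q ^+ npairs + 2)))^-1.

(** The maximal function is larger than the test function by a factor of order
    [sqrt (d + 1)] per tree. *)
Lemma norm_gain : \forall T \near \oo, forall (F : Rn -> R) C, 0 <= C ->
  lam.-integrable setT (EFin \o (fun x => `|F x| `^ p)) ->
  (forall x, envelope x * `|lin_prod (angles rho T x)| <= F x) ->
  (Lnorm lam p%:E (EFin \o F) <= C%:E * LnormC p (realC (tree_function T)))%E ->
  lower_constant * Num.sqrt m ^+ npairs <= C.
Proof.
apply: filterS near_integrals => T [up lo] F C C0 iF Fge.
have lF := maximal_norm iF Fge; have uf := tree_function_norm T.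
have b0 : 0 < Num.sqrt m ^+ npairs by rewrite exprn_gt0.
have B0 : 0 <= moment_bound R q ^+ npairs.
  by rewrite exprn_ge0// mulr_ge0 ?exprn_ge0// mulr_ge0 ?expR_ge0.
have heightE : height = Num.sqrt m ^+ npairs * Num.sqrt m ^+ npairs / 16 ^+ npairs.
  by rewrite /height expr_div_n -exprMn -expr2 sqr_sqrtr.
rewrite LnormC_real ?gt_eqF// Lnorm_real ?gt_eqF//.
have fin (g : Rn -> R) : lam.-integrable setT (EFin \o (fun x => `|g x| `^ p)) ->
    ((\int[lam]_x (`|g x| `^ p)%:E) `^ p^-1 = ((\int[lam]_x (`|g x| `^ p)) `^ p^-1)%:E)%E.
  move=> ig; rewrite -poweR_EFin /Rintegral fineK//.
  exact: (integrable_fin_num measurableT ig).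
have IF0 : 0 <= \int[lam]_x (`|F x| `^ p) by apply: Rintegral_ge0 => x _; exact: powR_ge0.
have If0 : 0 <= \int[lam]_x (`|tree_function T x| `^ p).
  by apply: Rintegral_ge0 => x _; exact: powR_ge0.
rewrite (fin _ iF) (fin _ (integrable_tree_function T)) -EFinM lee_fin => FC.
have {}FC := powR_root_le p0 IF0 If0 C0 FC.
have s0 : 0 < 16 ^+ npairs :> R by rewrite exprn_gt0.
exact: (gain_of_norms p_gt1 C0 (mass_gt0 p1 n) b0 B0 s0 heightE FC lo lF up uf).
Qed.

End Norms.

(** * The lower bound *)

Section PairIndex.
Variable n : nat.

Lemma pair_fst_lt (i : 'I_n./2) : (2 * i < n)%N.
Proof. by have := ltn_ord i; lia. Qed.

Lemma pair_snd_lt (i : 'I_n./2) : ((2 * i).+1 < n)%N.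
Proof. by have := ltn_ord i; lia. Qed.

(** Pairs without common coordinates, as many as the dimension allows. *)
Definition disjoint_pair (i : 'I_n./2) : Sigma n :=
  exist (fun s : 'I_n * 'I_n => (s.1 < s.2)%N) (Ordinal (pair_fst_lt i), Ordinal (pair_snd_lt i)) (ltnSn _).

Lemma disjoint_pair_inj : injective disjoint_pair.
Proof.
move=> i j /(congr1 (fun s : Sigma n => nat_of_ord (val s).1)) /= ij.
by apply: val_inj => /=; lia.
Qed.

End PairIndex.

Lemma fset_extend (T : choiceType) (A : {fset T}) (f : nat -> T) N : injective f -> (#|` A| <= N)%N ->
  exists2 B : {fset T}, (A `<=` B)%fset & #|` B| = N.
Proof.
move=> finj AN; rewrite -(subnKC AN); elim: (N - #|` A|)%N => [|k [B AB cB]].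
  by exists A; rewrite ?addn0// fsubset_refl.
have [j jB] : exists j, f j \notin B.
  apply: contrapT => /forallNP h.
  have fB : {subset [seq f i | i <- iota 0 #|` B|.+1] <= enum_fset B}.
    by move=> _ /mapP[j _ ->]; apply: contrapT => jB; apply: (h j); apply/negP.
  have := uniq_leq_size _ fB; rewrite map_inj_uniq ?iota_uniq// size_map size_iota.
  by move=> /(_ isT); rewrite ltnn.
exists (f j |` B)%fset; first by apply: fsubset_trans AB (fsubsetU1 _ _).
by rewrite cardfsU1 jB cB addnS.
Qed.

Section MaxDominated.
Variables (R : realType) (n : nat).
Local Notation Rn := (Rn R n).

Lemma bigmax_dominated (I : Type) (s : seq I) (G : I -> Rn -> R) :
  (forall i, measurable_fun setT (G i)) ->
  (forall i, exists C, forall x, `|G i x| <= C * envelope x) ->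
  measurable_fun setT (fun x => \big[Num.max/0]_(i <- s) `|G i x|) /\
  exists C, forall x, `|\big[Num.max/0]_(i <- s) `|G i x| | <= C * envelope x.
Proof.
move=> mG dG; elim: s => [|i s [ms [C HC]]].
  split; first by rewrite (_ : (fun x => _) = fun=> 0) //; apply/funext => x; rewrite big_nil.
  by exists 0 => x; rewrite big_nil normr0 mul0r.
have E x : \big[Num.max/0]_(j <- i :: s) `|G j x| = Num.max `|G i x| (\big[Num.max/0]_(j <- s) `|G j x|).
  by rewrite big_cons.
split.
  rewrite (funext E); apply: measurable_maxr => //.
  by apply: measurableT_comp => //; exact: normr_measurable.
have [C' HC'] := dG i; exists (`|C| + `|C'|) => x; rewrite E.
have e0 := @envelope_ge0 R n x.
have CC (c : R) : c * envelope x <= `|c| * envelope x by rewrite ler_wpM2r ?ler_norm.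
rewrite mulrDl; case: (leP `|G i x|) => _.
  by apply: (le_trans (HC x)); apply: (le_trans (CC C)); rewrite lerDl mulr_ge0.
by rewrite normr_id; apply: (le_trans (HC' x)); apply: (le_trans (CC C')); rewrite lerDr mulr_ge0.
Qed.

End MaxDominated.

Lemma le_bigmax_mem (R : realDomainType) (I : eqType) (s : seq I) (F : I -> R) i : i \in s ->
  F i <= \big[Num.max/0]_(j <- s) F j.
Proof.
elim: s => // j s IHs; rewrite inE big_cons le_max => /predU1P[->|/IHs ->]; first by rewrite lexx.
by rewrite orbT.
Qed.

Section LowerBound.
Variables (R : realType) (n q : nat) (phip phim : R -> R) (p : R).
Hypotheses (n_ge2 : (2 <= n)%N) (phipP : cutoff_pos n phip) (phimP : cutoff_neg n phim).
Hypotheses (p_gt1 : 1 < p) (q_gt0 : (0 < q)%N) (pq : p <= (2 * q)%:R).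
Local Notation sigma := (@disjoint_pair n).

(** The test function is mapped by the scales [scale_of t] to products of partial sums,
    whose maximum over [t] is at least the product of the linearised sums, in absolute
    value. *)
Lemma op_norm_lower d (e : signs n) (L : {fset scales n}) :
  (forall t : 'I_n./2 -> seq bool, (forall i, size (t i) = d) -> scale_of d sigma e t \in L) ->
  ((lower_constant R n./2 q * Num.sqrt d.+1%:R ^+ n./2)%:E <=
   op_norm p (max_op phip phim p e [set sigma i | i : 'I_n./2]%SET L))%E.
Proof.
move=> Lt; have p1 : 1 <= p := ltW p_gt1.
have eps0 : 0 < (2 * d.+1%:R)^-1 :> R by rewrite invr_gt0 mulr_gt0.
have [r [D [r_le1 span_r avg_r]]] := near_sign eps0.
have npairs_le : (2 * n./2 <= n)%N by lia.
have s1 (i : 'I_n./2) : (val (sigma i)).1 = (2 * i)%N :> nat by [].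
have s2 (i : 'I_n./2) : (val (sigma i)).2 = (2 * i).+1 :> nat by [].
pose rho := slope R d sigma e.
have near_K := K_op_filtered d npairs_le span_r n_ge2 phipP phimP e s1 s2 (@disjoint_pair_inj n) p1.
have near_gain := norm_gain rho npairs_le q_gt0 p_gt1 pq r_le1 span_r avg_r.
have [T [KT gain]] := filter_ex (filterI near_K near_gain).
apply: le_ereal_inf_tmp => _ [C [C0 HC] <-]; rewrite lee_fin.
pose G (l : scales n) := @filtered R n n./2 d r rho T
  (fun i s => kept (e (sigma i)) (l (sigma i)) (inorder_pos d s)).
pose F (x : Rn R n) := \big[Num.max/0]_(l <- L) `|G l x|.
have mG l : measurable_fun setT (G l) by exact: (measurable_filtered d rho npairs_le span_r).
have dG l : exists C, forall x, `|G l x| <= C * envelope x by exact: (filtered_dom n d rho span_r).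
have [mF [K HK]] := bigmax_dominated L mG dG.
apply: (gain F C C0).
- exact: integrable_powR_dom p1 mF HK.
- move=> x; rewrite normr_prod.
  have best i : exists t, size t = d /\
      `|linearised r d (angles rho T x i)| <= `|part_sum r d t (angles rho T x i)|.
    by have [t ? ?] := linearised_le_part d r_le1 (angles rho T x i); exists t.
  pose t (i : 'I_n./2) := projT1 (cid (best i)).
  have td i : size (t i) = d by rewrite /t; case: cid => ? [].
  apply: le_trans (le_bigmax_mem (fun l => `|G l x|) (Lt t td)).
  rewrite /G filtered_scale_of//; last exact: disjoint_pair_inj.
  rewrite normrM (ger0_norm (envelope_ge0 _)) ler_wpM2l ?envelope_ge0// normr_prod.
  apply: ler_prod => i _; rewrite normr_ge0 /= /t; case: cid => u /= [_]; exact.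
apply: HC.
  apply: LfunC_real; first exact: lt_trans ltr01 p_gt1.
    exact: (measurable_tree_function d rho npairs_le span_r).
  exact: (integrable_tree_function d rho npairs_le p_gt1 span_r).
exists (fun l => realC (G l)) => [l _|x]; first exact: KT.
by apply: eq_bigr => l _; rewrite -normc_real.
Qed.

End LowerBound.

(** [2 ^ (k * d)] scales are available and [2 ^ (k * (d + 1))] exceeds [N]. *)
Lemma ln_le_log (R : realType) (N d k : nat) : (0 < N)%N -> (0 < k)%N ->
  d = (trunc_log 2 N %/ k)%N -> ln N%:R <= (k * d.+1)%:R :> R.
Proof.
move=> N0 k0 dE; have NL : (N <= 2 ^ (k * d.+1))%N.
  apply: leq_trans (ltnW (trunc_log_ltn N (isT : 1 < 2)%N)) _.
  by rewrite leq_exp2l// dE mulnC ltn_ceil.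
have : ln N%:R <= ln (2 ^ (k * d.+1))%:R :> R.
  by rewrite ler_ln ?posrE ?ltr0n ?expn_gt0// ler_nat.
rewrite natrX lnXn// => /le_trans; apply.
rewrite -[ln 2 *+ _]mulr_natl ler_piMr//.
have := @le_ln1Dx R 1; have -> : 1 + 1 = 2 :> R by ring.
by apply; lra.
Qed.

Theorem theorem6p3 (R : realType) (n : nat) (n_ge2 : (2 <= n)%N)
    (phip phim : R -> R)
    (phipP : cutoff_pos n phip) (phimP : cutoff_neg n phim)
    (p : R) (p_gt1 : 1 < p) :
  exists2 c : R, 0 < c &
    forall N : nat, (0 < N)%N ->
      ((c * Num.sqrt (ln N%:R) ^+ n./2)%:E <=
        ereal_inf [set
          ereal_sup [set
            ereal_sup [set op_norm p (max_op phip phim p e U L) |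
              U in [set U : {set Sigma n} | U != finset.set0]] |
            L in [set L : {fset scales n} | #|` L| = N]] |
          e in [set: signs n]])%E.
Proof.
set k := n./2; have k0 : (0 < k)%N by rewrite /k; lia.
have p0 : 0 <= p by lra.
(* Half the order of an even moment that dominates the power [p]. *)
pose q := Num.bound p; have pq' : p < q%:R := archi_boundP p0.
have q0 : (0 < q)%N by rewrite -(ltr_nat R); apply: le_lt_trans p0 pq'.
have pq : p <= (2 * q)%:R by apply: (le_trans (ltW pq')); rewrite ler_nat; lia.
set c1 := lower_constant R k q.
have c1_gt0 : 0 < c1.
  rewrite invr_gt0 mulr_gt0 ?exprn_gt0// mulr_gt0// ltr_wpDl//.
  by rewrite exprn_ge0// mulr_ge0 ?exprn_ge0// mulr_ge0 ?expR_ge0.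
have sk0 : 0 < Num.sqrt k%:R :> R by rewrite sqrtr_gt0 ltr0n.
exists (c1 / Num.sqrt k%:R ^+ k); first by rewrite divr_gt0// exprn_gt0.
move=> N N0; apply: le_ereal_inf_tmp => _ [e _ <-].
(* The deepest trees for which [k] leaves give at most [N] scales. *)
pose d := (trunc_log 2 N %/ k)%N.
pose tuples : seq (scales n) := [seq scale_of d (@disjoint_pair n) e (fun i => tval (t i)) |
  t : {ffun 'I_k -> d.-tuple bool} <- enum {: {ffun 'I_k -> d.-tuple bool}}].
pose A : {fset scales n} := [fset l in tuples]%fset.
have AN : (#|` A| <= N)%N.
  rewrite card_fseq; apply: leq_trans (size_undup _) _.
  rewrite size_map -cardE card_ffun card_tuple card_bool card_ord -expnM.
  apply: leq_trans (trunc_logP (isT : 1 < 2)%N N0).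
  by rewrite leq_exp2l// leq_trunc_div.
(* Further scales, enough to reach the cardinality [N]. *)
pose const (j : nat) : scales n := [ffun=> j%:Z].
have const_inj : injective const.
  move=> i j /ffunP/(_ (disjoint_pair (Ordinal k0))).
  by rewrite !ffunE => -[].
have [L AL LN] := fset_extend const_inj AN.
apply: le_ereal_sup_tmp; eexists; first by exists L.
apply: le_ereal_sup_tmp; eexists.
  exists [set disjoint_pair i | i : 'I_k]%SET => //=.
  by apply/finset.set0Pn; exists (disjoint_pair (Ordinal k0)); exact: imset_f.
have Lt (t : 'I_n./2 -> seq bool) : (forall i, size (t i) = d) ->
    scale_of d (@disjoint_pair n) e t \in L.
  move=> td; apply: (fsubsetP AL); rewrite in_fset; apply/mapP.
  have td' i : size (t i) == d by apply/eqP.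
  exists [ffun i => Tuple (td' i)]; first by rewrite mem_enum.
  by congr scale_of; apply/funext => i; rewrite ffunE.
apply: le_trans (op_norm_lower n_ge2 phipP phimP p_gt1 q0 pq Lt).
rewrite lee_fin -/k -/c1 -mulrA ler_pM2l// mulrC ler_pdivrMr ?exprn_gt0//.
rewrite -exprMn; apply: lerXn2r; rewrite ?nnegrE ?mulr_ge0 ?sqrtr_ge0//.
rewrite -sqrtrM// ler_wsqrtr//; apply: (le_trans (ln_le_log R N0 k0 (erefl d))).
by rewrite natrM mulrC.
Qed.
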